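(* Let $H\in(\frac12,\frac34)$, let $\theta\in(0,1)$, and let $\xi=(\xi_t)_{t\in\mathbb Z}$ be a centered stationary Gaussian sequence satisfying the Hypothesis stated in the context with this $H$. Let $X_0=0$, $X_t=\theta X_{t-1}+\xi_t$ for $t\ge1$, and let $\tilde\theta_n=f^{-1}\big(\frac1n\sum_{t=1}^nX_t^2\big)$ be the second moment estimator of $\theta$. Let $Z$ be a standard Gaussian random variable and $\sigma_H=\big(2\sum_{k\in\mathbb Z}R^2(k)\big)^{1/2}$, where $R(k)=\mathbb E(Y_0Y_k)$ is the covariance function of the stationary solution $Y_t=\sum_{j=0}^\infty\theta^j\xi_{t-j}$. Then for every $\epsilon>0$ there exists a constant $C>0$ (independent of $n$) such that for all $n$ large enough, $$\sup_{z\in\mathbb R}\left|P\left\{\frac{f'(\theta)\sqrt n\,(\tilde\theta_n-\theta)}{\sigma_H}\le z\right\}-P\{Z\le z\}\right|\le C\,\varphi_\epsilon(n),$$ where $$\varphi_\epsilon(n)=\begin{cases}n^{-(\frac12-\epsilon)}, & H\in(\frac12,\frac58),\\ n^{-(3-4H-\epsilon)}, & H\in[\frac58,\frac34).\end{cases}$$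
   Context: **Slow variation.** A positive function $L$ defined for $x>x_0$ is slowly varying at infinity in Zygmund's sense if for every $\delta>0$, $x^{\delta}L(x)$ is increasing and $x^{-\delta}L(x)$ is decreasing for $x$ large enough. **Hypothesis (on $\xi$).** $\xi=(\xi_t)_{t\in\mathbb Z}$ is a centered stationary Gaussian sequence whose covariance function $\rho(k)=\mathbb E(\xi_0\xi_k)$ satisfies $\rho(0)=1$ and $\rho(k)=L(|k|)\,|k|^{2H-2}$ for $k\in\mathbb Z\setminus\{0\}$, where $H\in(\frac12,1)$, $L:(0,\infty)\to(0,\infty)$ is slowly varying at infinity in Zygmund's sense, and $\lambda\mapsto L(1/\lambda)$ is of bounded variation on $(a,\pi)$ for every $a>0$. **Function $f$ and estimator.** For $\vartheta\in(0,1)$, $f(\vartheta)=\sum_{i,j=0}^\infty\vartheta^{i+j}\rho(i-j)$; it equals $\mathbb E(Y_t^2)$ for the stationary solution $Y_t=\sum_{j\ge0}\vartheta^j\xi_{t-j}$ of the autoregression with parameter $\vartheta$. It is positive and strictly increasing on $(0,1)$, $f'$ is its derivative, and $f^{-1}$ denotes its inverse, defined on the range $f((0,1))$. On the event that $\frac1n\sum_{t=1}^nX_t^2\notin f((0,1))$, $\tilde\theta_n$ is set equal to an arbitrary fixed value in $(0,1)$. *)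

(* Defs.v *)
From HB Require Import structures.
From mathcomp Require Import all_boot all_order all_algebra.
From mathcomp Require Import all_classical all_reals all_analysis.

Set Implicit Arguments.
Unset Strict Implicit.
Unset Printing Implicit Defensive.
Import Order.TTheory GRing.Theory Num.Theory.
Import numFieldNormedType.Exports.
Local Open Scope classical_set_scope.
Local Open Scope ring_scope.

(* Monotone is meant in the weak sense; as d ranges over all positive reals,
   this is equivalent to the version with strict monotonicity. *)
Definition zygmund_slowly_varying (R : realType) (L : R -> R) : Prop :=
  forall d : R, 0 < d ->
    \forall a \near +oo,
      (forall x y, a < x -> x <= y -> x `^ d * L x <= y `^ d * L y) /\
      (forall x y, a < x -> x <= y -> y `^ (- d) * L y <= x `^ (- d) * L x).

(* Bounded variation on the open interval ]a, b[. *)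
Definition bounded_variation_oo (R : realType) (a b : R) (f : R -> R) : Prop :=
  exists M : R, forall c e, a < c -> c <= e -> e < b ->
    (total_variation c e f <= M%:E)%E.

(* The degenerate case has to be treated apart: [normal_prob m 0] is the
   uniform law on [0, 1], not the Dirac mass at m. *)
Definition gaussian_law (R : realType) (mu : set (measurableTypeR R) -> \bar R)
    : Prop :=
  exists m : R,
    (forall A, measurable A -> mu A = \d_m A) \/
    (exists s : R, 0 < s /\ forall A, measurable A -> mu A = normal_prob m s A).

Definition gaussian_seq d (T : measurableType d) (R : realType)
    (P : probability T R) (xi : int -> {RV P >-> R}) : Prop :=
  forall (n : nat) (t : 'I_n -> int) (a : 'I_n -> R),
    gaussian_law (fun A => P ((fun w => \sum_(i < n) a i * xi (t i) w) @^-1` A)).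

Definition stationary_seq d (T : measurableType d) (R : realType)
    (P : probability T R) (xi : int -> {RV P >-> R}) : Prop :=
  forall (n : nat) (t : 'I_n -> int) (h : int)
      (A : set (n.-tuple (measurableTypeR R))), measurable A ->
    P [set w | A [tuple xi (t i + h) w | i < n]] =
    P [set w | A [tuple xi (t i) w | i < n]].

(* X_0 = 0 and X_t = theta X_(t-1) + xi_t *)
Fixpoint ar_process (T : Type) (R : realType) (xi : int -> T -> R) (theta : R)
    (t : nat) (w : T) : R :=
  if t is t'.+1 then theta * ar_process xi theta t' w + xi t%:Z w else 0.

(* Y_t = sum_(j >= 0) theta^j xi_(t-j), as a pointwise limit; under the
   hypotheses of use the series converges almost surely. *)
Definition stationary_solution (T : Type) (R : realType) (xi : int -> T -> R)
    (theta : R) (t : int) (w : T) : R :=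
  limn (series (fun j : nat => theta ^+ j * xi (t - j%:Z) w)).

Definition solution_cov d (T : measurableType d) (R : realType)
    (P : probability T R) (xi : int -> {RV P >-> R}) (theta : R) (k : int) : R :=
  fine 'E_P[stationary_solution xi theta 0 \* stationary_solution xi theta k].

Definition sigmaH d (T : measurableType d) (R : realType)
    (P : probability T R) (xi : int -> {RV P >-> R}) (theta : R) : R :=
  Num.sqrt
    (2 * fine (\esum_(k in [set: int]) ((solution_cov xi theta k) ^+ 2)%:E)).

(* f(v) = sum_(i, j >= 0) v^(i+j) rho(i-j) *)
Definition second_moment (R : realType) (rho : int -> R) (v : R) : R :=
  limn (series (fun i : nat =>
    limn (series (fun j : nat => v ^+ (i + j) * rho (i%:Z - j%:Z))))).

(* f^-1 on the range f(]0, 1[), and theta0 outside of it *)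
Definition second_moment_inv (R : realType) (rho : int -> R) (theta0 m : R) : R :=
  xget theta0 [set v | 0 < v < 1 /\ second_moment rho v = m].

Definition second_moment_estimator (T : Type) (R : realType)
    (xi : int -> T -> R) (rho : int -> R) (theta theta0 : R) (n : nat) (w : T)
    : R :=
  second_moment_inv rho theta0
    (n%:R^-1 * \sum_(1 <= t < n.+1) (ar_process xi theta t w) ^+ 2).

Definition phi_rate (R : realType) (H eps : R) (n : nat) : R :=
  if H < 5 / 8 then n%:R `^ (- (1 / 2 - eps))
  else n%:R `^ (- (3 - 4 * H - eps)).

(* Main.v *)
Require Import Defs.
From HB Require Import structures.
From mathcomp Require Import all_boot all_order all_algebra.
From mathcomp Require Import all_classical all_reals all_analysis.
From mathcomp Require Import measurable_realfun ring lra zify.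
Set Implicit Arguments.
Unset Strict Implicit.
Unset Printing Implicit Defensive.
Import Order.TTheory GRing.Theory Num.Theory.
Import numFieldNormedType.Exports.
Local Open Scope classical_set_scope.
Local Open Scope ring_scope.

(* The estimator is a monotone function of m_n = (1/n) sum_t X_t^2, where (X_1, ..., X_n) is a
   centered Gaussian vector. For such a vector with covariance matrix S, put Q = |X|^2 and
   v = Var Q = 2 tr S^2. Gaussian integration by parts gives
     E (Q - E Q) g(Q) = E Gamma g'(Q)   with   Gamma = 2 X^T S X,
   so by Stein's equation the Kolmogorov distance between (Q - E Q) / sqrt v and N(0, 1) is at most
   (2 / v) E |Gamma - v| <= 2 sqrt(8 tr S^4) / v.
   The vector X may be degenerate, so the integration by parts is not done with a density: it is
   derived from E cos(V) = exp(- Var V / 2) for the one-dimensional marginals V, by writing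
   exp(- X_t^2) as a Gaussian mixture of cosines and approximating functions of Q by polynomials
   in exp(- s Q) (Weierstrass).
   Slow variation yields rho(k) = O((1 + |k|)^(-a)) for a slightly below 2 - 2H, whence
   tr S^4 = O(n^(1 + max(0, 3 - 4a) + delta)) and v = n sigma_H^2 + O(n^(2 - 2a)).
   Finally { f^-1(m_n) <= c } is { m_n <= f(c) } up to an event of probability O(n^(-1/2) + distance),
   and by a second-order Taylor expansion of f the threshold z is moved by at most |z|/2 and by
   O(n^b |z| + n^(-1/2) z^2 + n^(-1/2)), which the decay of the normal density turns into an error
   uniform in z. *)

(** * Weierstrass approximation *)

(** Once v >= 2n is inserted, the Stein error is of order n^(max(-1/2, 1-2a) + dl/2), and trading v
    for n sigma_H^2 costs n^(1-2a). As a approaches 2-2H the exponent 1-2a tends to 4H-3, which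
    overtakes -1/2 exactly at H = 5/8; [eps] pays for the slowly varying factor and for the
    logarithm in the critical power sum. The condition H < 3/4 enters as 2a > 1, the square
    summability of R. Since rho is positive, the series for f, f' and R have nonnegative terms:
    truncations increase, and estimates are proved on finite double sums and passed to monotone
    limits. The quadratic form is centred and scaled by its exact mean and variance, so that Stein's
    method meets no bias; the gaps between v and n sigma_H^2 and between E m_n and f(theta) only
    move the threshold. Far thresholds, where the shifted parameter may leave (0, 1), are treated
    apart: there |z| is at least of order sqrt n and both distribution functions are close to 0 or
    to 1. *)

Section weierstrass.
Context (R : realType).

(* The n-th Bernstein polynomial of phi, i.e. E phi(Bin(n, X)), computed by conditioning on the first trial. *)
Fixpoint bernstein (n : nat) (phi : nat -> R) : {poly R} :=
  if n is n'.+1 then 'X * bernstein n' (phi \o S) + (1 - 'X) * bernstein n' phi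
  else (phi 0%N)%:P.

Lemma bernsteinS n phi y : (bernstein n.+1 phi).[y] =
  y * (bernstein n (phi \o S)).[y] + (1 - y) * (bernstein n phi).[y].
Proof. by rewrite /= !hornerE. Qed.

Lemma bernstein_lin n phi psi (a b y : R) :
  (bernstein n (fun k => a * phi k + b * psi k)).[y] =
  a * (bernstein n phi).[y] + b * (bernstein n psi).[y].
Proof.
elim: n phi psi => [|n IH] phi psi; first by rewrite /= !hornerE.
by rewrite !bernsteinS (IH (phi \o S) (psi \o S)) IH; ring.
Qed.

Lemma bernstein_le n phi psi (y : R) : 0 <= y <= 1 -> (forall k, (k <= n)%N -> phi k <= psi k) ->
  (bernstein n phi).[y] <= (bernstein n psi).[y].
Proof.
move=> /andP[y0 y1]; elim: n phi psi => [|n IH] phi psi h; first by rewrite /= !hornerE h.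
rewrite !bernsteinS lerD// ler_wpM2l ?subr_ge0// IH// => k kn.
  exact: h.
by rewrite h// ltnW// ltnS.
Qed.

Lemma bernstein_cst n (c y : R) : (bernstein n (fun=> c)).[y] = c.
Proof. by elim: n => [|n IH]; rewrite ?bernsteinS ?IH /= ?hornerE//; ring. Qed.

(** The second moment of Bin(n, y) about a is its variance plus its squared bias. A general centre a
    is what the induction needs, since a successful first trial shifts it by one. *)
Lemma bernstein_sqr n (a y : R) :
  (bernstein n (fun k => (k%:R - a) ^+ 2)).[y] = n%:R * y * (1 - y) + (n%:R * y - a) ^+ 2.
Proof.
elim: n a => [|n IH] a; first by rewrite /= !hornerE.
rewrite bernsteinS IH.
rewrite (_ : _ \o S = fun k : nat => (k%:R - (a - 1)) ^+ 2); last first.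
  by apply/funext => k /=; rewrite -natr1; congr (_ ^+ 2); ring.
by rewrite IH -natr1; ring.
Qed.

Lemma heine01 (f : R -> R) (e : R) : continuous f -> 0 < e ->
  exists2 d : R, 0 < d & forall x y, 0 <= x <= 1 -> `|x - y| < d -> `|f x - f y| < e.
Proof.
move=> cf e0.
have := @segment_compact R 0 1 => /compact_near_coveringP.
move=> /(_ R 0^'+ (fun d x => forall y, `|x - y| < d -> `|f x - f y| < e)) h.
have {h}: \forall d \near 0^'+, `[0, 1]%classic `<=`
    (fun x : R => forall y : R, `|x - y| < d -> `|f x - f y| < e).
  apply: h => x _.
  have e20 : 0 < e / 2 by rewrite divr_gt0.
  have /cvgrPdist_lt/(_ _ e20)[d/= d0 fd] := cf x.
  exists (ball x (d / 2), [set t | t < d / 2]).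
    split => /=; first by apply: nbhsx_ballx; rewrite divr_gt0.
    by apply: nbhs_right_lt; rewrite divr_gt0.
  move=> [x' t]/= [xx' td] y x'y.
  have h1 : `|f x - f x'| < e / 2.
    by apply: fd; rewrite /ball/= in xx' *; rewrite (lt_trans xx')// ltr_pdivrMr// ltr_pMr// ltr1n.
  have h2 : `|f x - f y| < e / 2.
    apply: fd; rewrite /ball/= in xx' *.
    rewrite (splitr d) -(subrK x' x) -addrA (le_lt_trans (ler_normD _ _))// ltrD//.
    exact: lt_trans td.
  rewrite (splitr e) -(subrK (f x) (f x')) -addrA (le_lt_trans (ler_normD _ _))// ltrD//.
  by rewrite distrC.
move=> H.
have [d [d0 hd]] : exists d : R, 0 < d /\ `[0, 1]%classic `<=`
    (fun x : R => forall y : R, `|x - y| < d -> `|f x - f y| < e).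
  have : \forall d \near (0 : R)^'+, 0 < d /\ `[0, 1]%classic `<=`
    (fun x : R => forall y : R, `|x - y| < d -> `|f x - f y| < e).
    by apply: filterS2 H (nbhs_right_gt (0 : R)) => d h d0; split.
  by move/(@filter_ex _ _ _); exact.
by exists d => // x y x01; apply: hd; rewrite /= in_itv/=.
Qed.

(** Chebyshev's argument: if k/n is within d of y, uniform continuity bounds the oscillation of f by
    e/2; otherwise K (k/n - y)^2 with K = 2M/d^2 exceeds 2M. Averaging over the binomial law turns
    the square into the variance y(1-y)/n. *)
Lemma weierstrass (f : R -> R) (e : R) : continuous f -> 0 < e ->
  exists p : {poly R}, forall y, 0 <= y <= 1 -> `|p.[y] - f y| <= e.
Proof.
move=> cf e0.
have e20 : 0 < e / 2 by rewrite divr_gt0.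
have [d d0 fd] := heine01 cf e20.
have [M M0 fM] : exists2 M, 0 < M & forall y, 0 <= y <= 1 -> `|f y| <= M.
  have cnf : {within `[(0 : R), 1], continuous (fun x => `|f x|)}.
    by apply: continuous_subspaceT => x; apply: continuous_comp; [exact: cf|exact: norm_continuous].
  have [c _ h] := EVT_max ler01 cnf.
  exists (`|f c| + 1); first by rewrite ltr_wpDl.
  by move=> y y01; rewrite (le_trans (h y _)) ?in_itv//= lerDl.
pose K := 2 * M / d ^+ 2.
have K0 : 0 < K by rewrite divr_gt0 ?exprn_gt0// mulr_gt0.
(* The averaged quadratic term is at most K/n, which this n pushes below e/2. *)
pose n := (Num.truncn (K / (e / 2))).+1.
have nn0 : n%:R != 0 :> R by rewrite pnatr_eq0.
have Kn : K / n%:R <= e / 2.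
  rewrite ler_pdivrMr ?ltr0n// mulrC -ler_pdivrMr// ltW//.
  exact: truncnS_gt.
exists (bernstein n (fun k => f (k%:R / n%:R))) => y y01.
have bnd k : (k <= n)%N ->
    `|f (k%:R / n%:R) - f y| <= e / 2 + K * ((k%:R - n%:R * y) / n%:R) ^+ 2.
  move=> kn; set x := k%:R / n%:R.
  have x01 : 0 <= x <= 1.
    by rewrite divr_ge0//= ler_pdivrMr ?ltr0n// mul1r ler_nat.
  have -> : (k%:R - n%:R * y) / n%:R = x - y by rewrite /x; field.
  have [xy|xy] := ltP `|x - y| d.
    by rewrite (le_trans (ltW (fd _ _ x01 xy)))// lerDl mulr_ge0 ?sqr_ge0// ltW.
  rewrite (le_trans (ler_normB _ _))// (le_trans (lerD (fM _ x01) (fM _ y01)))//.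
  apply: ler_wpDl; first exact: ltW.
  rewrite /K mulrAC ler_pdivlMr ?exprn_gt0// -mulr2n mulr_natl ler_wpM2l//.
    by rewrite mulrn_wge0// ltW.
  by rewrite -(real_normK (num_real (x - y))) ler_pXn2r// ?nnegrE// ltW.
have q : (bernstein n (fun k => (e / 2) * 1 + K / n%:R ^+ 2 * (k%:R - n%:R * y) ^+ 2)).[y] <= e.
  rewrite (bernstein_lin n (fun=> 1)) bernstein_cst bernstein_sqr subrr expr0n/= addr0 mulr1.
  have -> : K / n%:R ^+ 2 * (n%:R * y * (1 - y)) = K / n%:R * (y * (1 - y)) by field.
  rewrite [leRHS](splitr e) lerD2l (le_trans _ Kn)// ler_piMr//.
    by rewrite divr_ge0// ltW.
  move/andP : y01 => [y0 y1]; nra.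
rewrite ler_norml; apply/andP; split.
  rewrite lerNl opprB; apply: le_trans q.
  rewrite -[X in X - _](bernstein_cst n (f y) y).
  rewrite -[X in X - _]mul1r -[X in _ - X]mul1r -mulNr -bernstein_lin.
  apply: bernstein_le => // k kn.
  rewrite mul1r mulN1r mulr1 (le_trans (ler_norm _))// distrC (le_trans (bnd k kn))//.
  by rewrite expr_div_n mulrA mulrAC.
apply: le_trans q.
rewrite -[X in _ - X](bernstein_cst n (f y) y).
rewrite -[X in X - _]mul1r -[X in _ - X]mul1r -mulNr -bernstein_lin.
apply: bernstein_le => // k kn.
rewrite mul1r mulN1r mulr1 (le_trans (ler_norm _))// (le_trans (bnd k kn))//.
by rewrite expr_div_n mulrA mulrAC.
Qed.
End weierstrass.

(** * One-dimensional Gaussian laws *)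

Section Rintegral_extra.
Context d (T : measurableType d) (R : realType) (mu : {measure set T -> \bar R}).
Implicit Types f g : T -> R.

Definition integ f := mu.-integrable setT (EFin \o f).

Lemma integ_measurable f : integ f -> measurable_fun setT f.
Proof. by move=> /measurable_int/measurable_EFinP. Qed.

Lemma integD f g : integ f -> integ g -> integ (fun x => f x + g x).
Proof. by move=> hf hg; exact: (integrableD _ hf hg). Qed.

Lemma integB f g : integ f -> integ g -> integ (fun x => f x - g x).
Proof. by move=> hf hg; exact: (integrableB _ hf hg). Qed.

Lemma integZ k f : integ f -> integ (fun x => k * f x).
Proof. by move=> hf; exact: (integrableZl _ _ hf). Qed.

Lemma integN f : integ f -> integ (fun x => - f x).
Proof. by move=> hf; exact: (integrableN hf). Qed.

Lemma integ_sum (I : Type) (s : seq I) (F : I -> T -> R) :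
  (forall i, integ (F i)) -> integ (fun x => \sum_(i <- s) F i x).
Proof.
move=> h; rewrite /integ.
rewrite (_ : _ \o _ = fun x => (\sum_(i <- s) (F i x)%:E)%E).
  by apply: integrable_sum => // i _; exact: h.
by apply/funext => x /=; rewrite sumEFin.
Qed.

Lemma integ_norm f : integ f -> integ (fun x => `|f x|).
Proof. exact: integrable_norm. Qed.

Lemma integ_le f g : measurable_fun setT f -> integ g ->
  (forall x, `|f x| <= g x) -> integ f.
Proof.
move=> mf ig fg; apply: (le_integrable _ _ _ ig) => //.
  exact/measurable_EFinP.
by move=> x _ /=; rewrite lee_fin (le_trans (fg x))// ler_norm.
Qed.

Lemma Rint_sum (I : Type) (s : seq I) (F : I -> T -> R) :
  (forall i, integ (F i)) ->
  \int[mu]_x (\sum_(i <- s) F i x) = \sum_(i <- s) \int[mu]_x F i x.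
Proof.
move=> h; elim: s => [|a s ih].
  under eq_Rintegral do rewrite big_nil.
  by rewrite big_nil /Rintegral integral0.
under eq_Rintegral do rewrite big_cons.
by rewrite RintegralD//; [rewrite big_cons ih|exact: h|exact: integ_sum].
Qed.

Lemma dominated_Rintegral (f_ : nat -> T -> R) f g :
  (forall n, measurable_fun setT (f_ n)) -> measurable_fun setT f ->
  (forall x, f_ n x @[n --> \oo] --> f x) -> integ g ->
  (forall n x, `|f_ n x| <= g x) ->
  integ f /\ \int[mu]_x f_ n x @[n --> \oo] --> \int[mu]_x f x.
Proof.
move=> mf_ mf ff ig fg.
have [||||If _ cvf] := @dominated_convergence _ T R mu setT measurableT
  (fun n x => (f_ n x)%:E) (EFin \o f) (EFin \o g) _ _ _ ig.
- by move=> n; apply/measurable_EFinP/mf_.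
- exact/measurable_EFinP.
- by apply: aeW => x _; apply: cvg_EFin; [exact: nearW|exact: ff].
- by apply: aeW => x n _ /=; rewrite lee_fin.
split => //.
by apply: fine_cvg; rewrite fineK//; exact: integrable_fin_num.
Qed.
End Rintegral_extra.

Section mvt.
Context (R : realType).

(** No order between a and b is imposed and c may be an endpoint, so the degenerate case a = b needs
    no separate treatment. *)
Lemma MVT_all (f df : R -> R) (a b : R) :
  (forall x : R, is_derive x 1 f (df x)) ->
  exists2 c, Num.min a b <= c <= Num.max a b & f b - f a = df c * (b - a).
Proof.
move=> h.
have cf : continuous f.
  by move=> x; apply/differentiable_continuous/derivable1_diffP; have [] := h x.
have [ab|ba|->] := ltgtP a b; last by exists b; rewrite ?lexx// !subrr mulr0.
  have [c /[!in_itv]/= /andP[ac cb] e] :=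
    MVT ab (fun x _ => h x) (continuous_subspaceT cf).
  by exists c => //; rewrite !ltW.
have [c /[!in_itv]/= /andP[ac cb] e] :=
  MVT ba (fun x _ => h x) (continuous_subspaceT cf).
by exists c; rewrite ?(ltW ac) ?(ltW cb)// -opprB e -mulrN opprB.
Qed.

Lemma derive0_const (f : R -> R) a b :
  (forall x : R, is_derive x 1 f 0) -> f a = f b.
Proof.
by move=> h; apply/esym/eqP; rewrite -subr_eq0; have [c _ ->] := MVT_all a b h; rewrite mul0r.
Qed.
End mvt.
Lemma cvg_Rintegral_sets d (T : measurableType d) (R : realType)
    (mu : {measure set T -> \bar R}) (A : nat -> set T) (B : set T) (f : T -> R) :
  (forall n, measurable (A n)) -> measurable B -> integ mu f ->
  (forall x, \forall n \near \oo, (x \in A n) = (x \in B)) ->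
  \int[mu]_(x in A n) f x @[n --> \oo] --> \int[mu]_(x in B) f x.
Proof.
move=> mA mB intf AB; rewrite Rintegral_mkcond.
under eq_fun do rewrite Rintegral_mkcond.
have mf := integ_measurable intf.
have [] // := @dominated_Rintegral _ _ _ mu (fun n => f \_ (A n)) (f \_ B) (fun x => `|f x|).
- move=> n; apply/(measurable_restrictT _ (mA n)).1.
  exact: measurable_funS mf.
- by apply/(measurable_restrictT _ mB).1; exact: measurable_funS mf.
- move=> x; apply: cvg_near_cst; near=> n.
  by rewrite /restrict; have -> : (x \in A n) = (x \in B) by near: n.
- exact: integ_norm.
- by move=> n x; rewrite /restrict; case: ifP => // _; rewrite normr0.
Unshelve. all: by end_near.
Qed.

(** * The fundamental theorem of calculus on rays and on the line *)

Section line_integrals.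
Context (R : realType).
Notation leb := (@lebesgue_measure R).
Implicit Types f F : R -> R.

Lemma FTC_ray f F x : continuous f -> (forall x : R, is_derive x 1 F (f x)) ->
  integ leb f -> F (- n%:R) @[n --> \oo] --> 0 ->
  \int[leb]_(t in `]-oo, x]) f t = F x.
Proof.
move=> cf dF intf F0.
have cF : continuous F.
  by move=> y; apply/differentiable_continuous/derivable1_diffP; have [] := dF y.
have h1 : \int[leb]_(t in `[- n%:R, x]) f t @[n --> \oo] -->
    \int[leb]_(t in `]-oo, x]) f t.
  apply: cvg_Rintegral_sets => // y; near=> n.
  have yn : - n%:R <= y.
    by rewrite lerNl; near: n; exact: nbhs_infty_ger.
  by rewrite !mem_setE !in_itv/= yn.
have h2 : \int[leb]_(t in `[- n%:R, x]) f t @[n --> \oo] --> F x - 0.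
  have : (F x - F (- n%:R)) @[n --> \oo] --> F x - 0.
    by apply: cvgB => //; exact: cvg_cst.
  apply: cvg_trans; apply: near_eq_cvg; near=> n.
  have nx : - n%:R < x by rewrite ltrNl; near: n; exact: nbhs_infty_gtr.
  rewrite /Rintegral (continuous_FTC2 (F := F) nx (continuous_subspaceT cf))//.
    split=> [y _||]; first by have [] := dF y.
      by apply: cvg_at_right_filter; exact: cF.
    by apply: cvg_at_left_filter; exact: cF.
  by move=> y _; rewrite derive1E; have [_ ->] := dF y.
by rewrite (cvg_unique _ h1 h2)//= subr0.
Unshelve. all: by end_near.
Qed.

Lemma FTC_line f F : continuous f -> (forall x : R, is_derive x 1 F (f x)) ->
  integ leb f -> F (- n%:R) @[n --> \oo] --> 0 -> F n%:R @[n --> \oo] --> 0 ->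
  \int[leb]_t f t = 0.
Proof.
move=> cf dF intf F0 F1.
have : \int[leb]_(t in `]-oo, n%:R]) f t @[n --> \oo] --> \int[leb]_t f t.
  apply: cvg_Rintegral_sets => // y; near=> n.
  by rewrite in_setT mem_setE in_itv/=; near: n; exact: nbhs_infty_ger.
under eq_fun do rewrite (FTC_ray _ cf dF)//.
by move=> h; exact: (cvg_unique _ h F1).
Unshelve. all: by end_near.
Qed.
End line_integrals.

(** * Gaussian densities against functions of quartic growth *)

Section gaussian_density.
Context (R : realType).
Notation leb := (@lebesgue_measure R).
Implicit Types (m s x : R).

Lemma is_derive_normal_pdf m s x : 0 < s ->
  is_derive x 1 (normal_pdf m s) (- ((x - m) / s ^+ 2) * normal_pdf m s x).
Proof.
move=> s0; have sn0 : s != 0 by rewrite gt_eqF.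
rewrite normal_pdfE//.
have h : is_derive x 1 (fun y : R => - (y - m) ^+ 2 / (s ^+ 2 *+ 2))
   (- (x - m) / s ^+ 2).
  by apply: is_derive_eq; rewrite /GRing.scale/=; field.
have := is_derive1_comp (is_derive_expR _) h.
move=> h2.
apply: is_derive_eq.
by rewrite /normal_fun /GRing.scale/=; field.
Qed.

Lemma normal_pdf_gt0 m s x : 0 < s -> 0 < normal_pdf m s x.
Proof.
by move=> s0; rewrite normal_pdfE ?gt_eqF// mulr_gt0 ?expR_gt0// normal_peak_gt0// gt_eqF.
Qed.

Lemma integ_normal_pdf m s : integ leb (normal_pdf m s).
Proof. exact: integrable_normal_pdf. Qed.

(* A Gaussian density times a quartic polynomial is dominated by a Gaussian of twice the variance. *)
Lemma normal_pdf_dom m s x : 0 < s ->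
  (1 + (x - m) ^+ 4) * normal_pdf m s x <=
  normal_peak s * (1 + 64 * s ^+ 4) / normal_peak (Num.sqrt 2 * s)
    * normal_pdf m (Num.sqrt 2 * s) x.
Proof.
move=> s0; have sn0 : s != 0 by rewrite gt_eqF.
have s20 : Num.sqrt 2 * s != 0 by rewrite mulf_neq0// gt_eqF// sqrtr_gt0.
rewrite !normal_pdfE//.
rewrite -!mulrA (mulrA _ (normal_peak (_ * _)) (normal_fun _ _ _)) mulVf ?mul1r; last first.
  by rewrite gt_eqF// normal_peak_gt0.
rewrite mulrCA ler_wpM2l ?normal_peak_ge0// /normal_fun.
rewrite exprMn sqr_sqrtr//.
set y := x - m; set u := y ^+ 2 / (4 * s ^+ 2).
have -> : - y ^+ 2 / (s ^+ 2 *+ 2) = - u + - u by rewrite /u; field.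
have -> : - y ^+ 2 / (2 * s ^+ 2 *+ 2) = - u by rewrite /u; field.
rewrite expRD mulrA ler_wpM2r ?expR_ge0// expRN ler_pdivrMr ?expR_gt0//.
have u0 : 0 <= u by rewrite divr_ge0 ?sqr_ge0// mulr_ge0// sqr_ge0.
(* Squaring 1 + u/2 <= exp(u/2) gives a quadratic lower bound on exp u; its term u^2/4 absorbs y^4 =
   16 s^4 u^2, whence the factor 64. *)
have e1 : (1 + u / 2) ^+ 2 <= expR u.
  rewrite [leRHS](_ : _ = expR (u / 2) ^+ 2); last first.
    by rewrite expr2 -expRD -splitr.
  rewrite ler_pXn2r ?expR_ge1Dx// nnegrE ?expR_ge0//.
  by rewrite addr_ge0// divr_ge0.
apply: (le_trans (y := (1 + 64 * s ^+ 4) * (1 + u / 2) ^+ 2)); last first.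
  by rewrite ler_wpM2l// addr_ge0// mulr_ge0// exprn_ge0// ltW.
have -> : y ^+ 4 = 64 * s ^+ 4 * (u ^+ 2 / 4) by rewrite /u; field.
have s4 : 0 <= s ^+ 4 by rewrite exprn_ge0// ltW.
nra.
Qed.

Lemma integ_normal_poly m s (h : R -> R) (C : R) : 0 < s ->
  measurable_fun setT h -> (forall x, `|h x| <= C * (1 + (x - m) ^+ 4)) ->
  integ leb (fun x => h x * normal_pdf m s x).
Proof.
move=> s0 mh hC.
have C0 : 0 <= C.
  have := hC m; rewrite subrr expr0n/= addr0 mulr1.
  exact: le_trans.
apply: (@integ_le _ _ _ leb _ (fun x => C * (normal_peak s * (1 + 64 * s ^+ 4) / normal_peak (Num.sqrt 2 * s)
    * normal_pdf m (Num.sqrt 2 * s) x))).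
- by apply: measurable_funM => //; exact: measurable_normal_pdf.
- by apply: integZ; apply: integZ; exact: integ_normal_pdf.
- move=> x; rewrite normrM (ger0_norm (normal_pdf_ge0 _ _ _)).
  apply: (le_trans (y := C * ((1 + (x - m) ^+ 4) * normal_pdf m s x))).
    by rewrite mulrA ler_wpM2r// normal_pdf_ge0.
  by rewrite ler_wpM2l// normal_pdf_dom.
Qed.

(** The sequence [e] stands for n or for -n, so one statement serves both ends of the line. The
    wider Gaussian dominates, and exp(-u) <= 1/(1+u) already yields decay of order 1/(n+1). *)
Lemma normal_pdf_vanish m s (h : R -> R) (C : R) (e : nat -> R) : 0 < s ->
  (forall x, `|h x| <= C * (1 + (x - m) ^+ 4)) ->
  (forall n, `|e n| = n%:R) ->
  h (e n) * normal_pdf m s (e n) @[n --> \oo] --> 0.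
Proof.
move=> s0 hC en.
set sg := Num.sqrt 2 * s.
have sg0 : 0 < sg by rewrite mulr_gt0// sqrtr_gt0.
set K := C * (normal_peak s * (1 + 64 * s ^+ 4) / normal_peak sg).
have C0 : 0 <= C.
  have := hC m; rewrite subrr expr0n/= addr0 mulr1.
  exact: le_trans.
have K0 : 0 <= K.
  rewrite mulr_ge0// divr_ge0 ?normal_peak_ge0// mulr_ge0 ?normal_peak_ge0//.
  by rewrite addr_ge0// mulr_ge0// exprn_ge0// ltW.
apply: norm_cvg0.
apply: (@squeeze_cvgr _ _ _ _ (cst 0) (fun n => K * (normal_peak sg * (2 + 2 * sg ^+ 2 + `|m|)) * harmonic n)); last 2 first.
- exact: cvg_cst.
- rewrite -[X in _ --> X](mulr0 (K * (normal_peak sg * (2 + 2 * sg ^+ 2 + `|m|)))).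
  by apply: cvgM; [exact: cvg_cst|exact: cvg_harmonic].
apply: nearW => n; rewrite normr_ge0/= normrM (ger0_norm (normal_pdf_ge0 _ _ _)).
apply: (le_trans (y := K * normal_pdf m sg (e n))).
  apply: (le_trans (y := C * ((1 + (e n - m) ^+ 4) * normal_pdf m s (e n)))).
    by rewrite mulrA ler_wpM2r// normal_pdf_ge0.
  by rewrite -(mulrA C) ler_wpM2l// normal_pdf_dom.
rewrite -mulrA ler_wpM2l// normal_pdfE ?gt_eqF// -mulrA ler_wpM2l ?normal_peak_ge0//.
rewrite /normal_fun /harmonic/= mulNr expRN -[leRHS]invrK lef_pV2 ?posrE ?expR_gt0 ?invr_gt0 ?divr_gt0//; last first.
  by rewrite -addrA ltr_pwDl// addr_ge0// mulr_ge0// sqr_ge0.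
rewrite invf_div; set u := _ / (sg ^+ 2 *+ 2).
apply: le_trans (expR_ge1Dx u).
rewrite ler_pdivrMr; last by rewrite -addrA ltr_pwDl// addr_ge0// mulr_ge0// sqr_ge0.
have yE : (e n - m) ^+ 2 = 2 * sg ^+ 2 * u by rewrite /u; field; rewrite gt_eqF.
have u0 : 0 <= u by rewrite divr_ge0 ?sqr_ge0// mulrn_wge0// sqr_ge0.
have h1 : `|e n - m| <= 1 + 2 * sg ^+ 2 * u.
  rewrite -yE -real_normK ?num_real//.
  have := sqr_ge0 (`|e n - m| - 1); have := normr_ge0 (e n - m); nra.
have h2 : n%:R <= `|e n - m| + `|m|.
  by rewrite -en -{1}(subrK m (e n)) ler_normD.
have m0 := normr_ge0 m; have g0 := sqr_ge0 sg.
rewrite -natr1; nra.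
Qed.

(** The derivative of h times the density integrates to zero over the line; the quartic bounds give
    both integrability and vanishing boundary terms. *)
Lemma stein_normal m s (h dh : R -> R) (C : R) : 0 < s ->
  (forall x, is_derive x 1 h (dh x)) -> continuous dh ->
  (forall x, `|h x| <= C * (1 + (x - m) ^+ 4)) ->
  (forall x, `|(x - m) * h x| <= C * (1 + (x - m) ^+ 4)) ->
  (forall x, `|dh x| <= C * (1 + (x - m) ^+ 4)) ->
  \int[leb]_x ((x - m) * h x * normal_pdf m s x) =
  s ^+ 2 * \int[leb]_x (dh x * normal_pdf m s x).
Proof.
move=> s0 dhE cdh hC xhC dhC; have sn0 : s != 0 by rewrite gt_eqF.
have ch : continuous h.
  by move=> y; apply/differentiable_continuous/derivable1_diffP; have [] := dhE y.
have cx : continuous (fun x : R => x - m).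
  by move=> x; apply: cvgB; [exact: cvg_id|exact: cvg_cst].
have mh : measurable_fun setT h by exact: continuous_measurable_fun.
have mdh : measurable_fun setT dh by exact: continuous_measurable_fun.
have mx : measurable_fun setT (fun x : R => x - m) by exact: continuous_measurable_fun.
have mxh : measurable_fun setT (fun x : R => (x - m) * h x) by exact: measurable_funM.
have i1 := integ_normal_poly s0 mxh xhC.
have i2 := integ_normal_poly s0 mdh dhC.
have cp : continuous (normal_pdf m s) by exact: continuous_normal_pdf.
pose F x := h x * normal_pdf m s x.
pose f x := dh x * normal_pdf m s x - s ^- 2 * ((x - m) * h x * normal_pdf m s x).
have : \int[leb]_x f x = 0.
  apply: (@FTC_line _ f F).
  - move=> x; apply: cvgB; first by apply: cvgM; [exact: cdh|exact: cp].
    apply: cvgM; first exact: cvg_cst.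
    by apply: cvgM; [apply: cvgM; [exact: cx|exact: ch]|exact: cp].
  - move=> x; have d1 := dhE x; have d2 := is_derive_normal_pdf m x s0.
    by apply: is_derive_eq; rewrite /f /GRing.scale/=; field.
  - by apply: integB => //; exact: integZ.
  - by apply: (normal_pdf_vanish s0 hC) => n; rewrite normrN normr_nat.
  - by apply: (normal_pdf_vanish s0 hC) => n; rewrite normr_nat.
rewrite RintegralB//; last exact: integZ.
rewrite RintegralZl// => /eqP; rewrite subr_eq0 => /eqP ->.
by rewrite mulrA divff ?mul1r// expf_neq0.
Qed.
End gaussian_density.

(** * Passing from laws to densities *)

Section laws.
Context (R : realType).
Notation leb := (@lebesgue_measure R).

(** Change of variables produces an abstract Radon-Nikodym density; it has the same integral as
    [normal_pdf] over every measurable set, hence agrees with it almost everywhere. *)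
Lemma ge0_integral_normal_prob (m s : R) (h : R -> R) :
  measurable_fun setT h -> (forall x, 0 <= h x) ->
  (\int[normal_prob m s]_x (h x)%:E = \int[leb]_x (h x * normal_pdf m s x)%:E)%E.
Proof.
move=> mh h0.
rewrite -(@Radon_Nikodym_SigmaFinite.change_of_variables _ _ _ (normal_prob m s) leb (normal_prob_dominates m s) (EFin \o h))//; last exact/measurable_EFinP.
have mp : measurable_fun setT (normal_pdf m s) by exact: measurable_normal_pdf.
have iF := Radon_Nikodym_SigmaFinite.f_integrable (normal_prob_dominates m s).
have F0 := Radon_Nikodym_SigmaFinite.f_ge0 (normal_prob_dominates m s).
apply: ge0_ae_eq_integral => //.
- apply: emeasurable_funM; first exact/measurable_EFinP.
  exact: measurable_int iF.
- by apply/measurable_EFinP; exact: measurable_funM.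
- by move=> x _; rewrite mule_ge0// lee_fin.
- by move=> x _; rewrite lee_fin mulr_ge0// normal_pdf_ge0.
have : ae_eq leb setT (Radon_Nikodym_SigmaFinite.f (normal_prob m s) leb) (EFin \o normal_pdf m s).
  apply: integral_ae_eq => //; first exact/measurable_EFinP.
  by move=> E _ mE; rewrite -(Radon_Nikodym_SigmaFinite.f_integral (normal_prob_dominates m s)).
by apply: filterS => x /= /(_ I) ->; rewrite EFinM.
Qed.

Lemma integ_normal_prob (m s : R) (h : R -> R) :
  measurable_fun setT h -> integ leb (fun x => h x * normal_pdf m s x) ->
  integ (normal_prob m s) h /\
  \int[normal_prob m s]_x h x = \int[leb]_x (h x * normal_pdf m s x).
Proof.
move=> mh ih.
have ihN : integ (normal_prob m s) h.
  apply/integrableP; split; first exact/measurable_EFinP.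
  suff : (\int[normal_prob m s]_x (`|h x|)%:E < +oo)%E by [].
  rewrite ge0_integral_normal_prob//; last exact: measurableT_comp.
  move/integrableP : ih => [_]; apply: le_lt_trans.
  apply: ge0_le_integral => //.
  - by move=> x _; rewrite lee_fin mulr_ge0// normal_pdf_ge0.
  - apply/measurable_EFinP/measurable_funM; last exact: measurable_normal_pdf.
    exact: measurableT_comp.
  - apply/measurableT_comp => //; apply/measurable_EFinP/measurable_funM => //.
    exact: measurable_normal_pdf.
  - move=> x _; rewrite /= lee_fin normrM.
    by rewrite (ger0_norm (normal_pdf_ge0 _ _ _)).
split => //.
have ipos (g : R -> R) : measurable_fun setT g -> (forall x, 0 <= g x) ->
    \int[normal_prob m s]_x g x = \int[leb]_x (g x * normal_pdf m s x).
  by move=> mg g0; congr fine; exact: ge0_integral_normal_prob.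
have ian : integ (normal_prob m s) (fun x => `|h x|) by exact: integ_norm.
have iap : integ leb (fun x => `|h x| * normal_pdf m s x).
  have := integ_norm ih; congr (integ leb _); apply/funext => x.
  by rewrite normrM (ger0_norm (normal_pdf_ge0 _ _ _)).
(* Both |h| + h and |h| are nonnegative, so the nonnegative case applies to each. *)
transitivity (\int[normal_prob m s]_x ((`|h x| + h x) - `|h x|)).
  by apply: eq_Rintegral => x _; rewrite addrAC subrr add0r.
rewrite RintegralB//; last exact: integD.
rewrite !ipos//; first last.
- by move=> x; rewrite -lerBlDr sub0r -normrN ler_norm.
- by apply: measurable_funD => //; exact: measurableT_comp.
- exact: measurableT_comp.
transitivity (\int[leb]_x ((`|h x| + h x) * normal_pdf m s x - `|h x| * normal_pdf m s x)).
  rewrite RintegralB//.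
  rewrite (_ : _ \o _ = EFin \o (fun x => `|h x| * normal_pdf m s x + h x * normal_pdf m s x)).
    exact: integD.
  by apply/funext => x /=; rewrite mulrDl.
by apply: eq_Rintegral => x _; rewrite mulrDl addrAC subrr add0r.
Qed.

Context d (T : measurableType d) (P : probability T R).

Lemma law_transfer (mu : {measure set (measurableTypeR R) -> \bar R}) (V : T -> R) (h : R -> R) :
  measurable_fun setT V ->
  (forall A : set (measurableTypeR R), measurable A -> P (V @^-1` A) = mu A) ->
  measurable_fun setT h -> integ mu h ->
  integ P (h \o V) /\ \int[P]_w h (V w) = \int[mu]_x h x.
Proof.
move=> mV law mh ih.
pose V' : {RV P >-> measurableTypeR R} := @mfun_Sub _ _ T (measurableTypeR R) V (mem_set mV).
have eqm A : measurable A -> A `<=` setT -> distribution P V' A = mu A.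
  by move=> mA _; rewrite /distribution/= -law.
have ihV : integ P (h \o V).
  apply/integrableP; split.
    by apply/measurable_EFinP; exact: measurableT_comp mh mV.
  have mah : measurable_fun setT (EFin \o (fun x => `|h x|)).
    by apply/measurable_EFinP; exact: measurableT_comp.
  have := @ge0_integral_distribution _ _ _ _ _ P V' (EFin \o (fun x => `|h x|)) mah.
  move=> /(_ (fun y => normr_ge0 _)) /= <-.
  rewrite (eq_measure_integral mu eqm).
  by move/integrableP : ih => [].
split => //.
have := @integral_distribution _ _ _ _ _ P V' (EFin \o h).
move=> /(_ (proj2 (measurable_EFinP _ _) mh) ihV) /=.
by rewrite /Rintegral (eq_measure_integral mu eqm)// => ->.
Qed.
End laws.

(** * Moments and characteristic function of a Gaussian density *)

Section gaussian_moments.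
Context (R : realType).
Notation leb := (@lebesgue_measure R).
Variable s : R.
Hypothesis s0 : 0 < s.

Lemma is_derive_id_scale (t x : R) : is_derive x 1 (fun y : R => t * y) t.
Proof. by apply: is_derive_eq; rewrite /GRing.scale/= mulr1. Qed.

Lemma is_derive_sin_scale (t x : R) : is_derive x 1 (fun y => sin (t * y)) (t * cos (t * x)).
Proof.
have h := is_derive_id_scale t x.
have := is_derive1_comp (is_derive_sin (t * x)) h.
by move=> h2; apply: is_derive_eq; rewrite /GRing.scale/= mulrC.
Qed.

Lemma is_derive_cos_scale (t x : R) : is_derive x 1 (fun y => cos (t * y)) (- (t * sin (t * x))).
Proof.
have h := is_derive_id_scale t x.
have := is_derive1_comp (is_derive_cos (t * x)) h.
by move=> h2; apply: is_derive_eq; rewrite /GRing.scale/= mulrC mulrN.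
Qed.

Lemma continuous_scale (t : R) : continuous (fun y : R => t * y).
Proof. by move=> x; apply: cvgM; [exact: cvg_cst|exact: cvg_id]. Qed.

Lemma normr_cos_le1 (x : R) : `|cos x| <= 1.
Proof. by rewrite ler_norml cos_geN1 cos_le1. Qed.

Lemma normr_sin_le1 (x : R) : `|sin x| <= 1.
Proof. by rewrite ler_norml sin_geN1 sin_le1. Qed.

Lemma normr_le_quartic (x : R) : `|x| <= 1 + x ^+ 4.
Proof.
have h4 : x ^+ 4 = `|x| ^+ 4 by rewrite (exprM x 2 2) -(real_normK (num_real x)) -exprM.
have := normr_ge0 x; set y := `|x| => y0.
have [y1|y1] := leP y 1; first by rewrite (le_trans y1)// lerDl h4 exprn_ge0.
have : y * 1 <= y * y ^+ 3 by rewrite ler_wpM2l// exprn_ege1// ltW.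
by rewrite h4 -exprS mulr1 => /le_trans; apply; rewrite lerDr.
Qed.

Lemma continuous_cos_scale (t : R) : continuous (fun x : R => cos (t * x)).
Proof. by move=> x; apply: continuous_comp; [exact: continuous_scale|exact: continuous_cos]. Qed.

Lemma continuous_sin_scale (t : R) : continuous (fun x : R => sin (t * x)).
Proof. by move=> x; apply: continuous_comp; [exact: continuous_scale|exact: continuous_sin]. Qed.

Lemma measurable_cos_scale (t : R) : measurable_fun setT (fun x : R => cos (t * x)).
Proof. by apply: continuous_measurable_fun; exact: continuous_cos_scale. Qed.

Lemma measurable_sin_scale (t : R) : measurable_fun setT (fun x : R => sin (t * x)).
Proof. by apply: continuous_measurable_fun; exact: continuous_sin_scale. Qed.

Lemma stein_sin (t : R) :
  \int[leb]_x (x * sin (t * x) * normal_pdf 0 s x) =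
  s ^+ 2 * t * \int[leb]_x (cos (t * x) * normal_pdf 0 s x).
Proof.
have := @stein_normal R 0 s (fun x => sin (t * x)) (fun x => t * cos (t * x)) (1 + `|t|) s0.
under eq_Rintegral do rewrite subr0.
move=> /(_ (fun x => is_derive_sin_scale t x)) ->.
- rewrite -mulrA -[in RHS]RintegralZl//.
    by congr (_ * _); apply: eq_Rintegral => x _; rewrite mulrA.
  apply: (@integ_normal_poly _ _ _ _ 1) => //; first exact: measurable_cos_scale.
  move=> x; rewrite mul1r (le_trans (normr_cos_le1 _))// lerDl subr0.
  by rewrite exprn_even_ge0.
- by move=> x; apply: cvgM; [exact: cvg_cst|exact: continuous_cos_scale].
- move=> x; rewrite subr0 (le_trans (normr_sin_le1 _))//.
  by rewrite -[leLHS]mulr1 ler_pM// ?lerDl// exprn_even_ge0.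
- move=> x; rewrite subr0 normrM -[leLHS]mulrC ler_pM//.
    by rewrite (le_trans (normr_sin_le1 _))// lerDl.
  exact: normr_le_quartic.
- move=> x; rewrite subr0 normrM ler_pM// ?lerDr//.
  by rewrite (le_trans (normr_cos_le1 _))// lerDl exprn_even_ge0.
Qed.

Lemma integ_normal_bnd (h : R -> R) (m : R) : measurable_fun setT h ->
  (forall x, `|h x| <= 1) -> integ leb (fun x => h x * normal_pdf m s x).
Proof.
move=> mh h1; apply: (@integ_normal_poly _ _ _ _ 1) => // x.
by rewrite mul1r (le_trans (h1 _))// lerDl exprn_even_ge0.
Qed.

Lemma Rintegral_normal_pdf (m : R) : \int[leb]_x normal_pdf m s x = 1.
Proof. by rewrite /Rintegral integral_normal_pdf. Qed.

(** Differentiation under the integral, with majorant |x| times the density, produces -x sin(tx);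
    Stein's identity [stein_sin] turns it back into cos(tx), so the characteristic function
    satisfies a linear differential equation. *)
Lemma is_derive_normal_cos (t : R) :
  is_derive t 1 (fun t => \int[leb]_x (cos (t * x) * normal_pdf 0 s x))
   (- (s ^+ 2 * t * \int[leb]_x (cos (t * x) * normal_pdf 0 s x))).
Proof.
pose f (t : R) x := cos (t * x) * normal_pdf 0 s x.
have It : `]t - 1, t + 1[%classic t by rewrite /= in_itv/= ltrBlDr ltrDl ltr01 /=.
have d1 (u x : R) : is_derive u 1 (fun u => f u x) (- (x * sin (u * x)) * normal_pdf 0 s x).
  rewrite /f.
  have := is_derive_cos_scale x u.
  rewrite (_ : (fun y => cos (x * y)) = (fun y => cos (y * x))); last first.
    by apply/funext => y; rewrite mulrC.
  move=> h; apply: is_derive_eq.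
  by rewrite /GRing.scale/= mulr0 add0r mulrC (mulrC u).
have p1 u x : partial1of2 f u x = - (x * sin (u * x)) * normal_pdf 0 s x.
  by rewrite partial1of2E; have [_ ->] := d1 u x.
have intf (x : R) : `]t - 1, t + 1[%classic x -> leb.-integrable setT (EFin \o f x).
  move=> _; apply: integ_normal_bnd; first exact: measurable_cos_scale.
  by move=> y; exact: normr_cos_le1.
have derf (x y : R) : `]t - 1, t + 1[%classic x -> setT y -> derivable (f ^~ y) x 1.
  by move=> _ _; have [] := d1 x y.
have intG : leb.-integrable setT (EFin \o (fun x => `|x| * normal_pdf 0 s x)).
  apply: (@integ_normal_poly _ _ _ _ 1) => // x.
  by rewrite normr_id subr0 mul1r normr_le_quartic.
have G0 y : 0 <= `|y| * normal_pdf 0 s y by rewrite mulr_ge0// normal_pdf_ge0.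
have Gub (x y : R) : `]t - 1, t + 1[%classic x -> setT y -> `|partial1of2 f x y| <= `|y| * normal_pdf 0 s y.
  move=> _ _; rewrite p1 normrM normrN (ger0_norm (normal_pdf_ge0 _ _ _)).
  rewrite ler_wpM2r ?normal_pdf_ge0// normrM ler_piMr//.
  exact: normr_sin_le1.
have h1 := derivable_under_integral measurableT It intf derf G0 intG Gub.
have h2 := differentiation_under_integral measurableT It intf derf G0 intG Gub.
split; first exact: h1.
rewrite -derive1E h2 -stein_sin.
under eq_Rintegral do rewrite p1 mulNr -mulN1r.
rewrite RintegralZl// ?mulN1r//.
apply: (@integ_normal_poly _ _ _ _ 1) => //.
  by apply: measurable_funM => //; exact: measurable_sin_scale.
move=> x; rewrite mul1r subr0 normrM (le_trans _ (normr_le_quartic x))//.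
by rewrite ler_piMr// normr_sin_le1.
Qed.

(** The equation phi' = - s^2 t phi makes phi(t) exp(s^2 t^2 / 2) constant, and phi(0) = 1. *)
Lemma normal_cos (t : R) :
  \int[leb]_x (cos (t * x) * normal_pdf 0 s x) = expR (- (s ^+ 2 * t ^+ 2 / 2)).
Proof.
set phi := fun t : R => \int[leb]_x (cos (t * x) * normal_pdf 0 s x).
pose psi u := phi u * expR (s ^+ 2 * u ^+ 2 / 2).
have dpsi (u : R) : is_derive u 1 psi 0.
  have h1 : is_derive u 1 phi (- (s ^+ 2 * u * phi u)) by exact: is_derive_normal_cos.
  have h : is_derive u 1 (fun y : R => s ^+ 2 * y ^+ 2 / 2) (s ^+ 2 * u).
    by apply: is_derive_eq; rewrite /GRing.scale/=; field.
  have h2 := is_derive1_comp (is_derive_expR _) h.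
  by apply: is_derive_eq; rewrite /GRing.scale/=; ring.
have := derive0_const 0 t dpsi.
rewrite /psi expr0n/= mulr0 mul0r expR0 mulr1 => e.
have e0 : phi 0 = 1.
  rewrite -(Rintegral_normal_pdf 0); apply: eq_Rintegral => x _.
  by rewrite mul0r cos0 mul1r.
rewrite -/(phi t) expRN; apply/esym/(mulIf (lt0r_neq0 (expR_gt0 (s ^+ 2 * t ^+ 2 / 2)))).
by rewrite -e e0 mulVf// lt0r_neq0// expR_gt0.
Qed.

Lemma normal_mean (m : R) : \int[leb]_x ((x - m) * normal_pdf m s x) = 0.
Proof.
have := @stein_normal R m s (fun=> 1) (fun=> 0) 1 s0.
under eq_Rintegral do rewrite mulr1.
move=> /(_ (fun x => is_derive_cst _ _ _)) ->.
- by under eq_Rintegral do rewrite mul0r; rewrite /Rintegral integral0 mulr0.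
- by move=> x; exact: cvg_cst.
- by move=> x; rewrite normr1 mul1r lerDl exprn_even_ge0.
- by move=> x; rewrite mulr1 mul1r normr_le_quartic.
- by move=> x; rewrite normr0 mul1r addr_ge0// exprn_even_ge0.
Qed.

Lemma normal_moment2 : \int[leb]_x (x ^+ 2 * normal_pdf 0 s x) = s ^+ 2.
Proof.
have := @stein_normal R 0 s id (fun=> 1) 1 s0.
under eq_Rintegral do rewrite subr0 -expr2.
move=> /(_ (fun x => is_derive_id _ _)) ->.
- by under eq_Rintegral do rewrite mul1r; rewrite Rintegral_normal_pdf mulr1.
- by move=> x; exact: cvg_cst.
- by move=> x; rewrite subr0 mul1r normr_le_quartic.
- move=> x; rewrite subr0 mul1r -expr2 ger0_norm ?sqr_ge0//.
  have := sqr_ge0 (x ^+ 2 - 1); rewrite (exprM x 2 2); nra.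
- by move=> x; rewrite normr1 mul1r lerDl exprn_even_ge0.
Qed.

Lemma normal_moment4 : \int[leb]_x (x ^+ 4 * normal_pdf 0 s x) = 3 * s ^+ 4.
Proof.
have e (x : R) : `|x| ^+ 3 <= 3 * (1 + x ^+ 4).
  have := normr_le_quartic x; have := sqr_ge0 (`|x| ^+ 2 - `|x|).
  have := sqr_ge0 (`|x| ^+ 2 - 1).
  rewrite (exprM x 2 2) -(real_normK (num_real x)); have := normr_ge0 x; nra.
have := @stein_normal R 0 s (fun x => x ^+ 3) (fun x => 3 * x ^+ 2) 3 s0.
under eq_Rintegral do rewrite subr0 -exprS.
have dE (x : R) : is_derive x 1 (fun x : R => x ^+ 3) (3 * x ^+ 2).
  by apply: is_derive_eq; rewrite /GRing.scale/=; ring.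
move=> /(_ dE) ->.
- under eq_Rintegral do rewrite -mulrA.
  rewrite RintegralZl//; first by rewrite normal_moment2 mulrCA -exprD.
  apply: (@integ_normal_poly _ _ _ _ 1) => //.
  move=> x; rewrite subr0 mul1r ger0_norm ?sqr_ge0//.
  have := sqr_ge0 (x ^+ 2 - 1); rewrite (exprM x 2 2); nra.
- move=> x; apply: cvgM; first exact: cvg_cst.
  exact: sqr_continuous.
- by move=> x; rewrite subr0 normrX.
- move=> x; rewrite subr0 -exprS ger0_norm ?exprn_even_ge0//.
  by have := @exprn_even_ge0 _ 4 x isT; lra.
- move=> x; rewrite subr0 ger0_norm; last by rewrite mulr_ge0// sqr_ge0.
  rewrite ler_wpM2l//.
  have := sqr_ge0 (x ^+ 2 - 1); rewrite (exprM x 2 2); nra.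
Qed.
End gaussian_moments.
Section gaussian_rv.
Context (R : realType) d (T : measurableType d) (P : probability T R).
Notation leb := (@lebesgue_measure R).

(** Phrased through the second moment, the formulas hold for the Dirac mass as well as for a
    density, so degenerate Gaussian vectors need no case distinction afterwards. In both cases the
    vanishing expectation forces m = 0. *)
Lemma gaussian_rv_facts (V : T -> R) : measurable_fun setT V ->
  gaussian_law (fun A => P (V @^-1` A)) -> \int[P]_w V w = 0 ->
  [/\ integ P (fun w => V w ^+ 4),
      \int[P]_w (V w ^+ 4) = 3 * (\int[P]_w (V w ^+ 2)) ^+ 2 &
      \int[P]_w cos (V w) = expR (- (\int[P]_w (V w ^+ 2)) / 2)].
Proof.
move=> mV [m [lawD|[s [s0 lawN]]]] EV0.
  have h (h : R -> R) : measurable_fun setT h ->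
    integ P (h \o V) /\ \int[P]_w h (V w) = h m.
    move=> mh.
    pose D : {measure set (measurableTypeR R) -> \bar R} := @dirac _ (measurableTypeR R) m R.
    have ih : integ D h.
      apply/integrableP; split; first exact/measurable_EFinP.
      rewrite (@integral_dirac _ (measurableTypeR R) m R setT measurableT)//.
        by rewrite diracT mul1e ltry.
      by apply/measurableT_comp => //; exact/measurable_EFinP.
    have [i e] := @law_transfer _ _ _ P D V h mV lawD mh ih; split => //.
    rewrite e /Rintegral (@integral_dirac _ (measurableTypeR R) m R setT measurableT)//.
      by rewrite diracT mul1e.
    exact/measurable_EFinP.
  have [_ e1] := h id (@measurable_id _ _ _).
  have m0 : m = 0 by rewrite -EV0 -e1.
  have [_ ->] := h (fun x => x ^+ 2) (measurable_funX _ (@measurable_id _ _ _)).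
  have [i4 ->] := h (fun x => x ^+ 4) (measurable_funX _ (@measurable_id _ _ _)).
  have [_ ->] := h cos (continuous_measurable_fun (@continuous_cos R)).
  by split => //; rewrite m0 !expr0n/= ?expr0n/= ?mulr0// oppr0 mul0r cos0 expR0.
have h (h : R -> R) (C : R) : measurable_fun setT h ->
    (forall x, `|h x| <= C * (1 + (x - m) ^+ 4)) ->
    integ P (h \o V) /\ \int[P]_w h (V w) = \int[leb]_x (h x * normal_pdf m s x).
  move=> mh hC.
  have [ih eh] := integ_normal_prob mh (integ_normal_poly s0 mh hC).
  have [i e] := law_transfer mV lawN mh ih.
  by split => //; rewrite e eh.
have mX k : measurable_fun setT (fun x : R => x ^+ k).
  exact: measurable_funX _ (@measurable_id _ _ _).
have m0 : m = 0.
  have [//||i e] := h id (1 + `|m|).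
    move=> x; rewrite mulrDl mul1r.
    have {1}-> : x = (x - m) + m by rewrite subrK.
    rewrite (le_trans (ler_normD _ _))// lerD// ?normr_le_quartic//.
    by rewrite ler_peMr// lerDl exprn_even_ge0.
  have := normal_mean s0 m.
  have ip := @integ_normal_pdf R m s.
  under eq_Rintegral do rewrite mulrBl.
  rewrite RintegralB//.
  - rewrite -e EV0 RintegralZl// Rintegral_normal_pdf mulr1 sub0r.
    by move/eqP; rewrite oppr_eq0 => /eqP.
  - apply: (@integ_normal_poly _ _ _ _ (1 + `|m|)) => // x.
    rewrite mulrDl mul1r.
    have {1}-> : x = (x - m) + m by rewrite subrK.
    rewrite (le_trans (ler_normD _ _))// lerD// ?normr_le_quartic//.
    by rewrite ler_peMr// lerDl exprn_even_ge0.
  - exact: integZ.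
subst m.
have [|i2 ->] := h (fun x => x ^+ 2) 1 (mX 2).
  move=> x; rewrite subr0 mul1r ger0_norm ?sqr_ge0//.
  have := sqr_ge0 (x ^+ 2 - 1); rewrite (exprM x 2 2); nra.
have [|i4 ->] := h (fun x => x ^+ 4) 1 (mX 4).
  by move=> x; rewrite subr0 mul1r ger0_norm ?exprn_even_ge0// lerDr.
have [|ic ->] := h cos 1 (continuous_measurable_fun (@continuous_cos R)).
  by move=> x; rewrite subr0 mul1r (le_trans (normr_cos_le1 _))// lerDl exprn_even_ge0.
rewrite normal_moment2// normal_moment4//; split => //; first by rewrite -exprM.
have := normal_cos s0 1; under eq_Rintegral do rewrite mul1r.
by move=> ->; rewrite expr1n mulr1 mulNr.
Qed.
End gaussian_rv.

(** * Stein's equation *)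

Lemma integS d (T : measurableType d) (R : realType) (mu : {measure set T -> \bar R})
    (f : T -> R) (D : set T) : measurable D -> integ mu f -> mu.-integrable D (EFin \o f).
Proof. by move=> mD; exact: integrableS. Qed.

Section stein_equation.
Context (R : realType).
Notation leb := (@lebesgue_measure R).
Local Notation p := (@normal_pdf R 0 1).

Lemma Rintegral_line_split (f : R -> R) x : integ leb f ->
  \int[leb]_t f t = \int[leb]_(t in `]-oo, x]) f t + \int[leb]_(t in `]x, +oo[) f t.
Proof.
move=> intf.
rewrite -Rintegral_setU//.
- by congr (Rintegral _ _ _); apply/seteqP; split => t //= _; rewrite !in_itv/= andbT; case: leP; [left|right].
- by apply: integS => //; exact: measurableU.
- by apply: lt_disjoint => s t; rewrite !in_itv/= andbT => h1 h2; exact: le_lt_trans h1 h2.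
Qed.

Lemma is_derive_pdf01 (x : R) : is_derive x 1 p (- x * p x).
Proof.
have h := is_derive_normal_pdf 0 x (@ltr01 R).
by apply: is_derive_eq; rewrite subr0 expr1n divr1.
Qed.

Lemma integ_xpdf01 : integ leb (fun x => - x * p x).
Proof.
apply: (@integ_normal_poly _ _ _ _ 1) => //.
by move=> x; rewrite subr0 mul1r normrN normr_le_quartic.
Qed.

Lemma continuous_pdf01 : continuous p.
Proof. exact: continuous_normal_pdf. Qed.

Lemma lower_moment_pdf01 (x : R) : \int[leb]_(t in `]-oo, x]) (- t * p t) = p x.
Proof.
apply: FTC_ray.
- by move=> t; apply: cvgM; [apply: cvgN; exact: cvg_id|exact: continuous_pdf01].
- exact: is_derive_pdf01.
- exact: integ_xpdf01.
- have := @normal_pdf_vanish R 0 1 (fun=> 1) 1 (fun n => - n%:R) ltr01.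
  under eq_fun do rewrite mul1r; apply.
    by move=> t; rewrite normr1 mul1r lerDl exprn_even_ge0.
  by move=> n; rewrite normrN normr_nat.
Qed.

Lemma upper_moment_pdf01 (x : R) : \int[leb]_(t in `]x, +oo[) (t * p t) = p x.
Proof.
have i : integ leb (fun t => t * p t).
  have := integN integ_xpdf01; congr (integ leb _).
  by apply/funext => t; rewrite mulNr opprK.
have := normal_mean (@ltr01 R) 0.
under eq_Rintegral do rewrite subr0.
rewrite (Rintegral_line_split x i) => /eqP; rewrite addrC addr_eq0 => /eqP ->.
rewrite -mulN1r -RintegralZl//; last exact: integS.
rewrite -[RHS]lower_moment_pdf01; apply: eq_Rintegral => t _.
by rewrite mulN1r mulNr.
Qed.

Variables (h : R -> R).
Hypothesis ch : continuous h.
Hypothesis h01 : forall x, 0 <= h x <= 1.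
Let c := \int[leb]_t (h t * p t).
Let k t := (h t - c) * p t.

Let mh : measurable_fun setT h.
Proof. exact: continuous_measurable_fun. Qed.

Let ihp : integ leb (fun t => h t * p t).
Proof.
apply: integ_normal_bnd => // x; have /andP[h0 h1] := h01 x.
by rewrite ger0_norm.
Qed.

Let c01 : 0 <= c <= 1.
Proof.
apply/andP; split.
  by apply: Rintegral_ge0 => t _; have /andP[h0 _] := h01 t; rewrite mulr_ge0// normal_pdf_ge0.
rewrite -(Rintegral_normal_pdf 1 0); apply: le_Rintegral => //; first exact: integ_normal_pdf.
by move=> t _; have /andP[_ h1] := h01 t; rewrite ler_piMl// normal_pdf_ge0.
Qed.

Let hc1 t : `|h t - c| <= 1.
Proof.
have /andP[h0 h1] := h01 t; have /andP[c0 c1] := c01.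
by rewrite ler_norml; apply/andP; split; lra.
Qed.

Let ik : integ leb k.
Proof.
apply: integ_normal_bnd => //.
by apply: measurable_funB => //; exact: measurable_cst.
Qed.

Let k_total : \int[leb]_t k t = 0.
Proof.
rewrite /k; under eq_Rintegral do rewrite mulrBl.
rewrite RintegralB//; last by apply: integZ; exact: integ_normal_pdf.
rewrite RintegralZl//; last exact: integ_normal_pdf.
by rewrite Rintegral_normal_pdf// mulr1 subrr.
Qed.

Let G x := \int[leb]_(t in `]-oo, x]) k t.

Let ck : continuous k.
Proof.
move=> x; apply: cvgM; last exact: continuous_pdf01.
by apply: cvgB; [exact: ch|exact: cvg_cst].
Qed.

Let dG (x : R) : is_derive x 1 G (k x).
Proof.
have xx : x < x + 1 by rewrite ltrDl.
have ik' : leb.-integrable [set` Interval -oo%O (BRight (x + 1))] (EFin \o k).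
  exact: integS.
have [||d1 d2] := continuous_FTC1 xx ik'; [exact: ltNyr|exact: ck|].
by split; [exact: d1|rewrite -derive1E d2].
Qed.

(** The Mills ratio argument: since |k| <= p, and |x| <= |t| on the ray beyond x, the product |x
    G(x)| is at most the integral of |t| p(t) over that ray, which is exactly p(x). *)
Let xG (x : R) : `|x * G x| <= p x.
Proof.
have kp t : `|k t| <= p t.
  by rewrite /k normrM (ger0_norm (normal_pdf_ge0 _ _ _)) ler_piMl// normal_pdf_ge0.
have i : integ leb (fun t => t * p t).
  have := integN integ_xpdf01; congr (integ leb _).
  by apply/funext => t; rewrite mulNr opprK.
have [x0|x0] := leP x 0.
  rewrite normrM (ler0_norm x0) -(lower_moment_pdf01 x).
  have hG : `|G x| <= \int[leb]_(t in `]-oo, x]) `|k t|.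
    by apply: le_normr_Rintegral => //; exact: integS.
  have nx0 : 0 <= - x by rewrite oppr_ge0.
  rewrite (le_trans (ler_wpM2l nx0 hG))//.
  rewrite -RintegralZl//; last by apply: integS => //; exact: integ_norm.
  apply: le_Rintegral => //.
  - by apply: integS => //; apply: integZ; exact: integ_norm.
  - by apply: integS => //; exact: integ_xpdf01.
  - move=> t /=; rewrite in_itv/= => tx; rewrite ler_pM// ?oppr_ge0//.
    by rewrite lerN2.
(* For x > 0 the estimate has to be made on the upper ray, which is possible because k has total
   integral zero. *)
have -> : G x = - \int[leb]_(t in `]x, +oo[) k t.
  by apply/eqP; rewrite -addr_eq0 -Rintegral_line_split// k_total.
rewrite mulrN normrN normrM (gtr0_norm x0) -(upper_moment_pdf01 x).
have hG : `|\int[leb]_(t in `]x, +oo[) k t| <= \int[leb]_(t in `]x, +oo[) `|k t|.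
  by apply: le_normr_Rintegral => //; exact: integS.
rewrite (le_trans (ler_wpM2l (ltW x0) hG))//.
rewrite -RintegralZl//; last by apply: integS => //; exact: integ_norm.
apply: le_Rintegral => //.
- by apply: integS => //; apply: integZ; exact: integ_norm.
- by apply: integS.
- move=> t /=; rewrite in_itv/= andbT => xt; rewrite ler_pM// ?ltW//.
Qed.

(** The solution is f = G / p. From |x f(x)| <= 1 and |h - c| <= 1 the equation itself gives |f'| <=
    2. This bound does not see the modulus of continuity of h, which is what later allows h to
    approach an indicator at no cost. *)
Lemma stein_solution : exists f df : R -> R,
  [/\ forall x : R, is_derive x 1 f (df x), continuous df,
      exists A, forall x, `|f x| <= A,
      forall x, `|df x| <= 2 &
      forall x, df x - x * f x = h x - \int[leb]_t (h t * p t)].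
Proof.
have p0 x : 0 < p x by exact: normal_pdf_gt0.
have pn0 x : p x != 0 by rewrite gt_eqF.
pose f x := G x / p x.
pose df x := h x - c + x * f x.
have dfE (x : R) : is_derive x 1 f (df x).
  have d1 := dG x; have d2 := is_derive_pdf01 x.
  have d3 := is_deriveV (pn0 x) d2.
  apply: is_derive_eq; rewrite /df /f /k /GRing.scale/= -exprVn; field.
  exact: pn0.
have xf x : `|x * f x| <= 1.
  by rewrite /f mulrA normrM normfV (gtr0_norm (p0 x)) ler_pdivrMr// mul1r.
have df2 x : `|df x| <= 2.
  by rewrite /df (le_trans (ler_normD _ _))// -[leRHS]/(1 + 1) lerD.
exists f, df; split => //.
- move=> x; apply: cvgD; first by apply: cvgB; [exact: ch|exact: cvg_cst].
  apply: cvgM; first exact: cvg_id.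
  by apply/differentiable_continuous/derivable1_diffP; have [] := dfE x.
(* On [-1, 1] the derivative bound controls f from its value at 0; outside, |x f(x)| <= 1 gives
   |f(x)| <= 1. *)
- exists (`|f 0| + 2) => x.
  have [x1|x1] := leP `|x| 1.
    have [e _ he] := @MVT_all R f df 0 x dfE; rewrite subr0 in he.
    rewrite -(subrK (f 0) (f x)) (le_trans (ler_normD _ _))// addrC lerD// he normrM.
    by rewrite -[leRHS]mulr1 ler_pM.
  apply: ler_wpDl => //; apply: (@le_trans _ _ 1); last by rewrite ler1n.
  have := xf x; rewrite normrM; apply: le_trans.
  by rewrite ler_peMl// ltW.
- by move=> x; rewrite /df addrK.
Qed.
End stein_equation.

Section poly_prim.
Context (R : realType).

(** The primitive with zero constant term: at i = 0 the coefficient is a division by zero, whose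
    value is 0. *)
Definition poly_prim (p : {poly R}) : {poly R} := \poly_(i < (size p).+1) (p`_i.-1 / i%:R).

Lemma deriv_poly_prim p : (poly_prim p)^`() = p.
Proof.
apply/polyP => i; rewrite coef_deriv coef_poly ltnS.
case: ltnP => ip; last by rewrite nth_default// mul0rn.
by rewrite /= -[LHS]mulr_natr divfK// pnatr_eq0.
Qed.
End poly_prim.

Lemma Rintegral_prob_cst (R : realType) d (T : measurableType d) (P : probability T R) (c : R) :
  \int[P]__ c = c.
Proof.
rewrite Rintegral_cst// -[RHS]mulr1; congr (_ * _).
exact: (congr1 fine (probability_setT P)).
Qed.

(** * Quadratic functionals of Gaussian vectors *)

Section fubini_swap.
Context (R : realType) d (T : measurableType d) (P : probability T R).
Notation leb := (@lebesgue_measure R).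

(** As k is bounded by 1, |A(w)| |q(t)| is an integrable majorant on the product. Integrability of
    the outer integrand is returned too, because such integrals are later added and subtracted. *)
Lemma Rintegral_swap (A : T -> R) (Y : T -> R) (k q : R -> R) :
  integ P A -> measurable_fun setT Y -> measurable_fun setT k ->
  (forall x, `|k x| <= 1) -> integ leb q ->
  \int[leb]_t (q t * \int[P]_w (A w * k (Y w * t))) =
  \int[P]_w (A w * \int[leb]_t (q t * k (Y w * t))) /\
  integ leb (fun t => q t * \int[P]_w (A w * k (Y w * t))).
Proof.
move=> iA mY mk k1 iq.
have mA := integ_measurable iA.
have mq : measurable_fun setT q := integ_measurable iq.
pose f (z : T * (measurableTypeR R)) : \bar R := (A z.1 * q z.2 * k (Y z.1 * z.2))%:E.
have mf : measurable_fun setT f.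
  apply/measurable_EFinP; apply: measurable_funM.
    by apply: measurable_funM; apply: measurableT_comp => //.
  apply: measurableT_comp => //; apply: measurable_funM => //.
  by apply: measurableT_comp.
have i1 w : integ leb (fun t => k (Y w * t) * q t).
  apply: (@integ_le _ _ _ leb _ (fun t => `|q t|)); last 2 first.
  - exact: integ_norm.
  - by move=> t; rewrite normrM ler_piMl.
  by apply: measurable_funM => //; apply: measurableT_comp => //.
have i2 t : integ P (fun w => k (Y w * t) * A w).
  apply: (@integ_le _ _ _ P _ (fun w => `|A w|)); last 2 first.
  - exact: integ_norm.
  - by move=> w; rewrite normrM ler_piMl.
  apply: measurable_funM => //; apply: measurableT_comp => //.
  exact: measurable_funM.
have fi : (P \x leb)%E.-integrable setT f.
  apply/integrable12ltyP => //.
  have inn w : (\int[leb]_y `|f (w, y)| <= (`|A w| * \int[leb]_y `|q y|)%:E)%E.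
    apply: (@le_trans _ _ (\int[leb]_y (`|A w| * `|q y|)%:E)%E).
      apply: ge0_le_integral => //.
      - apply/measurableT_comp => //; apply/measurable_EFinP.
        have := integ_measurable (integZ (A w) (i1 w)).
        by congr (measurable_fun _ _); apply/funext => t /=; rewrite -mulrA (mulrC (q _)).
      - by apply/measurable_EFinP; apply: measurable_funM => //; exact: measurableT_comp.
      - by move=> t _; rewrite /= lee_fin !normrM ler_piMr// mulr_ge0.
    rewrite EFinM fineK; last by apply: integrable_fin_num => //; exact: integ_norm.
    by rewrite -integralZl//; exact: integ_norm.
  apply: (@le_lt_trans _ _ (\int[P]_w (`|A w| * \int[leb]_y `|q y|)%:E)%E).
    apply: ge0_le_integral => //.
    - by move=> w _; apply: integral_ge0 => t _; exact: abse_ge0.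
    - apply: (@measurable_fun_fubini_tonelli_F _ _ _ _ _ leb (fun z => `|f z|)%E) => //.
      exact: measurableT_comp.
    - by apply/measurable_EFinP; apply: measurable_funM => //; exact: measurableT_comp.
  under eq_integral do rewrite mulrC EFinM.
  rewrite /= integralZl//; last exact: integ_norm.
  rewrite lte_mul_pinfty//; first by rewrite lee_fin Rintegral_ge0.
  by have /integrableP[_] := iA.
have e1 w : (\int[leb]_t f (w, t) = (A w * \int[leb]_t (q t * k (Y w * t)))%:E)%E.
  rewrite -RintegralZl//; last first.
    by have := i1 w; congr (integ leb _); apply/funext => t; rewrite mulrC.
  rewrite fineK; last first.
    apply: integrable_fin_num => //.
    have := integZ (A w) (i1 w); congr (integ leb _); apply/funext => t.
    by rewrite (mulrC (k _)).
  by apply: eq_integral => t _; rewrite /f /= mulrA.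
have e2 t : (\int[P]_w f (w, t) = (q t * \int[P]_w (A w * k (Y w * t)))%:E)%E.
  rewrite -RintegralZl//; last first.
    by have := i2 t; congr (integ P _); apply/funext => w; rewrite mulrC.
  rewrite fineK; last first.
    apply: integrable_fin_num => //.
    have := integZ (q t) (i2 t); congr (integ P _); apply/funext => w.
    by rewrite (mulrC (k _)).
  by apply: eq_integral => w _; rewrite /f /= mulrCA mulrA.
split.
  have := Fubini fi.
  under eq_integral do rewrite e1.
  under [in X in _ = X -> _]eq_integral do rewrite e2.
  by rewrite /Rintegral => ->.
apply: (@integ_le _ _ _ leb _ (fun t => `|q t| * \int[P]_w `|A w|)).
- apply/measurable_EFinP.
  rewrite (_ : _ \o _ = fun t => \int[P]_w f (w, t))%E; last first.
    by apply/funext => t; rewrite e2.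
  exact: measurable_fubini_G fi.
- under eq_fun do rewrite mulrC.
  by apply: integZ; exact: integ_norm.
- move=> t; rewrite normrM ler_wpM2l//.
  have i3 : integ P (fun w => A w * k (Y w * t)).
    by have := i2 t; congr (integ P _); apply/funext => w; rewrite mulrC.
  rewrite (le_trans (le_normr_Rintegral _ _))//.
  apply: le_Rintegral => //; [exact: integ_norm|exact: integ_norm|].
  by move=> w _; rewrite normrM ler_piMr.
Qed.
End fubini_swap.

(** * Integration by parts for centred Gaussian vectors *)

Section gaussian_family.
Context (R : realType) d (T : measurableType d) (P : probability T R).
Notation leb := (@lebesgue_measure R).
Variables (n : nat) (X : 'I_n -> T -> R).
Hypothesis mX : forall i, measurable_fun setT (X i).
Hypothesis gX : forall a : 'I_n -> R,
  gaussian_law (fun A => P ((fun w => \sum_i a i * X i w) @^-1` A)).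
Hypothesis EX : forall i, \int[P]_w X i w = 0.

Lemma integ_X4 i : integ P (fun w => X i w ^+ 4).
Proof.
have e : (fun w => \sum_j (j == i)%:R * X j w) = X i.
  apply/funext => w; rewrite (bigD1 i)//= eqxx mul1r big1 ?addr0// => j ji.
  by rewrite (negbTE ji) mul0r.
have := gX (fun j => (j == i)%:R); rewrite e => gXi.
by have [] := gaussian_rv_facts (mX i) gXi (EX i).
Qed.

Let M w := 1 + \sum_i `|X i w|.

(** A graded class of functions of polynomial growth: degrees add under products, and degree at most
    4 implies integrability because fourth moments are finite. Integrability obligations thus reduce
    to counting degrees. *)
Definition polybnd (k : nat) (f : T -> R) :=
  measurable_fun setT f /\ exists2 C, 0 <= C & forall w, `|f w| <= C * M w ^+ k.

Lemma M_ge1 w : 1 <= M w.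
Proof. by rewrite lerDl sumr_ge0. Qed.

Lemma polybndW j k f : (j <= k)%N -> polybnd j f -> polybnd k f.
Proof.
move=> jk [mf [C C0 fC]]; split => //; exists C => // w.
by rewrite (le_trans (fC w))// ler_wpM2l// ler_weXn2l// M_ge1.
Qed.

Lemma polybndM j k f g : polybnd j f -> polybnd k g ->
  polybnd (j + k) (fun w => f w * g w).
Proof.
move=> [mf [C C0 fC]] [mg [D D0 gD]]; split; first exact: measurable_funM.
exists (C * D); first exact: mulr_ge0.
move=> w; rewrite normrM exprD mulrACA ler_pM//.
Qed.

Lemma polybndD k f g : polybnd k f -> polybnd k g -> polybnd k (fun w => f w + g w).
Proof.
move=> [mf [C C0 fC]] [mg [D D0 gD]]; split; first exact: measurable_funD.
exists (C + D); first exact: addr_ge0.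
by move=> w; rewrite mulrDl (le_trans (ler_normD _ _))// lerD.
Qed.

Lemma polybnd_sum (I : Type) (s : seq I) k (F : I -> T -> R) :
  (forall i, polybnd k (F i)) -> polybnd k (fun w => \sum_(i <- s) F i w).
Proof.
move=> h; elim: s => [|a s ih].
  rewrite (_ : (fun w => _) = fun=> 0); last by apply/funext => w; rewrite big_nil.
  split; first exact: measurable_cst.
  by exists 0 => // w; rewrite normr0 mul0r.
rewrite (_ : (fun w => _) = fun w => F a w + \sum_(i <- s) F i w).
  exact: polybndD.
by apply/funext => w; rewrite big_cons.
Qed.

Lemma polybnd_bounded (f : T -> R) (C : R) : measurable_fun setT f -> (forall w, `|f w| <= C) -> polybnd 0 f.
Proof.
move=> mf fC; split => //; exists `|C| => // w.
by rewrite expr0 mulr1 (le_trans (fC w))// ler_norm.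
Qed.

Lemma polybnd_cst c : polybnd 0 (fun=> c).
Proof. by apply: (@polybnd_bounded _ `|c|) => //; exact: measurable_cst. Qed.

Lemma polybndZ k c f : polybnd k f -> polybnd k (fun w => c * f w).
Proof. by move=> h; have := polybndM (polybnd_cst c) h. Qed.

Lemma polybnd_X i : polybnd 1 (X i).
Proof.
split => //; exists 1 => // w; rewrite mul1r expr1 /M (bigD1 i)//=.
by rewrite addrCA lerDl addr_ge0// sumr_ge0.
Qed.

Lemma integ_M4 : integ P (fun w => M w ^+ 4).
Proof.
have E : exists2 C, 0 <= C & forall w, M w ^+ 4 <= C * (1 + \sum_i X i w ^+ 4).
  rewrite /M; elim: (index_enum _) => [|i s [C C0 IH]].
    by exists 1 => // w; rewrite !big_nil !addr0 expr1n mul1r.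
  exists (8 * (C + 1)); first by rewrite mulr_ge0// addr_ge0.
  move=> w; rewrite !big_cons.
  have -> : 1 + (`|X i w| + \sum_(j <- s) `|X j w|) = `|X i w| + (1 + \sum_(j <- s) `|X j w|) by rewrite addrCA.
  have := IH w; set Y := 1 + _; set S := \sum_(j <- s) _ => IHw.
  have S0 : 0 <= S by rewrite /S sumr_ge0// => j _; rewrite exprn_even_ge0.
  have h4 : X i w ^+ 4 = `|X i w| ^+ 4.
    by rewrite (exprM _ 2 2) -(real_normK (num_real (X i w))) -exprM.
  rewrite h4; set x := `|X i w|.
  have x4 : 0 <= x ^+ 4 by rewrite exprn_even_ge0.
  (* The inequality (x + y)^2 <= 2 (x^2 + y^2) is applied twice, first to x and Y and then to their
     squares. *)
  have l1 : (x + Y) ^+ 4 <= 8 * (x ^+ 4 + Y ^+ 4).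
    have a1 : (x + Y) ^+ 2 <= 2 * (x ^+ 2 + Y ^+ 2).
      by have := sqr_ge0 (x - Y); nra.
    have a2 : ((x + Y) ^+ 2) ^+ 2 <= (2 * (x ^+ 2 + Y ^+ 2)) ^+ 2.
      rewrite ler_pXn2r// ?nnegrE ?sqr_ge0//.
      by rewrite mulr_ge0// addr_ge0// sqr_ge0.
    rewrite (exprM _ 2 2) (le_trans a2)//.
    have := sqr_ge0 (x ^+ 2 - Y ^+ 2); rewrite (exprM x 2 2) (exprM Y 2 2); nra.
  rewrite (le_trans l1)// -mulrA ler_wpM2l// .
  have : 0 <= C * x ^+ 4 by rewrite mulr_ge0.
  nra.
have [C C0 h] := E.
apply: (@integ_le _ _ _ P _ (fun w => C * (1 + \sum_i X i w ^+ 4))).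
- apply: measurable_funX; apply: measurable_funD => //.
  by apply: measurable_sum => i; exact: measurableT_comp.
- apply: integZ; apply: integD; last by apply: integ_sum => i; exact: integ_X4.
  exact: finite_measure_integrable_cst.
- by move=> w; rewrite ger0_norm// exprn_ge0// (le_trans _ (M_ge1 w)).
Qed.

Lemma polybnd_integ k f : (k <= 4)%N -> polybnd k f -> integ P f.
Proof.
move=> k4 /(polybndW k4) [mf [C C0 fC]].
by apply: (@integ_le _ _ _ P _ (fun w => C * M w ^+ 4)) => //; apply: integZ; exact: integ_M4.
Qed.

Let S i j := \int[P]_w (X i w * X j w).
Definition linc (a : 'I_n -> R) w := \sum_i a i * X i w.

Lemma polybnd_linc a : polybnd 1 (linc a).
Proof. by apply: polybnd_sum => i; apply: polybndZ; exact: polybnd_X. Qed.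

Lemma integ_XX i j : integ P (fun w => X i w * X j w).
Proof. by apply: (@polybnd_integ 2) => //; exact: polybndM (polybnd_X i) (polybnd_X j). Qed.

Lemma E_linc_linc a b : \int[P]_w (linc a w * linc b w) = \sum_i \sum_j a i * b j * S i j.
Proof.
rewrite (_ : (fun w => _) = fun w => \sum_i \sum_j a i * b j * (X i w * X j w)).
  rewrite Rint_sum.
    apply: eq_bigr => i _; rewrite Rint_sum.
      by apply: eq_bigr => j _; rewrite RintegralZl//; exact: integ_XX.
    by move=> j; apply: integZ; exact: integ_XX.
  by move=> i; apply: integ_sum => j; apply: integZ; exact: integ_XX.
apply/funext => w; rewrite /linc big_distrlr/=; apply: eq_bigr => i _.
by apply: eq_bigr => j _; rewrite mulrACA.
Qed.

Lemma E_linc a : \int[P]_w linc a w = 0.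
Proof.
rewrite /linc Rint_sum; last by move=> i; apply: integZ; exact: polybnd_integ (polybnd_X i).
by rewrite big1// => i _; rewrite RintegralZl ?EX ?mulr0//; exact: polybnd_integ (polybnd_X i).
Qed.

Lemma linc_facts a : [/\ integ P (fun w => linc a w ^+ 4),
  \int[P]_w (linc a w ^+ 4) = 3 * (\int[P]_w (linc a w ^+ 2)) ^+ 2 &
  \int[P]_w cos (linc a w) = expR (- (\int[P]_w (linc a w ^+ 2)) / 2)].
Proof. by apply: gaussian_rv_facts; [have [] := polybnd_linc a|exact: gX|exact: E_linc]. Qed.

Lemma E_X_linc u b : \int[P]_w (X u w * linc b w) = \sum_j b j * S u j.
Proof.
under eq_Rintegral do rewrite /linc mulr_sumr.
rewrite Rint_sum.
  apply: eq_bigr => j _; under eq_Rintegral do rewrite mulrCA.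
  by rewrite RintegralZl//; exact: integ_XX.
move=> j; have := integZ (b j) (integ_XX u j); congr (integ P _).
by apply/funext => w; rewrite mulrCA.
Qed.

Lemma measurable_linc a : measurable_fun setT (linc a).
Proof. by have [] := polybnd_linc a. Qed.

Lemma measurable_cosf (f : T -> R) : measurable_fun setT f -> measurable_fun setT (fun w => cos (f w)).
Proof. by move=> mf; apply: measurableT_comp mf; exact: continuous_measurable_fun (@continuous_cos R). Qed.

Lemma measurable_sinf (f : T -> R) : measurable_fun setT f -> measurable_fun setT (fun w => sin (f w)).
Proof. by move=> mf; apply: measurableT_comp mf; exact: continuous_measurable_fun (@continuous_sin R). Qed.

Lemma polybnd_cosf (f : T -> R) : measurable_fun setT f -> polybnd 0 (fun w => cos (f w)).
Proof.
by move=> mf; apply: (@polybnd_bounded _ 1); [exact: measurable_cosf|move=> w; exact: normr_cos_le1].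
Qed.

Lemma polybnd_sinf (f : T -> R) : measurable_fun setT f -> polybnd 0 (fun w => sin (f w)).
Proof.
by move=> mf; apply: (@polybnd_bounded _ 1); [exact: measurable_sinf|move=> w; exact: normr_sin_le1].
Qed.

(* Differentiate E cos(V + t X_u) = exp(- Var(V + t X_u) / 2) at t = 0. *)
Lemma ibp_sin_linc u b :
  \int[P]_w (X u w * sin (linc b w)) = (\sum_j b j * S u j) * \int[P]_w cos (linc b w).
Proof.
pose f (t : R) w := cos (linc b w + t * X u w).
set K := \sum_j _.
have mlx t : measurable_fun setT (fun w => linc b w + t * X u w).
  apply: measurable_funD; first exact: measurable_linc.
  exact: measurable_funM.
have d1 (t : R) w : is_derive t 1 (fun t => f t w) (- (X u w * sin (linc b w + t * X u w))).
  have h : is_derive t 1 (fun t => linc b w + t * X u w) (X u w).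
    by apply: is_derive_eq; rewrite /GRing.scale/=; ring.
  have h2 := @is_derive1_comp _ cos (fun t => linc b w + t * X u w) t _ _ (is_derive_cos _) h.
  by apply: is_derive_eq; rewrite mulNr mulrC.
have p1 t w : partial1of2 f t w = - (X u w * sin (linc b w + t * X u w)).
  by rewrite partial1of2E; have [_ ->] := d1 t w.
have I0 : `](-1 : R), 1[%classic (0 : R) by rewrite /= in_itv/= ltrN10 ltr01.
have intf (t : R) : `](-1), 1[%classic t -> P.-integrable setT (EFin \o f t).
  by move=> _; apply: (@polybnd_integ 0) => //; exact: polybnd_cosf.
have derf (x : R) y : `](-1), 1[%classic x -> setT y -> derivable (f ^~ y) x 1.
  by move=> _ _; have [] := d1 x y.
have intG : P.-integrable setT (EFin \o (fun w => `|X u w|)).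
  by apply: integ_norm; exact: (@polybnd_integ 1) (polybnd_X u).
have G0 w : 0 <= `|X u w| by [].
have Gub (x : R) y : `](-1), 1[%classic x -> setT y -> `|partial1of2 f x y| <= `|X u y|.
  by move=> _ _; rewrite p1 normrN normrM ler_piMr// normr_sin_le1.
have h1 := derivable_under_integral measurableT I0 intf derf G0 intG Gub.
have h2 := differentiation_under_integral measurableT I0 intf derf G0 intG Gub.
have iXs : integ P (fun w => X u w * sin (linc b w)).
  apply: (@polybnd_integ 1) => //; have := polybndM (polybnd_X u) (polybnd_sinf (measurable_linc b)).
  by rewrite addn0.
(* V + t X_u is again a linear combination of the coordinates, so the expectation of its cosine is
   explicit; its variance is quadratic in t with linear coefficient 2K, where K = Cov(X_u, V). *)
have e1 : (fun t => \int[P]_w f t w) =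
   (fun t => expR (- (\int[P]_w (linc b w ^+ 2) + 2 * t * K + t ^+ 2 * S u u) / 2)).
  apply/funext => t.
  have e (w : T) : linc (fun j => b j + t * (j == u)%:R) w = linc b w + t * X u w.
    rewrite /linc; under eq_bigr do rewrite mulrDl.
    rewrite big_split/=; congr (_ + _).
    rewrite (bigD1 u)//= eqxx mulr1 big1 ?addr0// => j ju.
    by rewrite (negbTE ju) mulr0 mul0r.
  have [_ _] := linc_facts (fun j => b j + t * (j == u)%:R).
  under eq_Rintegral do rewrite e.
  under [in X in _ = X -> _]eq_Rintegral do rewrite e.
  rewrite /f => ->; congr (expR (- _ / 2)).
  have i1 : integ P (fun w => linc b w ^+ 2).
    by apply: (@polybnd_integ 2) => //; exact: polybndM (polybnd_linc b) (polybnd_linc b).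
  have i2 : integ P (fun w => X u w * linc b w).
    by apply: (@polybnd_integ 2) => //; exact: polybndM (polybnd_X u) (polybnd_linc b).
  have i3 := integ_XX u u.
  have e3 w : (linc b w + t * X u w) ^+ 2 = linc b w ^+ 2 + 2 * t * (X u w * linc b w) + t ^+ 2 * (X u w * X u w) by ring.
  under eq_Rintegral do rewrite e3.
  rewrite RintegralD//; last 2 first.
  - by apply: integD => //; exact: integZ.
  - exact: integZ.
  rewrite RintegralD//; last exact: integZ.
  by rewrite !RintegralZl// E_X_linc.
have D : is_derive (0 : R) 1 (fun t => \int[P]_w f t w) (- K * \int[P]_w cos (linc b w)).
  rewrite e1.
  set V := \int[P]_w (linc b w ^+ 2).
  have h : is_derive (0 : R) 1 (fun t => - (V + 2 * t * K + t ^+ 2 * S u u) / 2) (- K).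
    by apply: is_derive_eq; rewrite /GRing.scale/=; field.
  have h3 := is_derive1_comp (is_derive_expR _) h.
  apply: is_derive_eq; rewrite /GRing.scale/=.
  have [_ _ ->] := linc_facts b; rewrite -/V.
  by rewrite mulr0 mul0r expr0n/= mul0r !addr0 mulrC.
have := h2; rewrite derive1E.
have [_ ->] := D.
have -> : \int[P]_w partial1of2 f 0 w = - \int[P]_w (X u w * sin (linc b w)).
  rewrite -mulN1r -RintegralZl//; apply: eq_Rintegral => w _.
  by rewrite p1 mul0r addr0 mulN1r.
by rewrite mulNr => /eqP; rewrite eqr_opp => /eqP ->.
Qed.

(** Summing over a list instead of over all indices allows the Gaussian factors to be introduced one
    at a time, by induction on the list. *)
Let expQ (s : R) (l : seq 'I_n) w := expR (- (s * \sum_(i <- l) X i w ^+ 2)).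

Lemma polybnd_expQ s l : 0 <= s -> polybnd 0 (expQ s l).
Proof.
move=> s0; apply: (@polybnd_bounded _ 1).
  apply: measurableT_comp => //; apply: measurableT_comp => //.
  apply: measurable_funM => //; apply: measurable_sum => i.
  exact: measurable_funX.
move=> w; rewrite ger0_norm ?expR_ge0// -[leRHS]expR0 ler_expR oppr_le0.
by rewrite mulr_ge0// sumr_ge0// => i _; exact: sqr_ge0.
Qed.

Lemma integ_pdf_id : integ leb (fun t => normal_pdf 0 1 t * t).
Proof.
rewrite (_ : (fun t => _) = fun t => t * normal_pdf 0 1 t); last first.
  by apply/funext => t; rewrite mulrC.
by apply: (@integ_normal_poly _ _ _ _ 1) => // x; rewrite subr0 mul1r normr_le_quartic.
Qed.

(* Gaussian mixing: e^{-Y^2/2} = E cos(Y N) and Y e^{-Y^2/2} = E (N sin(Y N)) for N standard Gaussian. *)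
Lemma mix_cos (A Y : T -> R) : integ P A -> measurable_fun setT Y ->
  \int[P]_w (A w * expR (- (Y w ^+ 2 / 2))) =
  \int[leb]_t (normal_pdf 0 1 t * \int[P]_w (A w * cos (Y w * t))) /\
  integ leb (fun t => normal_pdf 0 1 t * \int[P]_w (A w * cos (Y w * t))).
Proof.
move=> iA mY.
have [e i] := Rintegral_swap iA mY (continuous_measurable_fun (@continuous_cos R))
  (@normr_cos_le1 R) (@integ_normal_pdf R 0 1).
split => //; rewrite e; apply: eq_Rintegral => w _; congr (_ * _).
under eq_Rintegral do rewrite mulrC.
by rewrite normal_cos// expr1n mul1r.
Qed.

Lemma mix_sin (A Y : T -> R) : integ P A -> measurable_fun setT Y ->
  \int[P]_w (A w * (Y w * expR (- (Y w ^+ 2 / 2)))) =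
  \int[leb]_t (normal_pdf 0 1 t * t * \int[P]_w (A w * sin (Y w * t))) /\
  integ leb (fun t => normal_pdf 0 1 t * t * \int[P]_w (A w * sin (Y w * t))).
Proof.
move=> iA mY.
have [e i] := Rintegral_swap iA mY (continuous_measurable_fun (@continuous_sin R))
  (@normr_sin_le1 R) integ_pdf_id.
split => //; rewrite e; apply: eq_Rintegral => w _; congr (_ * _).
under eq_Rintegral do rewrite -mulrA mulrC.
by rewrite stein_sin// normal_cos// expr1n !mul1r.
Qed.

(** Each factor exp(-s X_x^2) is a Gaussian mixture of cosines of multiples of X_x. Under the
    mixture only trigonometric functions of linear combinations remain, so the identity without the
    factor is available; integrating the mixing variable out again creates the summand of index
    x. *)
Lemma ibp_sin_expQ s u b l : 0 <= s ->
  \int[P]_w (X u w * expQ s l w * sin (linc b w)) =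
  (\sum_j b j * S u j) * \int[P]_w (expQ s l w * cos (linc b w))
  - 2 * s * \sum_(i <- l) S u i * \int[P]_w (X i w * expQ s l w * sin (linc b w)).
Proof.
move=> s0; elim: l b => [|x l IH] b.
  rewrite big_nil mulr0 subr0.
  have e w : expQ s [::] w = 1 by rewrite /expQ big_nil mulr0 oppr0 expR0.
  under eq_Rintegral do rewrite e mulr1.
  rewrite ibp_sin_linc; congr (_ * _); apply: eq_Rintegral => w _.
  by rewrite e mul1r.
(* This scale makes (c X_x)^2 / 2 equal to s X_x^2, as the mixing formulas require. *)
pose c := Num.sqrt (2 * s).
have c2 : c * c = 2 * s by rewrite -expr2 sqr_sqrtr// mulr_ge0.
pose Y w := c * X x w.
have mY : measurable_fun setT Y by exact: measurable_funM.
have Y2 w : Y w ^+ 2 / 2 = s * X x w ^+ 2 by rewrite /Y exprMn expr2 c2; field.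
have expQE w : expQ s (x :: l) w = expQ s l w * expR (- (Y w ^+ 2 / 2)).
  by rewrite Y2 /expQ big_cons mulrDr opprD expRD mulrC.
have pE := polybnd_expQ l s0.
have mL := measurable_linc b.
set L := linc b in mL *.
set K := \sum_j b j * S u j.
have pX i : polybnd 1 (fun w => X i w * expQ s l w * sin (L w)).
  by have := polybndM (polybndM (polybnd_X i) pE) (polybnd_sinf mL).
have iX i : integ P (fun w => X i w * expQ s l w * sin (L w)) := @polybnd_integ 1 _ isT (pX i).
have iC : integ P (fun w => expQ s l w * cos (L w)).
  by apply: (@polybnd_integ 0) => //; exact: (polybndM pE (polybnd_cosf mL)).
have iS : integ P (fun w => expQ s l w * sin (L w)).
  by apply: (@polybnd_integ 0) => //; exact: (polybndM pE (polybnd_sinf mL)).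
pose JX i t := \int[P]_w (X i w * expQ s l w * sin (L w) * cos (Y w * t)).
pose JC t := \int[P]_w (expQ s l w * cos (L w) * cos (Y w * t)).
pose JS t := \int[P]_w (expQ s l w * sin (L w) * sin (Y w * t)).
have mYt t : measurable_fun setT (fun w => Y w * t) by exact: measurable_funM.
(* For a fixed mixing variable t, sin(L) cos(Yt) is half the sum of sin(L + Yt) and sin(L - Yt). As
   Yt = c t X_x, both arguments are linear combinations with only the coefficient of X_x changed, so
   the induction hypothesis applies to each and the two instances are averaged. *)
have per_t t : JX u t = K * JC t - c * t * S u x * JS t
    - 2 * s * \sum_(i <- l) S u i * JX i t.
  have lincE e w : linc (fun j => b j + e * (j == x)%:R) w = L w + e * X x w.
    rewrite /L /linc; under eq_bigr do rewrite mulrDl.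
    rewrite big_split/=; congr (_ + _).
    rewrite (bigD1 x)//= eqxx mulr1 big1 ?addr0// => j jx.
    by rewrite (negbTE jx) mulr0 mul0r.
  have KE e : \sum_j (b j + e * (j == x)%:R) * S u j = K + e * S u x.
    under eq_bigr do rewrite mulrDl.
    rewrite big_split/=; congr (_ + _).
    rewrite (bigD1 x)//= eqxx mulr1 big1 ?addr0// => j jx.
    by rewrite (negbTE jx) mulr0 mul0r.
  have IHe e := IH (fun j => b j + e * (j == x)%:R).
  have mLe e : measurable_fun setT (fun w => L w + e * X x w).
    by apply: measurable_funD => //; exact: measurable_funM.
  have hX i e : integ P (fun w => X i w * expQ s l w * sin (L w + e * X x w)).
    apply: (@polybnd_integ 1) => //.
    by have := polybndM (polybndM (polybnd_X i) pE) (polybnd_sinf (mLe e)).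
  have hC e : integ P (fun w => expQ s l w * cos (L w + e * X x w)).
    by apply: (@polybnd_integ 0) => //; exact: (polybndM pE (polybnd_cosf (mLe e))).
  have iXc i : integ P (fun w => X i w * expQ s l w * sin (L w) * cos (Y w * t)).
    by apply: (@polybnd_integ 1) => //; have := polybndM (pX i) (polybnd_cosf (mYt t)).
  have sumX i : \int[P]_w (X i w * expQ s l w * sin (L w + (c * t) * X x w)) +
      \int[P]_w (X i w * expQ s l w * sin (L w + (- (c * t)) * X x w)) = 2 * JX i t.
    have h1 := hX i (c * t); have h2 := hX i (- (c * t)); have h3 := iXc i.
    rewrite /JX -RintegralD// -RintegralZl//; apply: eq_Rintegral => w _.
    have -> : - (c * t) * X x w = - (Y w * t) by rewrite /Y; ring.
    have -> : c * t * X x w = Y w * t by rewrite /Y; ring.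
    by rewrite sinB sinD; ring.
  have iCc : integ P (fun w => expQ s l w * cos (L w) * cos (Y w * t)).
    by apply: (@polybnd_integ 0) => //; have := polybndM (polybndM pE (polybnd_cosf mL)) (polybnd_cosf (mYt t)).
  have iSs : integ P (fun w => expQ s l w * sin (L w) * sin (Y w * t)).
    by apply: (@polybnd_integ 0) => //; have := polybndM (polybndM pE (polybnd_sinf mL)) (polybnd_sinf (mYt t)).
  pose Cp := \int[P]_w (expQ s l w * cos (L w + (c * t) * X x w)).
  pose Cm := \int[P]_w (expQ s l w * cos (L w + (- (c * t)) * X x w)).
  have eqY w : c * t * X x w = Y w * t by rewrite /Y; ring.
  have eqNY w : - (c * t) * X x w = - (Y w * t) by rewrite /Y; ring.
  have hCp := hC (c * t); have hCm := hC (- (c * t)).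
  have sumC : Cp + Cm = 2 * JC t.
    rewrite /Cp /Cm /JC -RintegralD// -RintegralZl//; apply: eq_Rintegral => w _.
    by rewrite eqY eqNY cosB cosD; ring.
  have difC : Cp - Cm = - 2 * JS t.
    rewrite /Cp /Cm /JS -RintegralB// -RintegralZl//; apply: eq_Rintegral => w _.
    by rewrite eqY eqNY cosB cosD; ring.
  have := sumX u.
  under eq_Rintegral do rewrite -lincE.
  under [X in _ + X = _ -> _]eq_Rintegral do rewrite -lincE.
  rewrite !IHe !KE.
  rewrite (_ : \int[P]_w (expQ s l w * cos (linc (fun j : 'I_n => b j + c * t * (j == x)%:R) w)) = Cp); last first.
    by apply: eq_Rintegral => w _; rewrite lincE.
  rewrite (_ : \int[P]_w (expQ s l w * cos (linc (fun j : 'I_n => b j + - (c * t) * (j == x)%:R) w)) = Cm); last first.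
    by apply: eq_Rintegral => w _; rewrite lincE.
  set A1 := \sum_(i <- l) _; set A2 := \sum_(i <- l) _ => e12.
  have eA : A1 + A2 = 2 * \sum_(i <- l) S u i * JX i t.
    rewrite /A1 /A2 -big_split/= mulr_sumr; apply: eq_bigr => i _.
    rewrite -mulrDr mulrCA -sumX; congr (_ * (_ + _)); apply: eq_Rintegral => w _;
    by rewrite lincE.
  have : 2 * JX u t = 2 * (K * JC t - c * t * S u x * JS t - 2 * s * \sum_(i <- l) S u i * JX i t).
    rewrite -e12.
    have -> : 2 * (K * JC t - c * t * S u x * JS t - 2 * s * (\sum_(i <- l) S u i * JX i t)) =
       K * (2 * JC t) + c * t * S u x * (- 2 * JS t) - 2 * s * (2 * \sum_(i <- l) S u i * JX i t) by ring.
    by rewrite -sumC -difC -eA; ring.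
  by apply: mulfI.
have [eXu iXu] := mix_cos (iX u) mY.
have [eC iCt] := mix_cos iC mY.
have [eS iSt] := mix_sin iS mY.
transitivity (\int[leb]_t (normal_pdf 0 1 t * JX u t)).
  rewrite -eXu; apply: eq_Rintegral => w _.
  by rewrite expQE; ring.
transitivity (\int[leb]_t (K * (normal_pdf 0 1 t * JC t)
   + (- (c * S u x)) * (normal_pdf 0 1 t * t * JS t)
   - 2 * s * \sum_(i <- l) S u i * (normal_pdf 0 1 t * JX i t))).
  apply: eq_Rintegral => t _; rewrite per_t.
  rewrite (_ : \sum_(i <- l) S u i * (normal_pdf 0 1 t * JX i t) = normal_pdf 0 1 t * \sum_(i <- l) S u i * JX i t).
    by ring.
  by rewrite mulr_sumr; apply: eq_bigr => i _; rewrite mulrCA.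
have iXt i : integ leb (fun t => S u i * (normal_pdf 0 1 t * JX i t)).
  by apply: integZ; have [] := mix_cos (iX i) mY.
rewrite RintegralB//; last 2 first.
- by apply: integD; apply: integZ.
- by apply: integZ; apply: integ_sum.
rewrite RintegralD//; last 2 first.
- exact: integZ.
- exact: integZ.
rewrite !RintegralZl//; last exact: integ_sum.
rewrite Rint_sum// -eC -eS big_cons mulrDr opprD addrA; congr (_ + _ - _ * _).
- by congr (_ * _); apply: eq_Rintegral => w _; rewrite expQE; ring.
(* Y contributes a second factor c, and c * c = 2 s is the coefficient of the new summand. *)
- rewrite (_ : \int[P]_w _ = c * \int[P]_w (X x w * expQ s (x :: l) w * sin (L w))).
    by rewrite -c2; ring.
  rewrite -RintegralZl//; first by apply: eq_Rintegral => w _; rewrite expQE /Y; ring.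
  apply: (@polybnd_integ 1) => //.
  by have := polybndM (polybndM (polybnd_X x) (polybnd_expQ (x :: l) s0)) (polybnd_sinf mL).
- apply: eq_bigr => i _; rewrite RintegralZl//; last by have [] := mix_cos (iX i) mY.
  have [<- _] := mix_cos (iX i) mY; congr (_ * _).
  by apply: eq_Rintegral => w _; rewrite expQE; ring.
Qed.

Lemma MVT_abs (f df : R -> R) (x : R) :
  (forall x : R, is_derive x 1 f (df x)) -> exists2 c, `|c| <= `|x| & f x - f 0 = df c * x.
Proof.
move=> h; have [c c01 e] := MVT_all 0 x h; rewrite subr0 in e; exists c => //.
move: c01; rewrite minElt maxElt; case: ltP => x0.
  by move=> /andP[c0 cx]; rewrite !ger0_norm// ltW.
by move=> /andP[cx c0]; rewrite !ler0_norm// lerN2.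
Qed.

Lemma normr_sin_le (x : R) : `|sin x| <= `|x|.
Proof.
have [c _] := @MVT_abs sin cos x (fun x => is_derive_sin x).
by rewrite sin0 !subr0 => ->; rewrite normrM ler_piMl// normr_cos_le1.
Qed.

Lemma normr_cosB1_le (x : R) : `|cos x - 1| <= `|x|.
Proof.
have [c _] := @MVT_abs cos (fun x => - sin x) x (fun x => is_derive_cos x).
by rewrite cos0 => ->; rewrite normrM ler_piMl// normrN normr_sin_le1.
Qed.

Lemma normr_sinB_le (x : R) : `|sin x - x| <= x ^+ 2.
Proof.
have dsy (y : R) : is_derive y 1 (fun y => sin y - y) (cos y - 1).
  by apply: is_derive_eq.
have [c cx] := @MVT_abs (fun y => sin y - y) (fun y => cos y - 1) x dsy.
rewrite sin0 !subr0 => ->; rewrite normrM -(real_normK (num_real x)) expr2.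
by rewrite ler_wpM2r// (le_trans (normr_cosB1_le _)).
Qed.

Lemma cvg_sin_scale (x : R) : k.+1%:R * sin (k.+1%:R^-1 * x) @[k --> \oo] --> x.
Proof.
apply/subr_cvg0; apply: norm_cvg0.
apply: (@squeeze_cvgr _ _ _ _ (cst 0) (fun k => x ^+ 2 * harmonic k)).
- near=> k; rewrite normr_ge0/= /harmonic/=.
  have k0 : k.+1%:R != 0 :> R by rewrite pnatr_eq0.
  have -> : k.+1%:R * sin (k.+1%:R^-1 * x) - x = k.+1%:R * (sin (k.+1%:R^-1 * x) - k.+1%:R^-1 * x).
    by rewrite mulrBr mulVKf.
  rewrite normrM normr_nat (le_trans (ler_wpM2l _ (normr_sinB_le _)))//.
  by rewrite le_eqVlt; apply/orP; left; apply/eqP; field.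
- exact: cvg_cst.
- rewrite -[X in _ --> X](mulr0 (x ^+ 2)).
  by apply: cvgM; [exact: cvg_cst|exact: cvg_harmonic].
Unshelve. all: by end_near.
Qed.

Lemma cvg_cos_scale (x : R) : cos (k.+1%:R^-1 * x) @[k --> \oo] --> (1 : R).
Proof.
apply/subr_cvg0; apply: norm_cvg0.
apply: (@squeeze_cvgr _ _ _ _ (cst 0) (fun k => `|x| * harmonic k)).
- near=> k; rewrite normr_ge0/= /harmonic/=.
  by rewrite (le_trans (normr_cosB1_le _))// normrM mulrC (ger0_norm (x := _^-1)) ?invr_ge0.
- exact: cvg_cst.
- rewrite -[X in _ --> X](mulr0 `|x|).
  by apply: cvgM; [exact: cvg_cst|exact: cvg_harmonic].
Unshelve. all: by end_near.
Qed.

(** The preceding identity is taken at the linear combination X_v / (k+1) and multiplied by k+1;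
    then (k+1) sin(X_v / (k+1)) tends to X_v and the cosine tends to 1, with majorants |X_i X_v| and
    [expQ]. *)
Lemma ibp_X_expQ s u v l : 0 <= s ->
  \int[P]_w (X u w * X v w * expQ s l w) =
  S u v * \int[P]_w expQ s l w
  - 2 * s * \sum_(i <- l) S u i * \int[P]_w (X i w * X v w * expQ s l w).
Proof.
move=> s0.
have pE := polybnd_expQ l s0.
have iE : integ P (expQ s l) by exact: (polybnd_integ _ pE).
have [mE _] := pE.
have E1 w : `|expQ s l w| <= 1.
  rewrite ger0_norm ?expR_ge0// -[leRHS]expR0 ler_expR oppr_le0.
  by rewrite mulr_ge0// sumr_ge0// => i _; exact: sqr_ge0.
have mXk k : measurable_fun setT (fun w => k.+1%:R^-1 * X v w) by exact: measurable_funM.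
have pXs i k : polybnd 1 (fun w => X i w * expQ s l w * sin (k.+1%:R^-1 * X v w)).
  by have := polybndM (polybndM (polybnd_X i) pE) (polybnd_sinf (mXk k)).
have cvX i : \int[P]_w (X i w * expQ s l w * (k.+1%:R * sin (k.+1%:R^-1 * X v w))) @[k --> \oo]
    --> \int[P]_w (X i w * X v w * expQ s l w).
  have [] // := @dominated_Rintegral _ _ _ P
    (fun k w => X i w * expQ s l w * (k.+1%:R * sin (k.+1%:R^-1 * X v w)))
    (fun w => X i w * X v w * expQ s l w) (fun w => `|X i w * X v w|).
  - move=> k; apply: measurable_funM; first exact: measurable_funM.
    by apply: measurable_funM => //; exact: measurable_sinf.
  - by apply: measurable_funM => //; exact: measurable_funM.
  - move=> w; rewrite -mulrA (mulrC (X v w)) mulrA.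
    by apply: cvgM; [exact: cvg_cst|exact: cvg_sin_scale].
  - by apply: integ_norm; exact: integ_XX.
  - move=> k w; rewrite !normrM -mulrA ler_wpM2l// normr_nat.
    rewrite -[leRHS]mul1r ler_pM// ?mulr_ge0//.
    rewrite (le_trans (ler_wpM2l _ (normr_sin_le _)))// normrM ger0_norm//.
    by rewrite mulrA divff ?mul1r// pnatr_eq0.
have cvC : \int[P]_w (expQ s l w * cos (k.+1%:R^-1 * X v w)) @[k --> \oo]
    --> \int[P]_w expQ s l w.
  have [] // := @dominated_Rintegral _ _ _ P
    (fun k w => expQ s l w * cos (k.+1%:R^-1 * X v w)) (expQ s l) (fun w => `|expQ s l w|).
  - by move=> k; apply: measurable_funM => //; exact: measurable_cosf.
  - move=> w; rewrite -[X in _ --> X]mulr1.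
    by apply: cvgM; [exact: cvg_cst|exact: cvg_cos_scale].
  - exact: integ_norm.
  - by move=> k w; rewrite normrM ler_piMr// normr_cos_le1.
have key k : \int[P]_w (X u w * expQ s l w * (k.+1%:R * sin (k.+1%:R^-1 * X v w))) =
    S u v * \int[P]_w (expQ s l w * cos (k.+1%:R^-1 * X v w))
    - 2 * s * \sum_(i <- l) S u i * \int[P]_w (X i w * expQ s l w * (k.+1%:R * sin (k.+1%:R^-1 * X v w))).
  have k0 : k.+1%:R != 0 :> R by rewrite pnatr_eq0.
  have eqi i : \int[P]_w (X i w * expQ s l w * (k.+1%:R * sin (k.+1%:R^-1 * X v w))) =
      k.+1%:R * \int[P]_w (X i w * expQ s l w * sin (k.+1%:R^-1 * X v w)).
    rewrite -RintegralZl//; last exact: polybnd_integ (pXs i k).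
    by apply: eq_Rintegral => w _; rewrite mulrCA.
  rewrite eqi.
  under [X in _ = _ - _ * X]eq_bigr do rewrite eqi mulrCA.
  rewrite -mulr_sumr.
  have := ibp_sin_expQ u (fun j => k.+1%:R^-1 * (j == v)%:R) l s0.
  have lE w : linc (fun j => k.+1%:R^-1 * (j == v)%:R) w = k.+1%:R^-1 * X v w.
    rewrite /linc (bigD1 v)//= eqxx mulr1 big1 ?addr0// => j jv.
    by rewrite (negbTE jv) mulr0 mul0r.
  rewrite (_ : \sum_j _ = k.+1%:R^-1 * S u v); last first.
    rewrite (bigD1 v)//= eqxx mulr1 big1 ?addr0// => j jv.
    by rewrite (negbTE jv) mulr0 mul0r.
  under eq_Rintegral do rewrite lE.
  under [X in _ = _ * X - _ -> _]eq_Rintegral do rewrite lE.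
  under [X in _ = _ - _ * X -> _]eq_bigr do under eq_Rintegral do rewrite lE.
  by move=> ->; field.
have cvR : (S u v * \int[P]_w (expQ s l w * cos (k.+1%:R^-1 * X v w))
    - 2 * s * \sum_(i <- l) S u i *
      \int[P]_w (X i w * expQ s l w * (k.+1%:R * sin (k.+1%:R^-1 * X v w)))) @[k --> \oo] -->
  S u v * \int[P]_w expQ s l w
  - 2 * s * \sum_(i <- l) S u i * \int[P]_w (X i w * X v w * expQ s l w).
  apply: cvgB; first by apply: cvgM; [exact: cvg_cst|exact: cvC].
  apply: cvgM; first exact: cvg_cst.
  apply: cvg_big => [|i _]; first exact: add_continuous.
  by apply: cvgM; [exact: cvg_cst|exact: cvX].
have := cvX u; rewrite (funext key) => cvX'.
exact: (cvg_unique _ cvX' cvR).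
Qed.

(** * Integration by parts for functions of the squared norm *)

Let Q w := \sum_i X i w ^+ 2.
Let mu := \sum_i S i i.
Let Gam w := 2 * \sum_u \sum_i S u i * (X u w * X i w).

Lemma polybnd_Q : polybnd 2 Q.
Proof. by apply: polybnd_sum => i; have := polybndM (polybnd_X i) (polybnd_X i). Qed.

Lemma polybnd_Gam : polybnd 2 Gam.
Proof.
apply: polybndZ; apply: polybnd_sum => u; apply: polybnd_sum => i; apply: polybndZ.
exact: polybndM (polybnd_X u) (polybnd_X i).
Qed.

Lemma polybndB k f g : polybnd k f -> polybnd k g -> polybnd k (fun w => f w - g w).
Proof.
move=> pf pg; have := polybndD pf (polybndZ (-1) pg).
by congr (polybnd _); apply/funext => w; rewrite mulN1r.
Qed.

Lemma polybnd_Qmu : polybnd 2 (fun w => Q w - mu).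
Proof. by apply: polybndB; [exact: polybnd_Q|apply: polybndW (polybnd_cst mu)]. Qed.

Lemma polybnd_exp s : 0 <= s -> polybnd 0 (fun w => expR (- (s * Q w))).
Proof. by move=> s0; exact: polybnd_expQ. Qed.

(** The diagonal case u = v of [ibp_X_expQ], with the full index list, summed over u. *)
Lemma ibp_laplace s : 0 <= s ->
  \int[P]_w ((Q w - mu) * expR (- (s * Q w))) =
  - s * \int[P]_w (Gam w * expR (- (s * Q w))).
Proof.
move=> s0; have pE := polybnd_exp s0; set E := fun w => expR (- (s * Q w)) in pE *.
have iE : integ P E by exact: (polybnd_integ _ pE).
have iXXE u v : integ P (fun w => X u w * X v w * E w).
  by apply: (@polybnd_integ 2) => //; exact: polybndM (polybndM (polybnd_X u) (polybnd_X v)) pE.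
have eQ : \int[P]_w (Q w * E w) = \sum_u \int[P]_w (X u w * X u w * E w).
  rewrite -Rint_sum; last by move=> u; exact: iXXE.
  by apply: eq_Rintegral => w _; rewrite /Q mulr_suml; apply: eq_bigr => i _; rewrite expr2.
have eG : \int[P]_w (Gam w * E w) = 2 * \sum_u \sum_i S u i * \int[P]_w (X i w * X u w * E w).
  transitivity (\int[P]_w (\sum_u \sum_i 2 * S u i * (X i w * X u w * E w))).
    apply: eq_Rintegral => w _; rewrite /Gam mulr_sumr mulr_suml; apply: eq_bigr => u _.
    rewrite mulr_sumr mulr_suml; apply: eq_bigr => i _.
    by rewrite (mulrC (X u w)); ring.
  rewrite Rint_sum; last by move=> u; apply: integ_sum => i; apply: integZ; exact: iXXE.
  rewrite mulr_sumr; apply: eq_bigr => u _.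
  rewrite Rint_sum; last by move=> i; apply: integZ; exact: iXXE.
  rewrite mulr_sumr; apply: eq_bigr => i _.
  by rewrite RintegralZl ?mulrA//; exact: iXXE.
under eq_Rintegral do rewrite mulrBl.
rewrite RintegralB//; last 2 first.
- by apply: (@polybnd_integ 2) => //; have := polybndM polybnd_Q pE.
- exact: integZ.
rewrite RintegralZl// eQ eG.
under eq_bigr do rewrite (@ibp_X_expQ s)//.
rewrite big_split/= -mulr_suml sumrN -mulr_sumr.
rewrite /E /mu /Q /expQ; ring.
Qed.

(** The monomial y^k at y = exp(-sQ) is exp(-(ks)Q), so this is the Laplace case by linearity; the
    factor k produced there assembles y G'(y). *)
Lemma ibp_poly s (G : {poly R}) : 0 <= s ->
  \int[P]_w ((Q w - mu) * G.[expR (- (s * Q w))]) =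
  - s * \int[P]_w (Gam w * (G^`().[expR (- (s * Q w))] * expR (- (s * Q w)))).
Proof.
move=> s0.
have e (k : nat) w : expR (- (s * Q w)) ^+ k = expR (- (k%:R * s * Q w)).
  by rewrite -expRM_natl; congr expR; ring.
have ks k : 0 <= k%:R * s by rewrite mulr_ge0.
have iF k : integ P (fun w => (Q w - mu) * expR (- (k%:R * s * Q w))).
  by apply: (@polybnd_integ 2) => //; have := polybndM polybnd_Qmu (polybnd_exp (ks k)).
have iG k : integ P (fun w => Gam w * expR (- (k%:R * s * Q w))).
  by apply: (@polybnd_integ 2) => //; have := polybndM polybnd_Gam (polybnd_exp (ks k)).
transitivity (\sum_(k < size G) G`_k * \int[P]_w ((Q w - mu) * expR (- (k%:R * s * Q w)))).
  transitivity (\sum_(k < size G) \int[P]_w (G`_k * ((Q w - mu) * expR (- (k%:R * s * Q w))))); last first.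
    by apply: eq_bigr => k _; rewrite RintegralZl//; exact: iF.
  rewrite -Rint_sum; last by move=> k; exact: integZ.
  apply: eq_Rintegral => w _; rewrite horner_coef mulr_sumr; apply: eq_bigr => k _.
  by rewrite e mulrCA.
transitivity (\sum_(k < size G) (- s * G`_k * k%:R) * \int[P]_w (Gam w * expR (- (k%:R * s * Q w)))).
  by apply: eq_bigr => k _; rewrite ibp_laplace//; ring.
transitivity (\sum_(k < size G) \int[P]_w (- s * G`_k * k%:R * (Gam w * expR (- (k%:R * s * Q w))))).
  by apply: eq_bigr => k _; rewrite RintegralZl//; exact: iG.
rewrite -Rint_sum; last by move=> k; exact: integZ.
have dE y : G^`().[y] * y = \sum_(k < size G) G`_k * k%:R * y ^+ k.
  rewrite (_ : G^`().[y] * y = (G^`() * 'X).[y]); last by rewrite hornerM hornerX.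
  rewrite (@horner_coef_wide _ (size G)); last first.
    have [->|G0] := eqVneq G 0; first by rewrite deriv0 mul0r size_poly0.
    have [d0|d0] := eqVneq G^`() 0; first by rewrite d0 mul0r size_poly0.
    by rewrite size_mulX// lt_size_deriv.
  apply: eq_bigr => k _; rewrite coefMX; case: eqP => [->|/eqP k0]; first by rewrite mulr0.
  by rewrite coef_deriv prednK ?lt0n// mulr_natr.
have mD (p : {poly R}) : measurable_fun setT (fun w => p.[expR (- (s * Q w))]).
  apply: measurableT_comp; last by have [] := polybnd_exp s0.
  by apply: continuous_measurable_fun => x; exact: continuous_horner.
have sumE w : Gam w * (G^`().[expR (- (s * Q w))] * expR (- (s * Q w))) =
    \sum_(k < size G) G`_k * k%:R * (Gam w * expR (- (k%:R * s * Q w))).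
  under eq_bigr do rewrite -e.
  set y := expR _; set g := Gam w; rewrite dE mulr_sumr; apply: eq_bigr => k _.
  by rewrite mulrCA.
rewrite -RintegralZl//.
  apply: eq_Rintegral => w _; rewrite sumE.
  set F := fun k => expR (- (k%:R * s * Q w)); set g := Gam w.
  rewrite mulr_sumr; apply: eq_bigr => k _.
  by rewrite -!mulrA.
rewrite (_ : _ \o _ = EFin \o (fun w => \sum_(k < size G) G`_k * k%:R * (Gam w * expR (- (k%:R * s * Q w))))).
  by apply: integ_sum => k; exact: integZ.
by apply/funext => w /=; rewrite sumE.
Qed.

Lemma Q_ge0 w : 0 <= Q w.
Proof. by apply: sumr_ge0 => i _; exact: sqr_ge0. Qed.

Lemma measurable_contQ (g : R -> R) : continuous g -> measurable_fun setT (fun w => g (Q w)).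
Proof.
move=> cg; apply: measurableT_comp; last by have [] := polybnd_Q.
exact: continuous_measurable_fun.
Qed.

Lemma polybnd_contQ (g : R -> R) A : continuous g -> (forall x, `|g x| <= A) ->
  polybnd 0 (fun w => g (Q w)).
Proof. by move=> cg gA; apply: (@polybnd_bounded _ A) => //; exact: measurable_contQ. Qed.

Lemma is_derive_expN (s x : R) : is_derive x 1 (fun x => expR (- (s * x))) (- s * expR (- (s * x))).
Proof.
have h : is_derive x 1 (fun y : R => - (s * y)) (- s).
  by apply: is_derive_eq; rewrite /GRing.scale/=; ring.
have h2 := @is_derive1_comp _ expR (fun y => - (s * y)) x _ _ (is_derive_expR _) h.
by apply: is_derive_eq; rewrite mulrC.
Qed.

Lemma continuous_expN (s : R) : continuous (fun x : R => expR (- (s * x))).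
Proof.
by move=> x; apply/differentiable_continuous/derivable1_diffP; have [] := is_derive_expN s x.
Qed.

(* A C^1 function of Q damped by e^{-2sQ} is approximated, together with its derivative, by a
   polynomial in e^{-sQ}; the damping makes the function to approximate continuous at e^{-sQ} = 0. *)
Lemma ibp_damped (g dg : R -> R) (A B s : R) : 0 < s ->
  (forall x : R, is_derive x 1 g (dg x)) -> continuous dg ->
  (forall x, `|g x| <= A) -> (forall x, `|dg x| <= B) ->
  \int[P]_w ((Q w - mu) * (g (Q w) * expR (- (2 * s * Q w)))) =
  \int[P]_w (Gam w * ((dg (Q w) - 2 * s * g (Q w)) * expR (- (2 * s * Q w)))).
Proof.
move=> s0 dgE cdg gA dgB.
have cg : continuous g.
  by move=> y; apply/differentiable_continuous/derivable1_diffP; have [] := dgE y.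
pose b q := dg q - 2 * s * g q.
have cb : continuous b.
  by move=> x; apply: cvgB; [exact: cdg|apply: cvgM; [exact: cvg_cst|exact: cg]].
pose D := B + 2 * s * A.
have A0 : 0 <= A by exact: le_trans (gA 0).
have bD x : `|b x| <= D.
  rewrite /b /D (le_trans (ler_normB _ _))// lerD// normrM (@ger0_norm _ (2 * s)); last by rewrite mulr_ge0// ltW.
  by rewrite ler_pM2l// mulr_gt0.
have D0 : 0 <= D by exact: le_trans (bD 0).
(* In the variable y = exp(-sq) the derivative of the damped function is b y^2 = k(y) s y: one
   factor y belongs to dy/dq, the other stays in k and forces k to 0 at y = 0, where b, although
   bounded, may oscillate. For y <= 0 the convention ln y = 0 makes k linear, so k is continuous on
   the whole line. *)
pose k (y : R) := y * b (- ln y / s) / s.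
have ck : continuous k.
  move=> y; have [y0|y0|->] := ltgtP y 0.
  - have cv : (y' * b 0 / s) @[y' --> y] --> y * b 0 / s.
      by apply: cvgM; [apply: cvgM; [exact: cvg_id|exact: cvg_cst]|exact: cvg_cst].
    have -> : continuous_at y k = (k y' @[y' --> y] --> y * b 0 / s).
      by rewrite /continuous_at {2}/k ln0 ?ltW// oppr0 mul0r.
    apply: cvg_trans cv; apply: near_eq_cvg; near=> y'.
    by rewrite /k ln0 ?oppr0 ?mul0r//; apply/ltW; near: y'; exact: lt_nbhsl.
  - rewrite /continuous_at /k; apply: cvgM; last exact: cvg_cst.
    apply: cvgM; first exact: cvg_id.
    apply: (@continuous_comp _ _ _ (fun y => - ln y / s) b); last exact: cb.
    by apply: cvgM; [apply: cvgN; exact: continuous_ln|exact: cvg_cst].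
  - rewrite /continuous_at /k mul0r mul0r; apply: norm_cvg0.
    apply: (@squeeze_cvgr _ _ _ _ (cst 0) (fun y' => `|y'| * (D / s))).
    + near=> y'; rewrite normr_ge0/= -mulrA normrM ler_wpM2l//.
      by rewrite normrM normfV (gtr0_norm s0) ler_pM2r ?invr_gt0.
    + exact: cvg_cst.
    + rewrite -[X in _ --> X](mul0r (D / s)); apply: cvgM; last exact: cvg_cst.
      by rewrite -[X in _ --> X](@normr0 _ R); exact: norm_continuous.
pose gs q := g q * expR (- (2 * s * q)).
have dgs (q : R) : is_derive q 1 gs (b q * expR (- (2 * s * q))).
  have d1 := dgE q; have d2 := is_derive_expN (2 * s) q.
  by apply: is_derive_eq; rewrite /GRing.scale/= /b; ring.
have E2 q : expR (- (2 * s * q)) = expR (- (s * q)) ^+ 2.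
  by rewrite expr2 -expRD; congr expR; ring.
have kE q : k (expR (- (s * q))) * (s * expR (- (s * q))) = b q * expR (- (2 * s * q)).
  rewrite /k expRK opprK E2 (_ : s * q / s = q); last by field; rewrite gt_eqF.
  by field; rewrite gt_eqF.
have cex : continuous (fun q : R => expR (- (s * q))) by exact: continuous_expN.
have E1 q : 0 <= q -> 0 <= expR (- (s * q)) <= 1.
  by move=> q0; rewrite expR_ge0/= -[leRHS]expR0 ler_expR oppr_le0 mulr_ge0// ltW.
have pg : polybnd 0 (fun w => gs (Q w)).
  have := polybndM (polybnd_contQ cg gA) (polybnd_exp (s := 2 * s) _).
  by apply; rewrite mulr_ge0// ltW.
have pb : polybnd 0 (fun w => b (Q w) * expR (- (2 * s * Q w))).
  have := polybndM (polybnd_contQ cb bD) (polybnd_exp (s := 2 * s) _).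
  by apply; rewrite mulr_ge0// ltW.
set LHS := LHS; set RHS := RHS.
(* The two expectations on the right are fixed, so an arbitrary accuracy e of the polynomial
   approximation is enough. *)
suff H (e : R) : 0 < e -> `|LHS - RHS| <= e * (\int[P]_w `|Q w - mu| + s * \int[P]_w `|Gam w|).
  set C := (\int[P]_w `|Q w - mu| + s * _) in H.
  have C0 : 0 <= C.
    have n1 : 0 <= \int[P]_w `|Q w - mu| by apply: Rintegral_ge0 => w _; exact: normr_ge0.
    have n2 : 0 <= \int[P]_w `|Gam w| by apply: Rintegral_ge0 => w _; exact: normr_ge0.
    by rewrite /C addr_ge0// mulr_ge0// ltW.
  apply/eqP; rewrite -subr_eq0 -normr_le0; apply/ler_addgt0Pr => e e0; rewrite add0r.
  have e1 : 0 < e / (C + 1) by rewrite divr_gt0// ltr_wpDl.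
  rewrite (le_trans (H _ e1))// mulrAC ler_pdivrMr ?ltr_wpDl// ler_pM2l// lerDl.
  exact: ler01.
move=> e0.
have [p pk] := weierstrass ck e0.
(* The sign accounts for y = exp(-sq) decreasing in q; the constant makes [gp] and [gs] agree at q =
   0, that is at y = 1. *)
pose G := (gs 0 + (poly_prim p).[1])%:P - poly_prim p.
have dGp : G^`() = - p by rewrite derivB derivC sub0r deriv_poly_prim.
pose gp q := G.[expR (- (s * q))].
have dgp (q : R) : is_derive q 1 gp (p.[expR (- (s * q))] * (s * expR (- (s * q)))).
  have d1 := is_derive_expN s q.
  have d2 : is_derive (expR (- (s * q))) 1 (horner G) (- p.[expR (- (s * q))]).
    by rewrite -hornerN -dGp; exact: is_derive_poly.
  have := @is_derive1_comp _ (horner G) (fun q => expR (- (s * q))) q _ _ d2 d1.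
  by move=> d3; apply: is_derive_eq; ring.
have dclose q : 0 <= q ->
    `|p.[expR (- (s * q))] * (s * expR (- (s * q))) - b q * expR (- (2 * s * q))|
    <= e * (s * expR (- (s * q))).
  move=> q0; rewrite -kE -mulrBl normrM (@ger0_norm _ (s * _)); last first.
    by rewrite mulr_ge0 ?expR_ge0// ltW.
  by rewrite ler_wpM2r ?pk ?E1// mulr_ge0 ?expR_ge0// ltW.
have gp0 : gp 0 = gs 0.
  by rewrite /gp mulr0 oppr0 expR0 /G hornerD hornerN hornerC addrK.
have key q : 0 <= q -> `|gp q - gs q| <= e.
  move=> q0.
  (* The derivative error e s exp(-sq) is itself the derivative of e (1 - exp(-sq)), which never
     exceeds e: closeness of the derivatives integrates to closeness of the functions uniformly over
     the unbounded half-line. The sign t yields both inequalities. *)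
  have hs (t : R) : t = 1 \/ t = -1 -> t * (gp q - gs q) <= e * (1 - expR (- (s * q))).
    move=> ht; pose psi q := e * (1 - expR (- (s * q))) - t * (gp q - gs q).
    pose dpsi q := e * (s * expR (- (s * q))) -
      t * (p.[expR (- (s * q))] * (s * expR (- (s * q))) - b q * expR (- (2 * s * q))).
    have dpsiE (q' : R) : is_derive q' 1 psi (dpsi q').
      have d1 := dgp q'; have d2 := dgs q'; have d3 := is_derive_expN s q'.
      by apply: is_derive_eq; rewrite /GRing.scale/= /dpsi; ring.
    have [c] := @MVT_all R psi dpsi 0 q dpsiE; rewrite subr0 min_l// max_r// => /andP[c0 _] eq.
    have : 0 <= psi q - psi 0.
      rewrite eq mulr_ge0// /dpsi subr_ge0.
      apply: le_trans (dclose _ c0); apply: le_trans (ler_norm _) _.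
      by case: ht => ->; rewrite ?mul1r// mulN1r normrN.
    have psi0 : psi 0 = 0.
      by rewrite /psi gp0 mulr0 oppr0 expR0; ring.
    by rewrite psi0 subr0 /psi subr_ge0.
  have le1 : e * (1 - expR (- (s * q))) <= e.
    by rewrite ler_piMr ?(ltW e0)// lerBlDr lerDl expR_ge0.
  rewrite ler_norml; apply/andP; split.
    by rewrite lerNl -mulN1r; apply: le_trans le1; apply: hs; right.
  by rewrite -(mul1r (gp q - gs q)); apply: le_trans le1; apply: hs; left.
have cgp : continuous gp.
  by move=> x; apply/differentiable_continuous/derivable1_diffP; have [] := dgp x.
have cgs : continuous gs.
  by move=> x; apply/differentiable_continuous/derivable1_diffP; have [] := dgs x.
have iQ : integ P (fun w => Q w - mu) := @polybnd_integ 2 _ isT polybnd_Qmu.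
have pgp : polybnd 0 (fun w => gp (Q w)).
  have [_ [Cg _ hg]] := pg.
  apply: (@polybnd_bounded _ (e + Cg)); first exact: measurable_contQ.
  move=> w; rewrite -(subrK (gs (Q w)) (gp (Q w))) (le_trans (ler_normD _ _))// lerD ?key ?Q_ge0//.
  by have := hg w; rewrite expr0 mulr1.
pose db q := b q * expR (- (2 * s * q)).
pose dp q := p.[expR (- (s * q))] * (s * expR (- (s * q))).
have cdp : continuous dp.
  move=> x; apply: cvgM; last by apply: cvgM; [exact: cvg_cst|exact: cex].
  apply: (@continuous_comp _ _ _ (fun x => expR (- (s * x))) (horner p)); first exact: cex.
  exact: continuous_horner.
have pdp : polybnd 0 (fun w => dp (Q w)).
  have [_ [Cb _ hb]] := pb.
  apply: (@polybnd_bounded _ (e * s + Cb)); first exact: measurable_contQ.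
  move=> w; rewrite -(subrK (db (Q w)) (dp (Q w))) (le_trans (ler_normD _ _))// lerD//.
    rewrite (le_trans (dclose _ (Q_ge0 w)))// ler_pM2l// ler_piMr ?(ltW s0)//.
    by have /andP[] := E1 _ (Q_ge0 w).
  by have := hb w; rewrite expr0 mulr1.
have i1 : integ P (fun w => (Q w - mu) * gs (Q w)).
  by apply: (@polybnd_integ 2) => //; have := polybndM polybnd_Qmu pg.
have i2 : integ P (fun w => (Q w - mu) * gp (Q w)).
  by apply: (@polybnd_integ 2) => //; have := polybndM polybnd_Qmu pgp.
have i3 : integ P (fun w => Gam w * db (Q w)).
  by apply: (@polybnd_integ 2) => //; have := polybndM polybnd_Gam pb.
have i4 : integ P (fun w => Gam w * dp (Q w)).
  by apply: (@polybnd_integ 2) => //; have := polybndM polybnd_Gam pdp.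
have iGam : integ P Gam := @polybnd_integ 2 _ isT polybnd_Gam.
have ibp : \int[P]_w ((Q w - mu) * gp (Q w)) = \int[P]_w (Gam w * dp (Q w)).
  rewrite /gp ibp_poly ?(ltW s0)// dGp -RintegralZl//.
    by apply: eq_Rintegral => w _; rewrite hornerN /dp; ring.
  have := integZ (- s^-1) i4; congr (integ P _); apply/funext => w.
  by rewrite hornerN /dp; field; rewrite gt_eqF.
have -> : LHS - RHS = \int[P]_w ((Q w - mu) * (gs (Q w) - gp (Q w))) - \int[P]_w (Gam w * (db (Q w) - dp (Q w))).
  under eq_Rintegral do rewrite mulrBr.
  under [X in _ = _ - X]eq_Rintegral do rewrite mulrBr.
  by rewrite !RintegralB// ibp /LHS /RHS; ring.
have j1 : integ P (fun w => (Q w - mu) * (gs (Q w) - gp (Q w))).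
  by have := integB i1 i2; congr (integ P _); apply/funext => w; rewrite mulrBr.
have j2 : integ P (fun w => Gam w * (db (Q w) - dp (Q w))).
  by have := integB i3 i4; congr (integ P _); apply/funext => w; rewrite mulrBr.
rewrite (le_trans (ler_normB _ _))// mulrDr lerD//.
  rewrite (le_trans (le_normr_Rintegral _ _))// -RintegralZl//; last exact: integ_norm.
  apply: le_Rintegral => //; [exact: integ_norm|by apply: integZ; exact: integ_norm|].
  by move=> w _; rewrite normrM mulrC ler_wpM2r// distrC key// Q_ge0.
rewrite (le_trans (le_normr_Rintegral _ _))// mulrA -RintegralZl//; last exact: integ_norm.
apply: le_Rintegral => //; [exact: integ_norm|by apply: integZ; exact: integ_norm|].
move=> w _; rewrite normrM mulrC ler_wpM2r// distrC (le_trans (dclose _ (Q_ge0 w)))//.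
by rewrite ler_pM2l// ler_piMr ?(ltW s0)//; have /andP[] := E1 _ (Q_ge0 w).
Unshelve. all: by end_near.
Qed.

(** The damping is removed by dominated convergence along 2s = 1/(k+1); the extra term 2 s g of the
    damped formula disappears in the limit. *)
Lemma ibp_C1 (g dg : R -> R) (A B : R) :
  (forall x : R, is_derive x 1 g (dg x)) -> continuous dg ->
  (forall x, `|g x| <= A) -> (forall x, `|dg x| <= B) ->
  \int[P]_w ((Q w - mu) * g (Q w)) = \int[P]_w (Gam w * dg (Q w)).
Proof.
move=> dgE cdg gA dgB.
have cg : continuous g.
  by move=> y; apply/differentiable_continuous/derivable1_diffP; have [] := dgE y.
have A0 : 0 <= A by exact: le_trans (gA 0).
have B0 : 0 <= B by exact: le_trans (dgB 0).
have mQ : measurable_fun setT Q by have [] := polybnd_Q.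
have mQm : measurable_fun setT (fun w => Q w - mu) by have [] := polybnd_Qmu.
have mG : measurable_fun setT Gam by have [] := polybnd_Gam.
have mg := measurable_contQ cg; have mdg := measurable_contQ cdg.
have mE k : measurable_fun setT (fun w => expR (- (harmonic k * Q w))).
  by apply: (measurable_contQ (g := fun x => expR (- (harmonic k * x)))); exact: continuous_expN.
have hE k : 2 * (harmonic k / 2) = harmonic k :> R by rewrite mulrC divfK.
have E1 k w : `|expR (- (harmonic k * Q w))| <= 1.
  by rewrite ger0_norm ?expR_ge0// -[leRHS]expR0 ler_expR oppr_le0 mulr_ge0 ?harmonic_ge0 ?Q_ge0.
have cE w : expR (- (harmonic k * Q w)) @[k --> \oo] --> (1 : R).
  rewrite -expR0; apply: continuous_cvg; first exact: continuous_expR.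
  rewrite -oppr0; apply: cvgN; rewrite -(mul0r (Q w)).
  by apply: cvgM; [exact: cvg_harmonic|exact: cvg_cst].
have key k : \int[P]_w ((Q w - mu) * (g (Q w) * expR (- (harmonic k * Q w)))) =
  \int[P]_w (Gam w * ((dg (Q w) - harmonic k * g (Q w)) * expR (- (harmonic k * Q w)))).
  have h0 : 0 < harmonic k / 2 :> R by rewrite divr_gt0// harmonic_gt0.
  by have := ibp_damped h0 dgE cdg gA dgB; rewrite hE.
have c1 : \int[P]_w ((Q w - mu) * (g (Q w) * expR (- (harmonic k * Q w)))) @[k --> \oo]
    --> \int[P]_w ((Q w - mu) * g (Q w)).
  have [] // := @dominated_Rintegral _ _ _ P
    (fun k w => (Q w - mu) * (g (Q w) * expR (- (harmonic k * Q w))))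
    (fun w => (Q w - mu) * g (Q w)) (fun w => A * `|Q w - mu|).
  - by move=> k; apply: measurable_funM => //; exact: measurable_funM.
  - exact: measurable_funM.
  - move=> w; apply: cvgM; first exact: cvg_cst.
    by rewrite -[X in _ --> X]mulr1; apply: cvgM; [exact: cvg_cst|exact: cE].
  - by apply: integZ; apply: integ_norm; exact: (@polybnd_integ 2 _ isT polybnd_Qmu).
  - move=> k w; rewrite normrM mulrC ler_wpM2r// normrM.
    by rewrite -[leRHS]mulr1 ler_pM.
have c2 : \int[P]_w (Gam w * ((dg (Q w) - harmonic k * g (Q w)) * expR (- (harmonic k * Q w)))) @[k --> \oo]
    --> \int[P]_w (Gam w * dg (Q w)).
  have [] // := @dominated_Rintegral _ _ _ P
    (fun k w => Gam w * ((dg (Q w) - harmonic k * g (Q w)) * expR (- (harmonic k * Q w))))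
    (fun w => Gam w * dg (Q w)) (fun w => (B + A) * `|Gam w|).
  - move=> k; apply: measurable_funM => //; apply: measurable_funM => //.
    by apply: measurable_funB => //; exact: measurable_funM.
  - exact: measurable_funM.
  - move=> w; apply: cvgM; first exact: cvg_cst.
    rewrite -[X in _ --> X]mulr1; apply: cvgM; last exact: cE.
    rewrite -[X in _ --> X]subr0; apply: cvgB; first exact: cvg_cst.
    by rewrite -(mul0r (g (Q w))); apply: cvgM; [exact: cvg_harmonic|exact: cvg_cst].
  - by apply: integZ; apply: integ_norm; exact: (@polybnd_integ 2 _ isT polybnd_Gam).
  - move=> k w; rewrite normrM mulrC ler_wpM2r// normrM.
    rewrite -[leRHS]mulr1 ler_pM// (le_trans (ler_normB _ _))// lerD//.
    rewrite normrM -[leRHS]mul1r ler_pM// ger0_norm ?invr_ge0//.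
    by rewrite /harmonic/= invf_le1 ?ltr0n// ler1n.
rewrite (funext key) in c1.
exact: (cvg_unique _ c1 c2).
Qed.

(** Polarisation of the fourth moment: the sum over eight sign choices of the product of signs times
    (X_p + e1 X_q + e2 X_r + e3 X_t)^4 leaves only the mixed monomial, with coefficient 8 * 4! =
    192. Each fourth power has expectation 3 Var^2, so coinciding indices need no special care. *)
Lemma isserlis p q r t : \int[P]_w (X p w * X q w * X r w * X t w) =
  S p q * S r t + S p r * S q t + S p t * S q r.
Proof.
pose dl (i j : 'I_n) : R := (j == i)%:R.
pose a (e : R * R * R) j : R := dl p j + e.1.1 * dl q j + e.1.2 * dl r j + e.2 * dl t j.
have sumdl (F : 'I_n -> R) i : \sum_j dl i j * F j = F i.
  by rewrite (bigD1 i)//= /dl eqxx mul1r big1 ?addr0// => j /negbTE ->; rewrite mul0r.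
have lE e w : linc (a e) w = X p w + e.1.1 * X q w + e.1.2 * X r w + e.2 * X t w.
  rewrite /linc /a; under eq_bigr do rewrite !mulrDl -!mulrA.
  by rewrite !big_split/= -!mulr_sumr !sumdl.
have SC i j : S i j = S j i by apply: eq_Rintegral => w _; rewrite mulrC.
have vE e : \int[P]_w (linc (a e) w ^+ 2) =
    S p p + e.1.1 ^+ 2 * S q q + e.1.2 ^+ 2 * S r r + e.2 ^+ 2 * S t t
    + 2 * (e.1.1 * S p q + e.1.2 * S p r + e.2 * S p t
    + e.1.1 * e.1.2 * S q r + e.1.1 * e.2 * S q t + e.1.2 * e.2 * S r t).
  under eq_Rintegral do rewrite expr2.
  rewrite E_linc_linc.
  have inner i : \sum_j a e i * a e j * S i j =
     a e i * (S i p + e.1.1 * S i q + e.1.2 * S i r + e.2 * S i t).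
    under eq_bigr do rewrite -mulrA; rewrite -mulr_sumr; congr (_ * _).
    rewrite /a; under eq_bigr do rewrite !mulrDl -!mulrA.
    by rewrite !big_split/= -!mulr_sumr !sumdl.
  under eq_bigr do rewrite inner.
  rewrite {1}/a; under eq_bigr do rewrite !mulrDl -!mulrA.
  rewrite !big_split/= -!mulr_sumr !sumdl.
  rewrite (SC q p) (SC r p) (SC t p) (SC r q) (SC t q) (SC t r); ring.
have i4 e : integ P (fun w => linc (a e) w ^+ 4) by have [] := linc_facts (a e).
have m4 e : \int[P]_w (linc (a e) w ^+ 4) = 3 * (\int[P]_w (linc (a e) w ^+ 2)) ^+ 2.
  by have [] := linc_facts (a e).
pose l : seq (R * R * R) := [:: (1,1,1); (1,1,-1); (1,-1,1); (1,-1,-1); (-1,1,1); (-1,1,-1); (-1,-1,1); (-1,-1,-1)].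
transitivity (\int[P]_w (192^-1 * \sum_(e <- l) (e.1.1 * e.1.2 * e.2 * linc (a e) w ^+ 4))).
  apply: eq_Rintegral => w _; by rewrite /l !big_cons big_nil !lE /=; field.
rewrite RintegralZl//; last by apply: integ_sum => e; exact: integZ.
rewrite Rint_sum; last by move=> e; exact: integZ.
under eq_bigr => e _ do rewrite (RintegralZl _ _ (i4 e))// m4 vE.
by rewrite /l !big_cons big_nil /=; field.
Qed.

Let v := \sum_i \sum_j 2 * S i j ^+ 2.
(** For symmetric S this squared Frobenius norm of S^2 is tr S^4. *)
Let kap := \sum_i \sum_j (\sum_k S i k * S k j) ^+ 2.

Lemma E_Gam : \int[P]_w Gam w = v.
Proof.
rewrite /Gam RintegralZl//; last first.
  by apply: integ_sum => u; apply: integ_sum => i; apply: integZ; exact: integ_XX.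
rewrite Rint_sum; last by move=> u; apply: integ_sum => i; apply: integZ; exact: integ_XX.
rewrite mulr_sumr; apply: eq_bigr => u _.
rewrite Rint_sum; last by move=> i; apply: integZ; exact: integ_XX.
rewrite mulr_sumr; apply: eq_bigr => i _.
by rewrite RintegralZl//; exact: integ_XX.
Qed.

Lemma polybnd_Gam2 : polybnd 4 (fun w => Gam w ^+ 2).
Proof. by have := polybndM polybnd_Gam polybnd_Gam. Qed.

(** Of the three pairings in Isserlis' formula, the one respecting the two factors [Gam] gives v^2;
    each of the two crossed ones gives 4 tr S^4. *)
Lemma E_Gam2 : \int[P]_w (Gam w ^+ 2) = v ^+ 2 + 8 * kap.
Proof.
have SC i j : S i j = S j i by apply: eq_Rintegral => w _; rewrite mulrC.
have iX4 u i p j : integ P (fun w => X u w * X i w * X p w * X j w).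
  apply: (@polybnd_integ 4) => //.
  by have := polybndM (polybndM (polybndM (polybnd_X u) (polybnd_X i)) (polybnd_X p)) (polybnd_X j).
have iF u i p j : integ P (fun w => 4 * S u i * S p j * (X u w * X i w * X p w * X j w)).
  exact: integZ.
transitivity (\sum_u \sum_i \sum_p \sum_j 4 * S u i * S p j * (S u i * S p j + S u p * S i j + S u j * S i p)).
  transitivity (\int[P]_w (\sum_u \sum_i \sum_p \sum_j
      4 * S u i * S p j * (X u w * X i w * X p w * X j w))).
    apply: eq_Rintegral => w _; rewrite /Gam exprMn [X in _ * X]expr2.
    rewrite mulr_suml mulr_sumr; apply: eq_bigr => u _.
    rewrite mulr_suml mulr_sumr; apply: eq_bigr => i _.
    rewrite mulr_sumr mulr_sumr; apply: eq_bigr => p _.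
    rewrite mulr_sumr mulr_sumr; apply: eq_bigr => j _.
    by ring.
  rewrite Rint_sum; last by move=> u; do 3![apply: integ_sum => ?]; exact: iF.
  apply: eq_bigr => u _; rewrite Rint_sum; last by move=> i; do 2![apply: integ_sum => ?]; exact: iF.
  apply: eq_bigr => i _; rewrite Rint_sum; last by move=> p; apply: integ_sum => ?; exact: iF.
  apply: eq_bigr => p _; rewrite Rint_sum; last by move=> j; exact: iF.
  apply: eq_bigr => j _; rewrite RintegralZl; [|by []|exact: iX4].
  by rewrite isserlis.
have kE : kap = \sum_u \sum_i \sum_p \sum_j S u i * S p j * (S u p * S i j).
  rewrite exchange_big/= /kap; apply: eq_bigr => i _.
  rewrite exchange_big/=; apply: eq_bigr => p _.
  rewrite expr2 mulr_suml; apply: eq_bigr => u _.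
  rewrite mulr_sumr; apply: eq_bigr => j _.
  by rewrite (SC i u) (SC j p); ring.
have kE2 : kap = \sum_u \sum_i \sum_p \sum_j S u i * S p j * (S u j * S i p).
  rewrite kE; apply: eq_bigr => u _; apply: eq_bigr => i _.
  rewrite exchange_big/=; apply: eq_bigr => j _; apply: eq_bigr => p _.
  by rewrite (SC p j).
have vE : v ^+ 2 = \sum_u \sum_i \sum_p \sum_j 4 * (S u i * S p j * (S u i * S p j)).
  rewrite expr2 /v mulr_suml; apply: eq_bigr => u _.
  rewrite mulr_suml; apply: eq_bigr => i _.
  rewrite mulr_sumr; apply: eq_bigr => p _.
  rewrite mulr_sumr; apply: eq_bigr => j _.
  by ring.
have -> : v ^+ 2 + 8 * kap = v ^+ 2 + (4 * kap + 4 * kap) by ring.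
rewrite {1}kE kE2 vE !mulr_sumr -!big_split; apply: eq_bigr => u _ /=.
rewrite !mulr_sumr -!big_split; apply: eq_bigr => i _ /=.
rewrite !mulr_sumr -!big_split; apply: eq_bigr => p _ /=.
rewrite !mulr_sumr -!big_split; apply: eq_bigr => j _ /=.
by ring.
Qed.

Hypothesis v0 : 0 < v.

(** Gam / v has mean 1 and variance 8 kap / v^2. The passage from the first to the second absolute
    moment is the nonnegativity of the variance of |1 - Gam / v|. *)
Lemma E_dev_Gam : \int[P]_w `|1 - Gam w / v| <= Num.sqrt (8 * kap) / v.
Proof.
have iG := @polybnd_integ 2 _ isT polybnd_Gam.
have iG2 := @polybnd_integ 4 _ isT polybnd_Gam2.
have i1 : integ P (fun=> 1) by exact: (@polybnd_integ 0 _ isT (polybnd_cst 1)).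
have pZ : polybnd 2 (fun w => 1 - Gam w / v).
  apply: polybndB; first by apply: polybndW (polybnd_cst 1).
  by have := polybndZ v^-1 polybnd_Gam; congr (polybnd _); apply/funext => w; rewrite mulrC.
have iZ := integ_norm (@polybnd_integ 2 _ isT pZ).
have iZ2 : integ P (fun w => (1 - Gam w / v) ^+ 2).
  by apply: (@polybnd_integ 4) => //; have := polybndM pZ pZ.
have kap0 : 0 <= kap by apply: sumr_ge0 => i _; apply: sumr_ge0 => j _; exact: sqr_ge0.
have P1 (c : R) : \int[P]_w c = c.
  exact: Rintegral_prob_cst.
have EZ2 : \int[P]_w ((1 - Gam w / v) ^+ 2) = 8 * kap / v ^+ 2.
  transitivity (\int[P]_w (1 - 2 / v * Gam w + v ^- 2 * Gam w ^+ 2)).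
    by apply: eq_Rintegral => w _; field; rewrite gt_eqF.
  rewrite RintegralD//; last 2 first.
  - by apply: integB => //; exact: integZ.
  - exact: integZ.
  rewrite RintegralB//; last exact: integZ.
  rewrite (RintegralZl _ measurableT iG) (RintegralZl _ measurableT iG2) E_Gam E_Gam2 P1; field; exact: lt0r_neq0.
set m := \int[P]_w _.
have m0 : 0 <= m by apply: Rintegral_ge0 => w _; exact: normr_ge0.
have : m ^+ 2 <= 8 * kap / v ^+ 2.
  rewrite -EZ2 -subr_ge0.
  suff -> : \int[P]_w ((1 - Gam w / v) ^+ 2) - m ^+ 2 = \int[P]_w ((`|1 - Gam w / v| - m) ^+ 2).
    by apply: Rintegral_ge0 => w _; exact: sqr_ge0.
  transitivity (\int[P]_w ((1 - Gam w / v) ^+ 2 - 2 * m * `|1 - Gam w / v| + m ^+ 2)); last first.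
    by apply: eq_Rintegral => w _; rewrite -(real_normK (num_real (1 - Gam w / v))); ring.
  rewrite RintegralD//; last 2 first.
  - by apply: integB => //; exact: integZ.
  - exact: (@polybnd_integ 0 _ isT (polybnd_cst _)).
  rewrite RintegralB//; last exact: integZ.
  by rewrite RintegralZl// P1 -/m; ring.
move=> h; rewrite -(ger0_norm m0) -sqrtr_sqr -(ger0_norm (ltW v0)) -[X in _ / X]sqrtr_sqr.
rewrite -sqrtrV ?sqr_ge0// -sqrtrM; last by rewrite mulr_ge0.
exact: ler_wsqrtr.
Qed.

Lemma berry_esseen_smooth (h : R -> R) : continuous h -> (forall x, 0 <= h x <= 1) ->
  `|\int[P]_w h ((Q w - mu) / Num.sqrt v) - \int[leb]_x (h x * normal_pdf 0 1 x)|
  <= 2 * (Num.sqrt (8 * kap) / v).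
Proof.
move=> ch h01.
have [f [df [dfE cdf [A fA] df2 eqf]]] := stein_solution ch h01.
set c := \int[leb]_x _.
have sv0 : 0 < Num.sqrt v by rewrite sqrtr_gt0.
pose W w := (Q w - mu) / Num.sqrt v.
pose g q := f ((q - mu) / Num.sqrt v).
pose dg q := df ((q - mu) / Num.sqrt v) / Num.sqrt v.
have dlin (q : R) : is_derive q 1 (fun q => (q - mu) / Num.sqrt v) (Num.sqrt v)^-1.
  by apply: is_derive_eq; rewrite /GRing.scale/=; ring.
have dgE (q : R) : is_derive q 1 g (dg q).
  have := @is_derive1_comp _ f (fun q => (q - mu) / Num.sqrt v) q _ _ (dfE _) (dlin q).
  by move=> d3; apply: is_derive_eq.
have clin : continuous (fun q => (q - mu) / Num.sqrt v).
  by move=> y; apply/differentiable_continuous/derivable1_diffP; have [] := dlin y.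
have cf : continuous f.
  by move=> y; apply/differentiable_continuous/derivable1_diffP; have [] := dfE y.
have cdfW : continuous (fun q => df ((q - mu) / Num.sqrt v)).
  by move=> q; apply: (@continuous_comp _ _ _ (fun q => (q - mu) / Num.sqrt v) df); [exact: clin|exact: cdf].
have cdg : continuous dg.
  by move=> q; apply: cvgM; [exact: cdfW|exact: cvg_cst].
have gA q : `|g q| <= A by exact: fA.
have dgB q : `|dg q| <= 2 / Num.sqrt v.
  by rewrite normrM normfV (gtr0_norm sv0) ler_wpM2r// invr_ge0 ltW.
have ibp := ibp_C1 dgE cdg gA dgB.
have pdf : polybnd 0 (fun w => df (W w)) by exact: polybnd_contQ cdfW (fun=> df2 _).
have cg : continuous g.
  by move=> y; apply/differentiable_continuous/derivable1_diffP; have [] := dgE y.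
have pf : polybnd 0 (fun w => f (W w)) by exact: polybnd_contQ cg (fun=> fA _).
have pW : polybnd 2 W.
  by have := polybndZ (Num.sqrt v)^-1 polybnd_Qmu; congr (polybnd _); apply/funext => w; rewrite /W mulrC.
have iWf : integ P (fun w => W w * f (W w)).
  by apply: (@polybnd_integ 2) => //; have := polybndM pW pf.
have idf := @polybnd_integ 0 _ isT pdf.
have iGdf : integ P (fun w => Gam w * df (W w)).
  by apply: (@polybnd_integ 2) => //; have := polybndM polybnd_Gam pdf.
have svv : Num.sqrt v * Num.sqrt v = v by rewrite -expr2 sqr_sqrtr// ltW.
have svn : Num.sqrt v != 0 by rewrite gt_eqF.
have vinv : v^-1 = (Num.sqrt v)^-1 * (Num.sqrt v)^-1 by rewrite -invfM svv.
(* One factor 1/sqrt v comes from the normalisation of W, the other from the chain rule. *)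
have ibpW : \int[P]_w (W w * f (W w)) = \int[P]_w (Gam w / v * df (W w)).
  transitivity ((Num.sqrt v)^-1 * \int[P]_w ((Q w - mu) * g (Q w))).
    rewrite -RintegralZl//.
      by apply: eq_Rintegral => w _; rewrite /W /g; ring.
    have := integZ (Num.sqrt v) iWf; congr (integ P _); apply/funext => w.
    by rewrite /W /g; field.
  rewrite ibp -RintegralZl//.
    by apply: eq_Rintegral => w _; rewrite /dg /W vinv; ring.
  have := integZ (Num.sqrt v)^-1 iGdf; congr (integ P _); apply/funext => w.
  by rewrite /W /dg; ring.
have iGvdf : integ P (fun w => Gam w / v * df (W w)).
  by have := integZ v^-1 iGdf; congr (integ P _); apply/funext => w; ring.
have P1 (r : R) : \int[P]_w r = r.
  exact: Rintegral_prob_cst.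
have chW : continuous (fun q => h ((q - mu) / Num.sqrt v)).
  by move=> q; apply: (@continuous_comp _ _ _ (fun q => (q - mu) / Num.sqrt v) h); [exact: clin|exact: ch].
have ih : integ P (fun w => h (W w)).
  apply: (@polybnd_integ 0) => //; apply: (polybnd_contQ (A := 1) chW) => x.
  by have /andP[h0 h1] := h01 ((x - mu) / Num.sqrt v); rewrite ger0_norm.
have -> : \int[P]_w h (W w) - c = \int[P]_w (df (W w) * (1 - Gam w / v)).
  rewrite -{1}(P1 c) -RintegralB//; last exact: (@polybnd_integ 0 _ isT (polybnd_cst _)).
  under eq_Rintegral do rewrite -eqf.
  rewrite RintegralB// ibpW -RintegralB//.
  by apply: eq_Rintegral => w _; ring.
have pZ : polybnd 2 (fun w => 1 - Gam w / v).
  apply: polybndB; first by apply: polybndW (polybnd_cst 1).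
  by have := polybndZ v^-1 polybnd_Gam; congr (polybnd _); apply/funext => w; rewrite mulrC.
have iZ := @polybnd_integ 2 _ isT pZ.
have idZ : integ P (fun w => df (W w) * (1 - Gam w / v)).
  by apply: (@polybnd_integ 2) => //; have := polybndM pdf pZ.
rewrite (le_trans (le_normr_Rintegral _ _))//.
apply: (@le_trans _ _ (2 * \int[P]_w `|1 - Gam w / v|)); last first.
  by rewrite ler_pM2l// E_dev_Gam.
rewrite -RintegralZl//; last exact: integ_norm.
apply: le_Rintegral => //; [exact: integ_norm|by apply: integZ; exact: integ_norm|].
by move=> w _; rewrite normrM ler_wpM2r.
Qed.
End gaussian_family.

(** * The normal distribution function and Kolmogorov distance *)

Section Phi.
Context (R : realType).
Notation leb := (@lebesgue_measure R).
Local Notation p := (@normal_pdf R 0 1).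

Definition Phi (x : R) := \int[leb]_(t in `]-oo, x]) p t.

Lemma is_derive_Phi (x : R) : is_derive x 1 Phi (p x).
Proof.
have xx : x < x + 1 by rewrite ltrDl.
have ik' : leb.-integrable [set` Interval -oo%O (BRight (x + 1))] (EFin \o p).
  by apply: integS => //; exact: integ_normal_pdf.
have [||d1 d2] := continuous_FTC1 xx ik'; [exact: ltNyr|exact: continuous_pdf01|].
by split; [exact: d1|rewrite -derive1E d2].
Qed.

Lemma pdf01_ge0 (x : R) : 0 <= p x. Proof. exact: normal_pdf_ge0. Qed.

(** This rational decay is all that is needed: it absorbs factors |z| and z^2 in the threshold
    perturbation. *)
Lemma pdf01_le (x : R) : p x <= (1 + x ^+ 2 / 2)^-1.
Proof.
rewrite normal_pdfE ?oner_neq0// /normal_fun subr0 expr1n.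
have pk : normal_peak (1 : R) <= 1.
  have p2 : 1 <= pi *+ 2 :> R by have := pi_ge2 R; rewrite mulr2n; lra.
  rewrite /normal_peak expr1n mul1r invf_le1; last by rewrite sqrtr_gt0 (lt_le_trans ltr01 p2).
  by rewrite -[leLHS]sqrtr1 ler_wsqrtr.
rewrite -[leRHS]mul1r ler_pM ?normal_peak_ge0 ?expR_ge0//.
rewrite mulNr expRN lef_pV2 ?posrE ?expR_gt0//; last by rewrite ltr_pwDl// divr_ge0 ?sqr_ge0.
exact: expR_ge1Dx.
Qed.

Lemma pdf01_le1 (x : R) : p x <= 1.
Proof.
rewrite (le_trans (pdf01_le x))// invf_le1 ?lerDl ?divr_ge0 ?sqr_ge0//.
by rewrite ltr_pwDl// divr_ge0 ?sqr_ge0.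
Qed.

Lemma Phi_lip (x y : R) : `|Phi y - Phi x| <= `|y - x|.
Proof.
have [c _ ->] := MVT_all x y is_derive_Phi.
by rewrite normrM ler_piMl// ger0_norm ?pdf01_le1// pdf01_ge0.
Qed.

Lemma Phi_nondecreasing (x y : R) : x <= y -> Phi x <= Phi y.
Proof.
move=> xy; rewrite -subr_ge0; have [c _ ->] := MVT_all x y is_derive_Phi.
by rewrite mulr_ge0 ?pdf01_ge0// subr_ge0.
Qed.

(** A perturbation a of size at most |x|/2 keeps the intermediate point at distance at least |x|/2
    from 0, so the density there still decays in x. The remaining shift b is treated by the
    Lipschitz bound alone. *)
Lemma Phi_perturb (x a b : R) : `|a| <= `|x| / 2 ->
  `|Phi (x + a + b) - Phi x| <= `|a| * (1 + x ^+ 2 / 8)^-1 + `|b|.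
Proof.
move=> ax; rewrite -(subrK (Phi (x + a)) (Phi (x + a + b))) -addrA addrC.
rewrite (le_trans (ler_normD _ _))// lerD//; last first.
  by rewrite (le_trans (Phi_lip _ _))// addrC addKr.
have [c hc ->] := MVT_all x (x + a) is_derive_Phi.
rewrite (addrC x) addrK normrM mulrC ler_wpM2l// ger0_norm ?pdf01_ge0//.
have xc : `|x| / 2 <= `|c|.
  have h : `|c - x| <= `|a|.
    move: hc; rewrite minElt maxElt ltrDl; case: ltP => a0 /andP[h1 h2].
      by rewrite ger0_norm ?subr_ge0// (gtr0_norm a0) lerBlDl.
    by rewrite ler0_norm ?subr_le0// (ler0_norm a0); lra.
  have : `|x| <= `|c| + `|c - x|.
    by rewrite -{1}(subKr c x) (le_trans (ler_normB _ _)).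
  lra.
rewrite (le_trans (pdf01_le c))// lef_pV2 ?posrE ?ltr_pwDl ?divr_ge0 ?sqr_ge0//.
rewrite lerD2l -(real_normK (num_real x)) -(real_normK (num_real c)).
have := normr_ge0 x; nra.
Qed.

(** Mills' ratio with the density bounded by 1. The crude order 1/x suffices, because x will be of
    order at least sqrt n. *)
Lemma Phi_lower (x : R) : 0 < x -> Phi (- x) <= x^-1.
Proof.
move=> x0; rewrite -(ler_pM2l x0) divff ?gt_eqF//.
apply: le_trans (pdf01_le1 (- x)); rewrite -(lower_moment_pdf01 (- x)).
rewrite -RintegralZl//; last by apply: integS => //; exact: integ_normal_pdf.
apply: le_Rintegral => //.
- by apply: integS => //; apply: integZ; exact: integ_normal_pdf.
- by apply: integS => //; exact: integ_xpdf01.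
- move=> t /=; rewrite in_itv/= => tx; rewrite ler_wpM2r ?pdf01_ge0//.
  by rewrite lerNr.
Qed.

Lemma Phi_upper (x : R) : 0 < x -> 1 - Phi x <= x^-1.
Proof.
move=> x0; rewrite -(ler_pM2l x0) divff ?gt_eqF//.
apply: le_trans (pdf01_le1 x); rewrite -(upper_moment_pdf01 x).
rewrite -[X in X - Phi x](Rintegral_normal_pdf 1 0) (Rintegral_line_split x (integ_normal_pdf 0 1)).
rewrite /Phi addrAC subrr add0r.
have i : integ leb (fun t => t * p t).
  have := integN (integ_xpdf01 R); congr (integ leb _).
  by apply/funext => t; rewrite mulNr opprK.
rewrite -RintegralZl//; last by apply: integS => //; exact: integ_normal_pdf.
apply: le_Rintegral => //.
- by apply: integS => //; apply: integZ; exact: integ_normal_pdf.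
- exact: integS.
- move=> t /=; rewrite in_itv/= andbT => xt; rewrite ler_wpM2r ?pdf01_ge0//.
  exact: ltW.
Qed.

Lemma Phi_ge0 x : 0 <= Phi x.
Proof. by apply: Rintegral_ge0 => t _; exact: pdf01_ge0. Qed.

Lemma Phi_le1 x : Phi x <= 1.
Proof.
rewrite -[leRHS](Rintegral_normal_pdf 1 0) (Rintegral_line_split x (integ_normal_pdf 0 1)) lerDl.
by apply: Rintegral_ge0 => t _; exact: pdf01_ge0.
Qed.

Lemma normal_prob_Phi x : normal_prob 0 1 `]-oo, x] = (Phi x)%:E.
Proof.
rewrite /Phi /Rintegral fineK//; apply: integrable_fin_num => //.
by apply: integS => //; exact: integ_normal_pdf.
Qed.

Lemma Rintegral_indic d (T : measurableType d) (mu : {finite_measure set T -> \bar R}) (A : set T) :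
  measurable A -> \int[mu]_w \1_A w = fine (mu A).
Proof. by move=> mA; rewrite /Rintegral integral_indic// setIT. Qed.

(** Indicators of rays are squeezed between continuous ramps. As B is the same for every test
    function, making the ramp steeper costs nothing on the side of W, and only its width e on the
    normal side, where [Phi] is 1-Lipschitz. *)
Lemma kolmogorov_of_smooth d (T : measurableType d) (P : probability T R) (W : T -> R) (B : R) :
  measurable_fun setT W ->
  (forall h : R -> R, continuous h -> (forall x, 0 <= h x <= 1) ->
    `|\int[P]_w h (W w) - \int[leb]_x (h x * p x)| <= B) ->
  forall z, `|fine (P [set w | W w <= z]) - Phi z| <= B.
Proof.
move=> mW hB z.
have mA y : measurable [set w | W w <= y].
  by rewrite -[X in measurable X]setTI; exact: measurable_fun_le.
have mI (y : R) : measurable [set t : measurableTypeR R | t <= y].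
  by rewrite -(set_itvNyc y).
(* The ramp equal to 1 up to y, equal to 0 beyond y + d, and linear in between. *)
pose h (d y x : R) := Num.max 0 (Num.min 1 (1 - d^-1 * (x - y))).
have ch d0 y : continuous (h d0 y).
  have -> : h d0 y = (cst 0 : R -> R^o) \max ((cst 1 : R -> R^o) \min (fun x => 1 - d0^-1 * (x - y))) by [].
  move=> x; apply: continuous_max; first exact: cvg_cst.
  apply: continuous_min; first exact: cvg_cst.
  apply: cvgB; first exact: cvg_cst.
  by apply: cvgM; [exact: cvg_cst|apply: cvgB; [exact: cvg_id|exact: cvg_cst]].
have h01 d0 y x : 0 <= h d0 y x <= 1.
  by rewrite /h le_max lexx/= ge_max ler01 ge_min lexx.
have h_ge (d0 y x : R) : 0 < d0 -> x <= y -> 1 <= h d0 y x.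
  move=> d00 xy; rewrite /h le_max le_min lexx/= lerBrDr gerDl pmulr_rle0 ?invr_gt0//.
  by rewrite subr_le0 xy orbT.
have h_le (d0 y x : R) : 0 < d0 -> y + d0 < x -> h d0 y x <= 0.
  move=> d00 yx; rewrite /h ge_max lexx/= ge_min; apply/orP; right.
  rewrite subr_le0 -(mulVf (lt0r_neq0 d00)) ler_pM2l ?invr_gt0//.
  by rewrite lerBrDl ltW.
have EW y : \int[P]_w \1_[set w | W w <= y] w = fine (P [set w | W w <= y]).
  exact: Rintegral_indic.
have iI y : integ P (\1_[set w | W w <= y] : T -> R).
  exact: integrable_indic.
have ihW d0 y : integ P (fun w => h d0 y (W w)).
  apply: (@integ_le _ _ _ P _ (fun=> 1)).
  - apply: measurableT_comp mW; exact: continuous_measurable_fun.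
  - exact: finite_measure_integrable_cst.
  - by move=> w; have /andP[h0 h1] := h01 d0 y (W w); rewrite ger0_norm.
have ihp d0 y : integ leb (fun x => h d0 y x * p x).
  apply: integ_normal_bnd => //; first exact: continuous_measurable_fun.
  by move=> x; have /andP[h0 h1] := h01 d0 y x; rewrite ger0_norm.
have Pp y : Phi y = \int[leb]_x (\1_[set t : measurableTypeR R | t <= y] x * p x).
  rewrite /Phi Rintegral_mkcond; apply: eq_Rintegral => x _.
  rewrite /restrict indicE mem_setE in_itv/=.
  by case: (x <= y); rewrite ?mul1r ?mul0r.
have ipp y : integ leb (fun x => \1_[set t : measurableTypeR R | t <= y] x * p x).
  apply: integ_normal_bnd => //; first by apply: measurable_indic; exact: mI.
  by move=> x; rewrite ger0_norm// indicE; case: (_ \in _).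
have up d0 y : 0 < d0 -> fine (P [set w | W w <= y]) <= \int[P]_w h d0 y (W w).
  move=> d00; rewrite -EW; apply: le_Rintegral; [by []|exact: iI|exact: ihW|] => w _.
  rewrite indicE; case: (boolP (w \in _)) => [|_].
    by rewrite inE/= => /h_ge -> .
  by have /andP[] := h01 d0 y (W w).
have low d0 y : 0 < d0 -> \int[P]_w h d0 y (W w) <= fine (P [set w | W w <= y + d0]).
  move=> d00; rewrite -EW; apply: le_Rintegral; [by []|exact: ihW|exact: iI|] => w _.
  rewrite indicE; case: (boolP (w \in _)) => [_|].
    by have /andP[] := h01 d0 y (W w).
  by rewrite notin_setE/= => /negP; rewrite -ltNge => /h_le; exact.
have upP d0 y : 0 < d0 -> Phi y <= \int[leb]_x (h d0 y x * p x).
  move=> d00; rewrite Pp; apply: le_Rintegral; [by []|exact: ipp|exact: ihp|] => x _; rewrite ler_wpM2r ?pdf01_ge0//.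
  rewrite indicE; case: (boolP (x \in _)) => [|_].
    by rewrite inE/= => /h_ge -> .
  by have /andP[] := h01 d0 y x.
have lowP d0 y : 0 < d0 -> \int[leb]_x (h d0 y x * p x) <= Phi (y + d0).
  move=> d00; rewrite Pp; apply: le_Rintegral; [by []|exact: ihp|exact: ipp|] => x _; rewrite ler_wpM2r ?pdf01_ge0//.
  rewrite indicE; case: (boolP (x \in _)) => [_|].
    by have /andP[] := h01 d0 y x.
  by rewrite notin_setE/= => /negP; rewrite -ltNge => /h_le; exact.
apply/ler_addgt0Pr => e e0.
rewrite ler_norml; apply/andP; split.
  have := low e (z - e) e0; rewrite subrK => l1.
  have := upP e (z - e) e0.
  have := hB (h e (z - e)) (ch e (z - e)) (h01 e (z - e)); rewrite ler_norml => /andP[l2 _] l3.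
  have := Phi_lip z (z - e).
  rewrite addrAC subrr add0r normrN (gtr0_norm e0) ler_norml => /andP[l4 _].
  lra.
have l1 := up e z e0; have l3 := lowP e z e0.
have := hB (h e z) (ch e z) (h01 e z); rewrite ler_norml => /andP[_ l2].
have := Phi_lip z (z + e).
rewrite addrAC subrr add0r (gtr0_norm e0) ler_norml => /andP[_ l4].
lra.
Qed.
End Phi.

(** * Power sums *)

Section power_sums.
Context (R : realType).
Implicit Types (a b c u : R).

Definition pw a (k : nat) : R := k.+1%:R `^ (- a).

Lemma pw_gt0 a k : 0 < pw a k. Proof. by rewrite powR_gt0// ltr0n. Qed.
Lemma pw_ge0 a k : 0 <= pw a k. Proof. exact/ltW/pw_gt0. Qed.

Lemma powRDn a b (k : nat) : k.+1%:R `^ (a + b) = k.+1%:R `^ a * k.+1%:R `^ b :> R.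
Proof. by rewrite powRD// pnatr_eq0 implybT. Qed.

Lemma pwM a b k : pw a k * pw b k = pw (a + b) k.
Proof. by rewrite /pw -powRDn opprD. Qed.

Lemma powR_onem_le c u : 0 < c -> 0 <= u <= 1 -> (1 - u) `^ c <= (1 + c * u)^-1.
Proof.
move=> c0 /andP[u0 u1].
apply: (@le_trans _ _ (expR (- u) `^ c)).
  rewrite ge0_ler_powR ?nnegrE ?subr_ge0 ?expR_ge0 ?(ltW c0)//.
  by have := expR_ge1Dx (- u).
rewrite /powR gt_eqF ?expR_gt0// expRK mulrN expRN lef_pV2 ?posrE ?expR_gt0//.
  exact: expR_ge1Dx.
by rewrite ltr_pwDl// mulr_ge0// ltW.
Qed.

(** A discrete substitute for the derivative of x^c; telescoping it replaces the comparison of power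
    sums with integrals. *)
Lemma powR_pred_le c k : 0 < c ->
  k%:R `^ c <= k.+1%:R `^ c * (1 + c * k.+1%:R^-1)^-1 :> R.
Proof.
move=> c0.
have k0 : 0 < k.+1%:R :> R by rewrite ltr0n.
have u01 : (0 : R) <= (k.+1%:R : R)^-1 <= 1.
  by rewrite invr_ge0 (ltW k0)/= invf_le1// ler1n.
have -> : k%:R = k.+1%:R * (1 - k.+1%:R^-1) :> R.
  by rewrite mulrBr mulr1 divff ?gt_eqF// -natr1 addrK.
rewrite powRM ?(ltW k0) ?subr_ge0 ?(proj2 (andP u01))//.
by rewrite ler_wpM2l ?powR_ge0// powR_onem_le.
Qed.

Lemma sum_pw_lt1 a n : 0 < a < 1 -> \sum_(k < n) pw a k <= 2 / (1 - a) * n%:R `^ (1 - a).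
Proof.
move=> /andP[a0 a1]; set c := 1 - a.
have c0 : 0 < c by rewrite subr_gt0.
have c1 : c < 1 by rewrite /c; lra.
elim: n => [|n IH]; first by rewrite big_ord0 mulr_ge0 ?powR_ge0// divr_ge0// ltW.
rewrite big_ord_recr/=.
(* The factor 2 comes from 1/(1 + x) <= 1 - x/2 on [0, 1], at x = c/(n+1). *)
have step : pw a n <= 2 / c * (n.+1%:R `^ c - n%:R `^ c).
  have := powR_pred_le n c0.
  have n0 : 0 < n.+1%:R :> R by rewrite ltr0n.
  set u := n.+1%:R^-1; set A := n.+1%:R `^ c => h.
  have -> : pw a n = A * u.
    rewrite /pw (_ : - a = c + - 1); last by rewrite /c; ring.
    by rewrite powRDn powR_inv1// ltW.
  have u0 : 0 < u by rewrite invr_gt0.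
  have u1 : u <= 1 by rewrite invf_le1// ler1n.
  have A0 : 0 < A by rewrite powR_gt0.
  have cu0 : 0 < c * u by rewrite mulr_gt0.
  have cu1 : c * u <= 1 by rewrite mulr_ile1// ltW.
  have h2 : A * (c * u / 2) <= A - n%:R `^ c.
    have : A * (1 + c * u)^-1 <= A * (1 - c * u / 2).
      rewrite ler_pM2l// -[leLHS]mul1r ler_pdivrMr ?addr_gt0//; nra.
    by move=> h3; have := le_trans h h3; rewrite mulrBr mulr1; lra.
  rewrite mulrAC ler_pdivlMr//; move: h2; rewrite mulrA ler_pdivrMr//; lra.
by rewrite (le_trans (lerD IH step))// -mulrDr addrC subrK.
Qed.

Lemma sum_pw_tail b m N : 1 < b -> (0 < m)%N ->
  \sum_(m <= k < N) pw b k <= (b - 1)^-1 * m%:R `^ (1 - b).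
Proof.
move=> b1 m0; set c := b - 1; have c0 : 0 < c by rewrite subr_gt0.
have -> : 1 - b = - c by rewrite /c opprB.
have bE : b = c + 1 by rewrite /c subrK.
clearbody c.
have step k : (0 < k)%N -> pw b k <= c^-1 * (k%:R `^ (- c) - k.+1%:R `^ (- c)).
  move=> k0; have := powR_pred_le k c0.
  have kp : 0 < k%:R :> R by rewrite ltr0n.
  have n0 : 0 < k.+1%:R :> R by rewrite ltr0n.
  rewrite ler_pdivlMl//.
  rewrite /pw (_ : - b = - c + - 1); last by rewrite bE opprD.
  rewrite powRDn (powR_inv1 (ltW n0)) !powRN.
  set u := k.+1%:R^-1; set A := k.+1%:R `^ c; set D := k%:R `^ c => h.
  have A0 : 0 < A by rewrite powR_gt0.
  have D0 : 0 < D by rewrite powR_gt0.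
  have u0 : 0 < u by rewrite invr_gt0.
  have cu0 : 0 < c * u by rewrite mulr_gt0.
  have cu10 : 0 < 1 + c * u by rewrite addr_gt0.
  have : A^-1 * (1 + c * u) <= D^-1.
    rewrite -[leRHS]mul1r ler_pdivlMr// -ler_pdivlMl ?mulr_gt0 ?invr_gt0//.
    by rewrite mulr1 invfM invrK.
  by rewrite mulrDr mulr1; lra.
suff H : m%:R `^ (- c) * c^-1 - (\sum_(m <= k < N) pw b k) >= 0.
  by move: H; rewrite subr_ge0 mulrC.
have [Nm|mN] := leqP N m.
  by rewrite big_geq// subr0 mulr_ge0 ?powR_ge0// invr_ge0 ltW.
suff H : \sum_(m <= k < N) pw b k <= c^-1 * (m%:R `^ (- c) - N%:R `^ (- c)).
  rewrite subr_ge0 (le_trans H)// mulrC ler_wpM2r ?invr_ge0 ?(ltW c0)//.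
  by rewrite gerBl powR_ge0.
rewrite -(subnKC (ltnW mN)); elim: (N - m)%N => [|j IH].
  by rewrite addn0 big_geq// subrr mulr0.
rewrite addnS big_nat_recr/= ?leq_addr//.
have := step (m + j)%N; rewrite ltn_addr// => /(_ isT) h.
rewrite (le_trans (lerD IH h))// -mulrDr ler_wpM2l ?invr_ge0 ?(ltW c0)//.
lra.
Qed.

(** Comparison with the subcritical exponent 1 - dl. The loss n^dl treats b < 1, b > 1 and the
    logarithmic case b = 1 at once. *)
Lemma sum_pw_le b dl n : 0 < dl < 1 ->
  \sum_(k < n) pw b k <= 2 / dl * n%:R `^ (Num.max 0 (1 - b) + dl).
Proof.
move=> /andP[d0 d1].
case: n => [|n]; first by rewrite big_ord0 mulr_ge0 ?powR_ge0// divr_ge0// ltW.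
rewrite powRDn mulrCA.
have := @sum_pw_lt1 (1 - dl) n.+1; rewrite subKr => /(_ _)/(le_trans _).
move=> h; rewrite (le_trans (y := n.+1%:R `^ Num.max 0 (1 - b) * \sum_(k < n.+1) pw (1 - dl) k))//.
  rewrite mulr_sumr ler_sum// => k _.
  have -> : pw b k = k.+1%:R `^ (1 - b - dl) * pw (1 - dl) k.
    by rewrite /pw -powRDn; congr (_ `^ _); ring.
  rewrite ler_wpM2r ?pw_ge0//.
  apply: (@le_trans _ _ (k.+1%:R `^ Num.max 0 (1 - b))).
    rewrite ler_powR ?ler1n// le_max; apply/orP; right; lra.
  by rewrite ge0_ler_powR ?nnegrE// ?le_max ?lexx// ler_nat.
rewrite ler_wpM2l ?powR_ge0//; apply: h => //.
by apply/andP; split; lra.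
Qed.

(** Subtraction is truncated, so at most one summand is nonzero and the sum is |i - j|. *)
Definition dist (i j : nat) : nat := ((i - j) + (j - i))%N.

Lemma distC i j : dist i j = dist j i. Proof. by rewrite /dist addnC. Qed.

Lemma sum_dist (F : nat -> R) n (v : nat) : (v < n)%N ->
  \sum_(u < n) F (dist u v) = \sum_(0 <= j < v.+1) F j + \sum_(1 <= j < n - v) F j.
Proof.
move=> vn; rewrite -(big_mkord predT (fun u : nat => F (dist u v))).
rewrite (@big_cat_nat _ _ _ v.+1)//=; congr (_ + _).
  rewrite big_nat_rev/= big_nat [RHS]big_nat; apply: eq_bigr => j /andP[_ jv].
  congr F; rewrite /dist; lia.
rewrite -{1}(add1n v) big_addn big_nat [RHS]big_nat; apply: eq_bigr => j /andP[j1 jn].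
congr F; rewrite /dist; lia.
Qed.

Lemma sum_dist_le (F : nat -> R) n (v : nat) : (forall j, 0 <= F j) -> (v < n)%N ->
  \sum_(u < n) F (dist u v) <= 2 * \sum_(j < n) F j.
Proof.
move=> F0 vn; rewrite sum_dist// mulr_natl mulr2n.
rewrite -(big_mkord predT F); apply: lerD.
  rewrite (@big_cat_nat _ _ _ v.+1 0 n)//= lerDl sumr_ge0//.
rewrite (@big_cat_nat _ _ _ (n - v) 0 n)//= ?leq_subr// -[leLHS]addr0.
apply: lerD; last by rewrite sumr_ge0.
have [nv|nv] := leqP (n - v)%N 0; first by rewrite big_geq ?sumr_ge0// (leq_trans nv).
by rewrite [leRHS]big_ltn// lerDr.
Qed.

(** Of the distances from u to t and to v, the larger is at least k/2, where k is the distance from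
    t to v, and at least the smaller one j. So the product is of order max(j, k)^(-a) j^(-a).
    Indices j <= k contribute k^(-a) k^(1-a), which uses a < 1; indices j > k contribute a tail of
    exponent 2a > 1. Both are of order k^(1-2a). *)
Lemma conv_pw a : 1 / 2 < a < 1 -> exists2 C, 0 < C & forall n (t v : 'I_n),
  \sum_(u < n) pw a (dist t u) * pw a (dist u v) <= C * pw (2 * a - 1) (dist t v).
Proof.
move=> /andP[a2 a1].
have a0 : 0 <= a by lra.
pose C1 : R := 2 / (1 - a); pose C2 : R := (2 * a - 1)^-1.
have C10 : 0 < C1 by rewrite divr_gt0// subr_gt0.
have C20 : 0 < C2 by rewrite invr_gt0; lra.
exists (8 * (C1 + C2)); first by rewrite mulr_gt0// addr_gt0.
move=> n t v; set k := dist t v.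
have kn : (k < n)%N by rewrite /k /dist; have := ltn_ord t; have := ltn_ord v; lia.
pose K j := pw a (maxn j k) * pw a j.
have K0 j : 0 <= K j by rewrite mulr_ge0// pw_ge0.
(* Here max(d2, k) + 1 <= 2 (d1 + 1), and 2^a <= 2. *)
have half (d1 d2 : nat) : (d2 <= d1)%N -> (k <= d1 + d2)%N -> pw a d1 * pw a d2 <= 2 * K d2.
  move=> h1 h2; rewrite /K mulrA ler_wpM2r ?pw_ge0//.
  have m2 : (maxn d2 k).+1%:R <= 2 * d1.+1%:R :> R by rewrite -natrM ler_nat; lia.
  rewrite /pw !powRN ler_pdivlMr ?powR_gt0 ?ltr0n// mulrC ler_pdivrMr ?powR_gt0 ?ltr0n//.
  apply: (@le_trans _ _ ((2 * d1.+1%:R) `^ a)).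
    by rewrite ge0_ler_powR// nnegrE// mulr_ge0.
  rewrite powRM// ler_wpM2r ?powR_ge0//.
  by rewrite -[leRHS]powRr1// ler_powR ?ler1n// ltW.
have term (u : 'I_n) : pw a (dist t u) * pw a (dist u v) <= 2 * (K (dist u v) + K (dist u t)).
  have tri : (k <= dist t u + dist u v)%N by rewrite /k /dist; lia.
  have [h|h] := leqP (dist u v) (dist t u).
    rewrite (le_trans (half _ _ h tri))// ler_pM2l// lerDl//.
  rewrite mulrC (distC u t) (le_trans (half _ _ (ltnW h) _))//; first by rewrite addnC.
  by rewrite ler_pM2l// lerDr.
have sK : \sum_(j < n) K j <= (C1 + C2) * pw (2 * a - 1) k.
  rewrite -(big_mkord predT K) (@big_cat_nat _ _ _ k.+1)//= mulrDl lerD//.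
    apply: (@le_trans _ _ (pw a k * \sum_(j < k.+1) pw a j)).
      rewrite big_mkord mulr_sumr ler_sum// => j _.
      by rewrite /K (maxn_idPr _)// -ltnS.
    apply: (@le_trans _ _ (pw a k * (C1 * k.+1%:R `^ (1 - a)))).
      by rewrite ler_wpM2l ?pw_ge0// sum_pw_lt1//; apply/andP; split; lra.
    rewrite mulrCA ler_wpM2l ?(ltW C10)// /pw -powRDn le_eqVlt; apply/orP; left.
    by apply/eqP; congr (_ `^ _); ring.
  apply: (@le_trans _ _ (\sum_(k.+1 <= j < n) pw (2 * a) j)).
    rewrite big_nat [leRHS]big_nat ler_sum// => j /andP[kj _].
    by rewrite /K (maxn_idPl _) ?(ltnW kj)// pwM mulrDl mul1r.
  apply: (le_trans (sum_pw_tail _ _ _)) => //; first lra.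
  by rewrite /C2 /pw opprB.
apply: (@le_trans _ _ (\sum_(u < n) 2 * (K (dist u v) + K (dist u t)))).
  by apply: ler_sum => u _; exact: term.
rewrite -mulr_sumr big_split/=.
have s1 := sum_dist_le K0 (ltn_ord v); have s2 := sum_dist_le K0 (ltn_ord t).
have := pw_ge0 (2 * a - 1) k.
by move: sK s1 s2; set A := \sum_(j < n) K j; set X := pw _ k; clearbody C1 C2; lra.
Qed.
End power_sums.

(** * Covariances of the autoregression *)

Section finite_sums.
Context (R : realType).
Implicit Types (v w r : R).

Lemma sum_ord_le (F : nat -> R) m n : (forall i, 0 <= F i) -> (m <= n)%N ->
  \sum_(i < m) F i <= \sum_(i < n) F i.
Proof.
move=> F0 mn; rewrite -(big_mkord predT F) -[leRHS](big_mkord predT F).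
by rewrite [leRHS](@big_cat_nat _ _ _ m)//= lerDl sumr_ge0.
Qed.

Lemma rev_ord2 n (j : 'I_n) : (n - (n - j.+1).+1)%N = j.
Proof. by have := ltn_ord j; lia. Qed.

Lemma double_sum_le (F : nat -> nat -> R) t u t' u' : (forall i j, 0 <= F i j) ->
  (t <= t')%N -> (u <= u')%N ->
  \sum_(i < t) \sum_(j < u) F i j <= \sum_(i < t') \sum_(j < u') F i j.
Proof.
move=> F0 tt uu; apply: (@le_trans _ _ (\sum_(i < t) \sum_(j < u') F i j)).
  by apply: ler_sum => i _; exact: (@sum_ord_le (F i)).
by apply: (@sum_ord_le (fun i => \sum_(j < u') F i j)) => // i; exact: sumr_ge0.
Qed.

Lemma double_sum_term (F : nat -> nat -> R) t u (i j : nat) :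
  (forall i j, 0 <= F i j) -> (i < t)%N -> (j < u)%N ->
  F i j <= \sum_(i < t) \sum_(j < u) F i j.
Proof.
move=> F0 it ju.
rewrite (bigD1 (Ordinal it))//= (bigD1 (Ordinal ju))//= -addrA lerDl addr_ge0//.
  exact: sumr_ge0.
by apply: sumr_ge0 => k _; exact: sumr_ge0.
Qed.

Lemma geom_sum v N : v < 1 -> \sum_(i < N) v ^+ i = (1 - v ^+ N) / (1 - v).
Proof.
move=> v1; have v0 : 1 - v != 0 by rewrite subr_eq0 gt_eqF.
elim: N => [|N IH]; first by rewrite big_ord0 expr0 subrr mul0r.
by rewrite big_ord_recr/= IH exprS; field.
Qed.

Lemma geom_sum_le v N : 0 <= v < 1 -> \sum_(i < N) v ^+ i <= (1 - v)^-1.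
Proof.
move=> /andP[v0 v1]; rewrite geom_sum// ler_pdivrMr ?subr_gt0//.
by rewrite mulVf ?subr_eq0 ?gt_eqF// gerBl exprn_ge0.
Qed.

Lemma double_geom v t u :
  \sum_(i < t) \sum_(j < u) v ^+ (i + j) = (\sum_(i < t) v ^+ i) * \sum_(j < u) v ^+ j.
Proof.
rewrite mulr_suml; apply: eq_bigr => i _; rewrite mulr_sumr.
by apply: eq_bigr => j _; rewrite exprD.
Qed.

Lemma sqr_geom_sum_le v N : 0 <= v < 1 ->
  \sum_(i < N) i.+1%:R ^+ 2 * v ^+ i <= 2 / (1 - v) ^+ 3.
Proof.
move=> /andP[v0 v1]; have w0 : 0 < 1 - v by rewrite subr_gt0.
pose p : R := N%:R ^+ 2 * (1 - v) ^+ 2 + 2 * N%:R * (1 - v) + (1 + v).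
(* Closed form of the partial sums, checked by induction; as p is nonnegative, 1 + v <= 2 bounds the
   right side. *)
have key : (1 - v) ^+ 3 * \sum_(i < N) i.+1%:R ^+ 2 * v ^+ i = (1 + v) - v ^+ N * p.
  rewrite {}/p; elim: N => [|N IH]; first by rewrite big_ord0 expr0; ring.
  by rewrite big_ord_recr/= mulrDr IH (exprS v N) -(natr1 N); ring.
have p0 : 0 <= p by rewrite !addr_ge0 ?mulr_ge0 ?sqr_ge0 ?(ltW w0).
rewrite ler_pdivlMr ?exprn_gt0// mulrC key.
by have := mulr_ge0 (exprn_ge0 N v0) p0; lra.
Qed.

Lemma double_sqr_geom_le v t u : 0 <= v < 1 ->
  \sum_(i < t) \sum_(j < u) (i.+1%:R * j.+1%:R) ^+ 2 * v ^+ (i + j)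
    <= (2 / (1 - v) ^+ 3) ^+ 2.
Proof.
move=> v01; have /andP[v0 v1] := v01.
have -> : \sum_(i < t) \sum_(j < u) (i.+1%:R * j.+1%:R) ^+ 2 * v ^+ (i + j) =
  (\sum_(i < t) i.+1%:R ^+ 2 * v ^+ i) * \sum_(j < u) j.+1%:R ^+ 2 * v ^+ j.
  rewrite mulr_suml; apply: eq_bigr => i _; rewrite mulr_sumr.
  by apply: eq_bigr => j _; rewrite exprD exprMn; ring.
have s0 n : 0 <= \sum_(i < n) i.+1%:R ^+ 2 * v ^+ i.
  by apply: sumr_ge0 => i _; rewrite mulr_ge0 ?exprn_ge0.
by rewrite expr2 ler_pM// sqr_geom_sum_le.
Qed.

(** The natural bound carries r^(m-2); writing it as r^m times r^-2 keeps the statement uniform for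
    m < 2, where truncated subtraction would spoil it. *)
Lemma expr_taylor r v w m : 0 < r -> 0 <= v <= r -> 0 <= w <= r ->
  `|w ^+ m - v ^+ m - m%:R * v ^+ m.-1 * (w - v)|
    <= m%:R ^+ 2 * r ^+ m * (r ^- 2 * (w - v) ^+ 2).
Proof.
move=> r0 /andP[v0 vr] /andP[w0 wr].
set d2 := (w - v) ^+ 2; have d0 : 0 <= d2 by exact: sqr_ge0.
have rn : r != 0 by rewrite gt_eqF.
elim: m => [|m IH]; first by rewrite !expr0 !mul0r subrr subr0 normr0 expr0n/= !mul0r.
have -> : w ^+ m.+1 - v ^+ m.+1 - m.+1%:R * v ^+ m.+1.-1 * (w - v) =
  w * (w ^+ m - v ^+ m - m%:R * v ^+ m.-1 * (w - v)) + m%:R * v ^+ m.-1 * d2.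
  case: m {IH} => [|m]; first by rewrite /d2 /= !expr0 !expr1; ring.
  by rewrite /d2 /= !exprS -!natr1; ring.
rewrite (le_trans (ler_normD _ _))// normrM (ger0_norm w0).
have h1 : w * `|w ^+ m - v ^+ m - m%:R * v ^+ m.-1 * (w - v)|
    <= r * (m%:R ^+ 2 * r ^+ m * (r ^- 2 * d2)) by rewrite ler_pM.
have h2 : `|m%:R * v ^+ m.-1 * d2| <= m%:R * r ^+ m.+1 * (r ^- 2 * d2).
  rewrite ger0_norm; last exact: (mulr_ge0 (mulr_ge0 (ler0n _ _) (exprn_ge0 _ v0)) d0).
  have -> : m%:R * r ^+ m.+1 * (r ^- 2 * d2) = m%:R * (r ^+ m.+1 * (r ^- 2 * d2)).
    by rewrite mulrA.
  case: m {IH h1} => [|m]; first by rewrite !mul0r.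
  rewrite -mulrA ler_wpM2l// (_ : r ^+ m.+2 * _ = r ^+ m * d2); last first.
    by rewrite !exprS; field.
  by rewrite ler_wpM2r// lerXn2r// nnegrE// ltW.
apply: (le_trans (lerD h1 h2)).
have rd0 : 0 <= r ^- 2 * d2 by apply: mulr_ge0 d0; rewrite invr_ge0 exprn_ge0// ltW.
rewrite mulrA -mulrDl; apply: ler_wpM2r rd0 _ _ _.
have -> : r * (m%:R ^+ 2 * r ^+ m) = m%:R ^+ 2 * r ^+ m.+1 by rewrite (exprS r m); ring.
rewrite -mulrDl ler_wpM2r ?exprn_ge0 ?(ltW r0)// -natr1.
by have : 0 <= m%:R :> R by []; nra.
Qed.

End finite_sums.

(** * Truncated covariances and their stationary limit *)

Section covariance.
Context (R : realType) (rho : int -> R) (a C0 : R).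
Hypothesis rho_ge0 : forall k, 0 <= rho k.
Hypothesis rho_le1 : forall k, rho k <= 1.
Hypothesis rho0 : rho 0 = 1.
Hypothesis rho1 : 0 < rho 1.
Hypothesis rhoN : forall k, rho (- k) = rho k.
Hypothesis C0_gt0 : 0 < C0.
Hypothesis a_range : 1 / 2 < a < 1.
Hypothesis rho_pw : forall k : int, rho k <= C0 * pw a `|k|%N.
Implicit Types (v w r : R) (k : int).

(** Covariance at lag k of two moving averages of the noise with weights v^i, truncated to t and u
    terms. The process started at 0 and the partial sums of the stationary solution are both of this
    form, so one family serves both. *)
Definition cov v (t u : nat) k : R :=
  \sum_(i < t) \sum_(j < u) v ^+ (i + j) * rho (k + i%:Z - j%:Z).

Lemma cov_nd v t u t' u' k : 0 <= v -> (t <= t')%N -> (u <= u')%N ->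
  cov v t u k <= cov v t' u' k.
Proof.
move=> v0; apply: (@double_sum_le _ (fun i j => v ^+ (i + j) * rho (k + i%:Z - j%:Z))).
by move=> i j; rewrite mulr_ge0 ?exprn_ge0.
Qed.

Lemma cov_ge0 v t u k : 0 <= v -> 0 <= cov v t u k.
Proof.
by move=> v0; do 2!(apply: sumr_ge0 => ? _); rewrite mulr_ge0 ?exprn_ge0.
Qed.

Lemma cov_ge1 v t u : 0 <= v -> 1 <= cov v t.+1 u.+1 0.
Proof.
move=> v0; have /(_ 0%N 0%N) := @double_sum_term R
  (fun i j => v ^+ (i + j) * rho (0 + i%:Z - j%:Z)) t.+1 u.+1.
rewrite addn0 expr0 mul1r subr0 addr0 rho0; apply=> // i j.
by rewrite mulr_ge0 ?exprn_ge0.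
Qed.

Lemma cov_le v t u k : 0 <= v < 1 -> cov v t u k <= (1 - v) ^- 2.
Proof.
move=> v01; have /andP[v0 v1] := v01.
apply: (@le_trans _ _ (\sum_(i < t) \sum_(j < u) v ^+ (i + j))).
  apply: ler_sum => i _; apply: ler_sum => j _.
  by rewrite -[leRHS]mulr1 ler_wpM2l ?exprn_ge0.
rewrite double_geom expr2 invfM ler_pM ?geom_sum_le//.
  by apply: sumr_ge0 => i _; rewrite exprn_ge0.
by apply: sumr_ge0 => i _; rewrite exprn_ge0.
Qed.

Lemma covN v t k : cov v t t (- k) = cov v t t k.
Proof.
rewrite /cov exchange_big; apply: eq_bigr => i _; apply: eq_bigr => j _.
by rewrite addnC -[in RHS]rhoN; congr (_ * rho _); ring.
Qed.

Definition Rcov v k : R := limn (fun N => cov v N N k).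

Lemma cov_cvg v k : 0 <= v < 1 -> (fun N => cov v N N k) @ \oo --> Rcov v k.
Proof.
move=> v01; have /andP[v0 v1] := v01.
apply: nondecreasing_is_cvgn; first by move=> m n mn; exact: cov_nd.
by exists ((1 - v) ^- 2) => _ [n _ <-]; exact: cov_le.
Qed.

Lemma cov_le_Rcov v t u k : 0 <= v < 1 -> cov v t u k <= Rcov v k.
Proof.
move=> v01; have /andP[v0 v1] := v01.
apply: limr_ge; first by apply/cvg_ex; eexists; exact: cov_cvg.
near=> N; apply: cov_nd => //.
  by near: N; exact: nbhs_infty_ge.
by near: N; exact: nbhs_infty_ge.
Unshelve. all: by end_near. Qed.

Lemma Rcov_le v k B : 0 <= v < 1 -> (forall N, cov v N N k <= B) -> Rcov v k <= B.
Proof.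
move=> v01 h; apply: limr_le; first by apply/cvg_ex; eexists; exact: cov_cvg.
by near=> N; exact: h.
Unshelve. all: by end_near. Qed.

Lemma Rcov_ge0 v k : 0 <= v < 1 -> 0 <= Rcov v k.
Proof.
by move=> v01; apply: le_trans (cov_le_Rcov 0 0 k v01); rewrite cov_ge0// (andP v01).1.
Qed.

Lemma Rcov_ge1 v : 0 <= v < 1 -> 1 <= Rcov v 0.
Proof.
by move=> v01; apply: le_trans (cov_le_Rcov 1 1 0 v01); rewrite cov_ge1//; case/andP: v01.
Qed.

Lemma RcovN v k : Rcov v (- k) = Rcov v k.
Proof. by rewrite /Rcov; congr (limn _); apply/funext => N; rewrite covN. Qed.

Lemma Rcov_abs v k : Rcov v `|k|%N = Rcov v k.
Proof. by case: (intP k) => // n; rewrite ?abszN ?RcovN. Qed.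

(** As 1 - rho is also nonnegative, the complementary double sum increases with the truncation too.
    The truncation error of [cov] is therefore at most that of the purely geometric double sum,
    which is explicit. *)
Lemma Rcov_sub_cov v t u k : 0 <= v < 1 ->
  Rcov v k - cov v t u k <= (v ^+ t + v ^+ u) / (1 - v) ^+ 2.
Proof.
move=> v01; have /andP[v0 v1] := v01; rewrite lerBlDl; apply: Rcov_le => // N0.
apply: (le_trans (cov_nd k v0 (leq_addr (t + u) N0) (leq_addr (t + u) N0))).
set N := (N0 + (t + u))%N.
have tN : (t <= N)%N by rewrite /N; lia.
have uN : (u <= N)%N by rewrite /N; lia.
have := @double_sum_le R (fun i j => v ^+ (i + j) * (1 - rho (k + i%:Z - j%:Z))) t u N N.
move=> h.
have split_sum (t' u' : nat) : \sum_(i < t') \sum_(j < u') v ^+ (i + j) * (1 - rho (k + i%:Z - j%:Z))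
   = (1 - v ^+ t') * (1 - v ^+ u') / (1 - v) ^+ 2 - cov v t' u' k.
  have <- : \sum_(i < t') \sum_(j < u') v ^+ (i + j) = (1 - v ^+ t') * (1 - v ^+ u') / (1 - v) ^+ 2.
    by rewrite double_geom !geom_sum// expr2 invfM; ring.
  rewrite /cov -sumrB; apply: eq_bigr => i _; rewrite -sumrB.
  by apply: eq_bigr => j _; rewrite mulrBr mulr1.
have e : (1 - v ^+ N) * (1 - v ^+ N) / (1 - v) ^+ 2 <=
  ((1 - v ^+ t) * (1 - v ^+ u) + (v ^+ t + v ^+ u)) / (1 - v) ^+ 2.
  rewrite ler_wpM2r ?invr_ge0 ?exprn_ge0 ?subr_ge0 ?(ltW v1)//.
  have b n : 0 <= v ^+ n <= 1 by rewrite exprn_ge0//= exprn_ile1// ltW.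
  have /andP[? ?] := b N; have /andP[? ?] := b t; have /andP[? ?] := b u.
  nra.
have {}h : (1 - v ^+ t) * (1 - v ^+ u) / (1 - v) ^+ 2 - cov v t u k <=
    (1 - v ^+ N) * (1 - v ^+ N) / (1 - v) ^+ 2 - cov v N N k.
  by rewrite -!split_sum; apply: h => // i j; rewrite mulr_ge0 ?exprn_ge0 ?subr_ge0.
by move: e; rewrite [X in _ <= X]mulrDl; lra.
Qed.

(** Peetre's inequality 1 + |k| <= (1 + |k + i - j|)(1 + i)(1 + j), raised to the power a; the
    exponent a is then rounded up to 2 so that the geometric sums are explicit. *)
Lemma pw_shift k (i j : nat) : pw a (absz (k + i%:Z - j%:Z)%R)
   <= (i.+1%:R * j.+1%:R) ^+ 2 * pw a `|k|%N.
Proof.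
have /andP[a2 a1] := a_range.
have a0 : 0 <= a by lra.
set m := absz (k + i%:Z - j%:Z)%R.
have h : `|k|.+1%:R <= m.+1%:R * (i.+1%:R * j.+1%:R) :> R.
  by rewrite -!natrM ler_nat /m; have : (absz k <= absz (k + i%:Z - j%:Z)%R + i + j)%N; [lia | nia].
have p1 : 1 <= i.+1%:R * j.+1%:R :> R by rewrite -natrM ler1n.
rewrite /pw !powRN ler_pdivlMr ?powR_gt0 ?ltr0n// mulrC ler_pdivrMr ?powR_gt0 ?ltr0n//.
apply: (@le_trans _ _ ((m.+1%:R * (i.+1%:R * j.+1%:R)) `^ a)).
  by rewrite ge0_ler_powR ?nnegrE// mulr_ge0// mulr_ge0.
rewrite powRM ?mulr_ge0// mulrC ler_wpM2r ?powR_ge0//.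
by rewrite -powR_mulrn ?mulr_ge0// ler_powR//; lra.
Qed.

(** The stationary covariance inherits the decay of rho, because the polynomial cost of a shift by i
    - j is summable against v^(i+j). *)
Lemma Rcov_pw v : 0 <= v < 1 -> exists2 C, 0 < C & forall k, Rcov v k <= C * pw a `|k|%N.
Proof.
move=> v01; have /andP[v0 v1] := v01.
exists (C0 * (2 / (1 - v) ^+ 3) ^+ 2).
  by rewrite mulr_gt0// exprn_gt0// divr_gt0// exprn_gt0// subr_gt0.
move=> k; apply: Rcov_le => // N.
apply: (@le_trans _ _ (\sum_(i < N) \sum_(j < N)
    (C0 * pw a `|k|%N) * ((i.+1%:R * j.+1%:R) ^+ 2 * v ^+ (i + j)))).
  apply: ler_sum => i _; apply: ler_sum => j _.
  have h := rho_pw (k + i%:Z - j%:Z).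
  have h2 := ler_wpM2l (ltW C0_gt0) (pw_shift k i j).
  have h3 := ler_wpM2l (exprn_ge0 (i + j) v0) (le_trans h h2).
  by apply: (le_trans h3); rewrite le_eqVlt; apply/orP; left; apply/eqP; ring.
under eq_bigr do rewrite -mulr_sumr.
rewrite -mulr_sumr -[leRHS]mulrA [in leRHS](mulrC _ (pw _ _)) mulrA.
by rewrite ler_wpM2l ?double_sqr_geom_le// mulr_ge0 ?pw_ge0// ltW.
Qed.

(** An iterated limit is identified with a limit over squares: with nonnegative terms, the sum of
    the first M complete rows lies between the M by M square and the full sum. *)
Lemma second_momentE v : 0 <= v < 1 -> second_moment rho v = Rcov v 0.
Proof.
move=> v01; have /andP[v0 v1] := v01.
pose F (i : nat) := limn (series (fun j : nat => v ^+ (i + j) * rho (i%:Z - j%:Z))).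
have Fcvg i : series (fun j : nat => v ^+ (i + j) * rho (i%:Z - j%:Z)) @ \oo --> F i.
  apply: nondecreasing_is_cvgn.
    apply/nondecreasing_seqP => n; rewrite /series/= big_nat_recr//= lerDl.
    by rewrite mulr_ge0 ?exprn_ge0.
  exists ((1 - v)^-1) => _ [n _ <-]; rewrite /series/= big_mkord.
  apply: le_trans (geom_sum_le n v01); apply: ler_sum => j _.
  rewrite -[leRHS]mul1r exprD mulrAC ler_wpM2r ?exprn_ge0// mulr_ile1 ?exprn_ge0//.
  by rewrite exprn_ile1// ltW.
have JE M : (fun N => cov v M N 0) @ \oo --> \sum_(i < M) F i.
  have -> : (fun N => cov v M N 0) =
      (fun N => \sum_(i < M) series (fun j : nat => v ^+ (i + j) * rho (i%:Z - j%:Z)) N).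
    by apply/funext => N; apply: eq_bigr => i _; rewrite /series/= big_mkord; under [LHS]eq_bigr do rewrite add0r.
  by apply: cvg_big => [|i _]; [exact: add_continuous | exact: Fcvg].
have Jup M : \sum_(i < M) F i <= Rcov v 0.
  rewrite -(cvg_lim _ (JE M))//; apply: limr_le; first by apply/cvg_ex; eexists; exact: JE.
  by near=> N; exact: cov_le_Rcov.
have Jlow M : cov v M M 0 <= \sum_(i < M) F i.
  rewrite -(cvg_lim _ (JE M))//; apply: limr_ge; first by apply/cvg_ex; eexists; exact: JE.
  by near=> N; apply: cov_nd => //; near: N; exact: nbhs_infty_ge.
apply: cvg_lim => //.
have -> : series F = (fun M => \sum_(i < M) F i).
  by apply/funext => M; rewrite /series/= big_mkord.
apply: (@squeeze_cvgr _ _ _ _ (fun N => cov v N N 0) (fun=> Rcov v 0)).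
- by near=> M; rewrite Jlow Jup.
- exact: cov_cvg.
- exact: cvg_cst.
Unshelve. all: by end_near. Qed.

(** Termwise derivative of [cov v N N 0] in v; at i = j = 0 the factor (i + j) is zero, so the
    truncated predecessor does no harm. *)
Definition dcov v N : R :=
  \sum_(i < N) \sum_(j < N) (i + j)%:R * v ^+ (i + j).-1 * rho (0 + i%:Z - j%:Z).

Definition Dcov v : R := limn (dcov v).

Definition taylorK r : R := (2 / (1 - r) ^+ 3) ^+ 2 * r ^- 2.

Lemma taylorK_gt0 r : 0 < r < 1 -> 0 < taylorK r.
Proof.
move=> /andP[r0 r1].
by rewrite mulr_gt0 ?invr_gt0 ?exprn_gt0 ?divr_gt0 ?exprn_gt0 ?subr_gt0.
Qed.

Lemma natrD_le (i j : nat) : (i + j)%:R <= i.+1%:R * j.+1%:R :> R.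
Proof. by rewrite -natrM ler_nat; nia. Qed.

Lemma natrD_le_sqr (i j : nat) : (i + j)%:R <= (i.+1%:R * j.+1%:R) ^+ 2 :> R.
Proof. by rewrite -natrM -natrX ler_nat; nia. Qed.

Lemma dcov_cvg v : 0 <= v < 1 -> dcov v @ \oo --> Dcov v.
Proof.
move=> /andP[v0 v1]; apply: nondecreasing_is_cvgn.
  move=> m n mn; apply: (@double_sum_le _
    (fun i j => (i + j)%:R * v ^+ (i + j).-1 * rho (0 + i%:Z - j%:Z))) => //.
  by move=> i j; rewrite !mulr_ge0 ?exprn_ge0.
(* Powers are compared with those of the midpoint of v and 1, which is positive even if v = 0; its
   inverse accounts for the lowered exponent. *)
set r := (1 + v) / 2.
have r0 : 0 < r by rewrite /r; lra.
have r1 : r < 1 by rewrite /r; lra.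
have vr : v <= r by rewrite /r; lra.
exists (r^-1 * (2 / (1 - r) ^+ 3) ^+ 2) => _ [n _ <-].
apply: (@le_trans _ _ (r^-1 * \sum_(i < n) \sum_(j < n) (i.+1%:R * j.+1%:R) ^+ 2 * r ^+ (i + j))).
  rewrite mulr_sumr ler_sum// => i _; rewrite mulr_sumr ler_sum// => j _.
  have ge0 (k : nat) : 0 <= k%:R * v ^+ k.-1 by rewrite mulr_ge0 ?exprn_ge0.
  apply: (@le_trans _ _ ((i + j)%:R * v ^+ (i + j).-1)).
    by rewrite -[leRHS]mulr1 ler_wpM2l.
  apply: (@le_trans _ _ ((i + j)%:R * (r^-1 * r ^+ (i + j)))); last first.
    rewrite mulrCA ler_wpM2l ?invr_ge0 ?(ltW r0)// ler_wpM2r ?exprn_ge0 ?(ltW r0)//.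
    exact: natrD_le_sqr.
  case: (i + j)%N => [|k]; first by rewrite !mul0r.
  rewrite exprS mulKf ?gt_eqF// ler_wpM2l// lerXn2r// nnegrE// ltW//.
by rewrite ler_wpM2l ?invr_ge0 ?(ltW r0)// double_sqr_geom_le// (ltW r0).
Qed.

(** The remainder is bounded term by term uniformly in the truncation. One estimate thus serves for
    the differentiability of f and for the quadratic error in the threshold. *)
Lemma Rcov_taylor r v w : 0 < r < 1 -> 0 <= v <= r -> 0 <= w <= r ->
  `|Rcov w 0 - Rcov v 0 - Dcov v * (w - v)| <= taylorK r * (w - v) ^+ 2.
Proof.
move=> /andP[r0 r1] vr wr.
have [[v0 v1] [w0 w1]] := (andP vr, andP wr).
have v01 : 0 <= v < 1 by rewrite v0 (le_lt_trans v1).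
have w01 : 0 <= w < 1 by rewrite w0 (le_lt_trans w1).
have cv : (fun N => `|cov w N N 0 - cov v N N 0 - dcov v N * (w - v)|) @ \oo -->
    `|Rcov w 0 - Rcov v 0 - Dcov v * (w - v)|.
  apply: cvg_norm; apply: cvgB; first by apply: cvgB; exact: cov_cvg.
  by apply: cvgMl; exact: dcov_cvg.
rewrite -(cvg_lim _ cv)//; apply: limr_le; first by apply/cvg_ex; eexists; exact: cv.
near=> N.
rewrite /cov /dcov mulr_suml -!sumrB (le_trans (ler_norm_sum _ _ _))//.
apply: (@le_trans _ _ (\sum_(i < N) \sum_(j < N)
    (r ^- 2 * (w - v) ^+ 2) * ((i.+1%:R * j.+1%:R) ^+ 2 * r ^+ (i + j)))).
  apply: ler_sum => i _.
  rewrite mulr_suml -!sumrB (le_trans (ler_norm_sum _ _ _))//.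
  apply: ler_sum => j _.
  have := expr_taylor (i + j) r0 vr wr.
  set x := w ^+ _; set y := v ^+ _; set z := v ^+ _; set q := rho _ => h.
  have -> : x * q - y * q - (i + j)%:R * z * q * (w - v) =
    (x - y - (i + j)%:R * z * (w - v)) * q by ring.
  rewrite normrM (ger0_norm (rho_ge0 _)).
  apply: (@le_trans _ _ `|x - y - (i + j)%:R * z * (w - v)|).
    by rewrite -[leRHS]mulr1 ler_wpM2l// rho_le1.
  have d0 : 0 <= r ^- 2 * (w - v) ^+ 2.
    by apply: mulr_ge0 (sqr_ge0 _); rewrite invr_ge0 exprn_ge0// ltW.
  rewrite (le_trans h)// mulrC; apply: ler_wpM2l d0 _ _ _.
  rewrite ler_wpM2r ?exprn_ge0 ?(ltW r0)// lerXn2r ?nnegrE ?mulr_ge0//.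
  exact: natrD_le.
under eq_bigr do rewrite -mulr_sumr.
rewrite -mulr_sumr /taylorK mulrC mulrA ler_wpM2r ?sqr_ge0// ler_wpM2r ?invr_ge0 ?exprn_ge0 ?(ltW r0)//.
by rewrite double_sqr_geom_le// (ltW r0).
Unshelve. all: by end_near. Qed.

Lemma Dcov_gt0 v : 0 <= v < 1 -> 0 < Dcov v.
Proof.
move=> v01; have /andP[v0 v1] := v01; apply: (lt_le_trans rho1).
apply: limr_ge; first by apply/cvg_ex; eexists; exact: dcov_cvg.
near=> N.
have N2 : (2 <= N)%N by near: N; exact: nbhs_infty_ge.
have := @double_sum_term R (fun i j => (i + j)%:R * v ^+ (i + j).-1 * rho (0 + i%:Z - j%:Z))
  N N 1%N 0%N.
rewrite addn0 expr0 !mul1r add0r subr0 => /(_ _ N2 (ltnW N2)); apply.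
by move=> i j; rewrite !mulr_ge0 ?exprn_ge0.
Unshelve. all: by end_near. Qed.

(** All terms increase with v, and the term (i, j) = (1, 0) alone is rho(1) v. The quantitative
    slope is what later separates f(theta) from f at the ends of a window. *)
Lemma Rcov_incr v w : 0 <= v -> v <= w -> w < 1 -> rho 1 * (w - v) <= Rcov w 0 - Rcov v 0.
Proof.
move=> v0 vw w1.
have w01 : 0 <= w < 1 by rewrite w1 (le_trans v0).
have v01 : 0 <= v < 1 by rewrite v0 (le_lt_trans vw).
have cv : (fun N => cov w N N 0 - cov v N N 0) @ \oo --> Rcov w 0 - Rcov v 0.
  by apply: cvgB; exact: cov_cvg.
rewrite -(cvg_lim _ cv)//; apply: limr_ge; first by apply/cvg_ex; eexists; exact: cv.
near=> N.
have N2 : (2 <= N)%N by near: N; exact: nbhs_infty_ge.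
have -> : cov w N N 0 - cov v N N 0 =
  \sum_(i < N) \sum_(j < N) (w ^+ (i + j) - v ^+ (i + j)) * rho (0 + i%:Z - j%:Z).
  rewrite /cov -sumrB; apply: eq_bigr => i _; rewrite -sumrB.
  by apply: eq_bigr => j _; rewrite mulrBl.
have := @double_sum_term R (fun i j => (w ^+ (i + j) - v ^+ (i + j)) * rho (0 + i%:Z - j%:Z))
  N N 1%N 0%N.
rewrite addn0 !expr1 add0r subr0 (mulrC (rho 1)) => /(_ _ N2 (ltnW N2)); apply.
move=> i j; rewrite mulr_ge0// subr_ge0 lerXn2r// nnegrE//.
exact: le_trans v0 vw.
Unshelve. all: by end_near. Qed.

Lemma is_derive_second_moment v : 0 < v < 1 ->
  is_derive (v : R) 1 (second_moment rho) (Dcov v).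
Proof.
move=> /andP[v0 v1].
set r := (1 + v) / 2.
have r0 : 0 < r by rewrite /r; lra.
have r1 : r < 1 by rewrite /r; lra.
have r01 : 0 < r < 1 by rewrite r0.
have vr : 0 <= v <= r by rewrite (ltW v0)/= /r; lra.
have K0 := taylorK_gt0 r01.
suff cv : h^-1 *: (second_moment rho (h *: 1 + v) - second_moment rho v) @[h --> 0^'] --> Dcov v.
  by split; [apply/cvg_ex; exists (Dcov v) | exact: cvg_lim].
apply/cvgrPdist_le => e e0; near=> h.
have h0 : h != 0 by near: h; exact: nbhs_dnbhs_neq.
have hv : `|h| <= v by near: h; exact: dnbhs0_le.
have hr : `|h| <= (1 - v) / 2 by near: h; apply: dnbhs0_le; rewrite divr_gt0// subr_gt0.
have he : `|h| <= e / taylorK r by near: h; apply: dnbhs0_le; rewrite divr_gt0.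
have /andP[hv1 hv2] : - v <= h <= v by rewrite -ler_norml.
have /andP[hr1 hr2] : - ((1 - v) / 2) <= h <= (1 - v) / 2 by rewrite -ler_norml.
rewrite [h *: 1]mulr1.
have wr : 0 <= h + v <= r by apply/andP; split; rewrite /r; lra.
have w01 : 0 <= h + v < 1 by case/andP: wr => -> wr; rewrite (le_lt_trans wr).
rewrite !second_momentE ?(ltW v0)//.
have := Rcov_taylor r01 vr wr; rewrite addrK => hT.
have -> : Dcov v - h^-1 *: (Rcov (h + v) 0 - Rcov v 0) =
   - (h^-1 * (Rcov (h + v) 0 - Rcov v 0 - Dcov v * h)).
  by rewrite /GRing.scale/=; field.
rewrite normrN normrM normfV ler_pdivrMl ?normr_gt0// (le_trans hT)//.
rewrite -(real_normK (num_real h)) expr2 mulrCA ler_wpM2l// [leLHS]mulrC.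
by rewrite -ler_pdivlMr.
Unshelve. all: by end_near. Qed.

(** * Trace estimates for the covariance matrix of the sample *)

Section sample.
Variables (v CR : R).
Hypothesis v01 : 0 <= v < 1.
Hypothesis CR_gt0 : 0 < CR.
Hypothesis R_pw : forall k, Rcov v k <= CR * pw a `|k|%N.

Let v0 : 0 <= v. Proof. by case/andP: v01. Qed.
Let v1 : v < 1. Proof. by case/andP: v01. Qed.

(** Indices are shifted by one: entry (i, j) belongs to X_(i+1) and X_(j+1), which are sums of i+1
    and j+1 noise terms. *)
Definition covar (i j : nat) : R := cov v i.+1 j.+1 (j%:Z - i%:Z).

Let rr (k : nat) : R := Rcov v k%:Z.

Lemma covar_ge0 i j : 0 <= covar i j. Proof. exact: cov_ge0. Qed.

Lemma covar_diag_ge1 i : 1 <= covar i i.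
Proof. by rewrite /covar subrr cov_ge1. Qed.

Let Rdist (i j : nat) : Rcov v (j%:Z - i%:Z) = rr (dist i j).
Proof. by rewrite -Rcov_abs /rr /dist; congr (Rcov v (Posz _)); lia. Qed.

Let rr_ge0 (k : nat) : 0 <= rr k. Proof. exact: Rcov_ge0. Qed.
Let rr_pw (k : nat) : rr k <= CR * pw a k. Proof. exact: R_pw. Qed.

Lemma covar_le_R i j : covar i j <= rr (dist i j).
Proof. by rewrite -Rdist cov_le_Rcov. Qed.

Lemma covar_pw i j : covar i j <= CR * pw a (dist i j).
Proof. exact: le_trans (covar_le_R i j) (rr_pw _). Qed.

Lemma R_sub_covar i j : rr (dist i j) - covar i j <= (v ^+ i + v ^+ j) / (1 - v) ^+ 2.
Proof.
rewrite -Rdist; apply: (le_trans (Rcov_sub_cov _ _ _ v01)).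
rewrite ler_wpM2r ?invr_ge0 ?exprn_ge0 ?subr_ge0 ?(ltW v1)//.
by rewrite lerD// exprS ler_piMl ?exprn_ge0// ltW.
Qed.

(** Started at 0, the process falls short of the stationary variance by O(v^i) at time i, so the
    total bias stays bounded in n. *)
Lemma mean_bound n :
  0 <= n%:R * Rcov v 0 - \sum_(i < n) covar i i <= 2 / (1 - v) ^+ 3.
Proof.
have -> : n%:R * Rcov v 0 - \sum_(i < n) covar i i = \sum_(i < n) (rr (dist i i) - covar i i).
  rewrite sumrB; congr (_ - _).
  rewrite (eq_bigr (fun=> Rcov v 0)); last by move=> i _; rewrite /dist subnn.
  by rewrite sumr_const card_ord mulr_natl.
apply/andP; split; first by apply: sumr_ge0 => i _; rewrite subr_ge0 covar_le_R.
apply: (@le_trans _ _ (\sum_(i < n) 2 / (1 - v) ^+ 2 * v ^+ i)).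
  apply: ler_sum => i _; apply: (le_trans (R_sub_covar i i)).
  by rewrite le_eqVlt; apply/orP; left; apply/eqP; ring.
have -> : 2 / (1 - v) ^+ 3 = 2 / (1 - v) ^+ 2 * (1 - v)^-1.
  by rewrite (exprSr _ 2) invfM mulrA.
rewrite -mulr_sumr.
by rewrite ler_wpM2l ?geom_sum_le// divr_ge0// exprn_ge0// subr_ge0 ltW.
Qed.

Definition sumR2 (m : nat) : R := \sum_(k < m) rr k ^+ 2.

Definition sumR2_lim : R := limn sumR2.

Let sumR2_nd m n : (m <= n)%N -> sumR2 m <= sumR2 n.
Proof. by apply: (@sum_ord_le _ (fun k : nat => rr k ^+ 2)) => i; exact: sqr_ge0. Qed.

Let sumR2_tail m N : (0 < m)%N -> (m <= N)%N ->
  sumR2 N <= sumR2 m + CR ^+ 2 / (2 * a - 1) * m%:R `^ (1 - 2 * a).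
Proof.
have /andP[a2 a1] := a_range.
move=> m0 mN; rewrite /sumR2 -!(big_mkord predT (fun k : nat => rr k ^+ 2)).
rewrite [leLHS](@big_cat_nat _ _ _ m)//= lerD2l.
apply: (@le_trans _ _ (\sum_(m <= k < N) CR ^+ 2 * pw (2 * a) k)).
  apply: ler_sum => k _; rewrite -[2 * a]/(2%:R * a) mulr_natl mulr2n -pwM -expr2 -exprMn.
  by rewrite lerXn2r// nnegrE ?mulr_ge0 ?pw_ge0// ltW.
rewrite -mulr_sumr -mulrA ler_wpM2l ?sqr_ge0//; apply: sum_pw_tail => //; lra.
Qed.

Lemma sumR2_cvg : sumR2 @ \oo --> sumR2_lim.
Proof.
apply: nondecreasing_is_cvgn.
  by move=> m n mn; exact: sumR2_nd.
exists (sumR2 1 + CR ^+ 2 / (2 * a - 1) * 1%:R `^ (1 - 2 * a)) => _ [n _ <-].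
apply: le_trans (sumR2_tail (ltn0Sn 0) (leq_maxr n 1)).
by apply: sumR2_nd; exact: leq_maxl.
Qed.

Lemma sumR2_le m : sumR2 m <= sumR2_lim.
Proof.
apply: limr_ge; first by apply/cvg_ex; eexists; exact: sumR2_cvg.
near=> N; apply: sumR2_nd.
by near: N; exact: nbhs_infty_ge.
Unshelve. all: by end_near. Qed.

Lemma sumR2_lim_le m :
  sumR2_lim <= sumR2 m.+1 + CR ^+ 2 / (2 * a - 1) * pw (2 * a - 1) m.
Proof.
apply: limr_le; first by apply/cvg_ex; eexists; exact: sumR2_cvg.
near=> N; rewrite /pw opprB; apply: sumR2_tail => //.
by near: N; exact: nbhs_infty_ge.
Unshelve. all: by end_near. Qed.

(** This is sigma_H^2: doubling the sum over k >= 0 counts R(0)^2 twice. *)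
Definition asym_var : R := 2 * (2 * sumR2_lim - rr 0 ^+ 2).

Definition sample_var n : R := \sum_(i < n) \sum_(j < n) 2 * covar i j ^+ 2.

Definition sample_kap n : R :=
  \sum_(i < n) \sum_(j < n) (\sum_(k < n) covar i k * covar k j) ^+ 2.

Lemma sample_var_ge n : 2 * n%:R <= sample_var n.
Proof.
have -> : 2 * n%:R = \sum_(i < n) 2 :> R.
  by rewrite sumr_const card_ord mulr_natr.
apply: ler_sum => i _; rewrite (bigD1 i)//= -[leLHS]addr0; apply: lerD.
  rewrite ler_peMr// -[leLHS](expr1n _ 2) lerXn2r ?nnegrE ?covar_ge0//.
  exact: covar_diag_ge1.
by apply: sumr_ge0 => j _; rewrite mulr_ge0// sqr_ge0.
Qed.

Lemma asym_var_ge : 2 <= asym_var.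
Proof.
have := sumR2_le 1; rewrite /sumR2 big_ord1 /= /asym_var => h.
have : 1 <= rr 0 ^+ 2 by rewrite exprn_ege1// Rcov_ge1.
lra.
Qed.

(** The difference splits as A + B. A collects the tails of the sum of R^2 cut off in each row; they
    are of order i^(1-2a) and add up to n^(2-2a). B replaces R by the covariances of the process
    started at 0; its geometric weights reduce it to one row of R, of order n^(1-a), which is
    smaller. *)
Lemma sample_var_asym : exists2 C, 0 < C & forall n,
  `|n%:R * asym_var - sample_var n| <= C * n%:R `^ (2 - 2 * a).
Proof.
have /andP[a2 a1] := a_range.
pose Ct := CR ^+ 2 / (2 * a - 1).
have Ct0 : 0 < Ct by apply: divr_gt0; [exact: exprn_gt0 | lra].
pose K := 2 * CR / (1 - v) ^+ 2.
have w0 : 0 < 1 - v by rewrite subr_gt0.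
have K0 : 0 < K by rewrite divr_gt0 ?exprn_gt0// mulr_gt0.
pose C1 : R := 4 * Ct * (2 / (2 - 2 * a)).
pose C2 : R := 2 * (2 * K * ((1 - v)^-1 * (2 * (2 / (1 - a))))).
have C10 : 0 < C1 by rewrite !mulr_gt0// invr_gt0; lra.
have C20 : 0 < C2.
  by rewrite /C2; repeat (apply: mulr_gt0 => //); rewrite invr_gt0; lra.
exists (C1 + C2); first exact: addr_gt0.
move=> n.
have pn : n%:R `^ (1 - a) <= n%:R `^ (2 - 2 * a).
  case: (n) => [|m]; first by rewrite powR0 ?powR_ge0//; lra.
  by rewrite ler_powR ?ler1n//; lra.
(* A row splits at the diagonal into two one-sided sums that both contain the diagonal entry. *)
have row (i : 'I_n) : \sum_(j < n) rr (dist i j) ^+ 2 = sumR2 i.+1 + sumR2 (n - i) - rr 0 ^+ 2.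
  rewrite /sumR2; under eq_bigr do rewrite distC.
  rewrite (@sum_dist _ (fun k : nat => rr k ^+ 2))// -!(big_mkord predT (fun k : nat => rr k ^+ 2)).
  rewrite -addrA; congr (_ + _); rewrite [X in _ = X - _]big_ltn ?subn_gt0//.
  by rewrite addrC addKr.
pose A := \sum_(i < n) (2 * (sumR2_lim - sumR2 i.+1) + 2 * (sumR2_lim - sumR2 (n - i))).
pose B := \sum_(i < n) \sum_(j < n) 2 * (rr (dist i j) ^+ 2 - covar i j ^+ 2).
have -> : n%:R * asym_var - sample_var n = A + B.
  rewrite /sample_var /A /B -[in n%:R * _](card_ord n) -sum1_card natr_sum mulr_suml.
  rewrite -sumrB -big_split/=; apply: eq_bigr => i _.
  rewrite mul1r -[in RHS]mulr_sumr sumrB row -mulr_sumr /asym_var; ring.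
have A0 : 0 <= A.
  by apply: sumr_ge0 => i _; rewrite addr_ge0// mulr_ge0// subr_ge0 sumR2_le.
have B0 : 0 <= B.
  do 2!(apply: sumr_ge0 => ? _); rewrite mulr_ge0// subr_ge0 lerXn2r ?nnegrE ?covar_ge0//.
  exact: covar_le_R.
rewrite ger0_norm ?addr_ge0// mulrDl; apply: lerD.
  apply: (@le_trans _ _ (\sum_(i < n) (2 * (Ct * pw (2 * a - 1) i) +
      2 * (Ct * pw (2 * a - 1) (rev_ord i))))).
    apply: ler_sum => i _; apply: lerD; rewrite ler_pM2l// lerBlDl.
      exact: sumR2_lim_le.
    by have := sumR2_lim_le (rev_ord i); rewrite /= subnSK.
  rewrite big_split/= [X in _ + X](reindex_inj rev_ord_inj)/=.
  rewrite [X in _ + X](eq_bigr (fun j : 'I_n => 2 * (Ct * pw (2 * a - 1) j))); last first.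
    by move=> j _; rewrite rev_ord2.
  rewrite -!mulr_sumr.
  have := @sum_pw_lt1 R (2 * a - 1) n.
  have -> : 1 - (2 * a - 1) = 2 - 2 * a by ring.
  have h : 0 < 2 * a - 1 < 1 by apply/andP; split; lra.
  move=> /(_ h) => {}h; rewrite /C1.
  by have := ler_wpM2l (ltW Ct0) h; lra.
pose W := \sum_(k < n) pw a k.
have W0 : 0 <= W by apply: sumr_ge0 => k _; rewrite pw_ge0.
have dsum (i : 'I_n) : \sum_(j < n) pw a (dist i j) <= 2 * W.
  under eq_bigr do rewrite distC.
  by apply: sum_dist_le => // j; exact: pw_ge0.
pose G := \sum_(i < n) v ^+ i * \sum_(j < n) pw a (dist i j).
have GE : G <= (1 - v)^-1 * (2 * W).
  apply: (@le_trans _ _ (\sum_(i < n) v ^+ i * (2 * W))).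
    by apply: ler_sum => i _; rewrite ler_wpM2l ?exprn_ge0.
  by rewrite -mulr_suml ler_wpM2r ?geom_sum_le// mulr_ge0.
apply: (@le_trans _ _ (2 * (K * G + K * G))).
  rewrite /B; under eq_bigr do rewrite -mulr_sumr.
  rewrite -mulr_sumr ler_pM2l//.
  have G2 : G = \sum_(i < n) \sum_(j < n) v ^+ j * pw a (dist i j).
    rewrite exchange_big; apply: eq_bigr => i _; rewrite mulr_sumr.
    by apply: eq_bigr => j _; rewrite distC.
  rewrite {2}G2 /G !mulr_sumr -big_split; apply: ler_sum => i _.
  rewrite !mulr_sumr -big_split; apply: ler_sum => j _ /=.
  have h1 := R_sub_covar i j; have h2 := covar_le_R i j; have h3 := covar_ge0 i j.
  have h4 := rr_pw (dist i j).
  set x := rr _ in h1 h2 h4 *; set y := covar i j in h1 h2 h3 *; set p := pw a _ in h4 *.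
  apply: (@le_trans _ _ (2 * (CR * p) * ((v ^+ i + v ^+ j) / (1 - v) ^+ 2))).
    have xy1 : 0 <= x - y by rewrite subr_ge0.
    have xy2 : 0 <= x + y by rewrite addr_ge0// (le_trans h3).
    by rewrite subr_sqr mulrC ler_pM//; lra.
  by rewrite /K le_eqVlt; apply/orP; left; apply/eqP; ring.
have Wn : W <= 2 / (1 - a) * n%:R `^ (2 - 2 * a).
  apply: (le_trans (@sum_pw_lt1 R a n _)); first by apply/andP; split; lra.
  by rewrite ler_wpM2l// divr_ge0//; lra.
have h1 := ler_wpM2l (ltW K0) GE.
have c0 : 0 <= 8 * (K * (1 - v)^-1) by rewrite mulr_ge0// mulr_ge0 ?invr_ge0 ?ltW.
have h2 := ler_wpM2l c0 Wn.
rewrite /C2; clearbody K; move: h1 h2; rewrite !mulrA; lra.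
Qed.

(** By [conv_pw] the entries of S^2 decay with exponent 2a - 1, their squares with exponent 4a - 2;
    each of the n row sums is then of order n^(max(0, 3-4a) + dl). *)
Lemma sample_kap_le dl : 0 < dl < 1 -> exists2 C, 0 < C & forall n,
  sample_kap n <= C * (n%:R * n%:R `^ (Num.max 0 (3 - 4 * a) + dl)).
Proof.
move=> dl01; have /andP[d0 d1] := dl01.
have [C1 C10 conv] := conv_pw a_range.
exists ((CR ^+ 2 * C1) ^+ 2 * (2 * (2 / dl))).
  by rewrite !mulr_gt0 ?invr_gt0 ?exprn_gt0// mulr_gt0// exprn_gt0.
have c2 : 0 <= CR ^+ 2 * C1 := mulr_ge0 (sqr_ge0 CR) (ltW C10).
move=> n; pose W := \sum_(k < n) pw (4 * a - 2) k.
apply: (@le_trans _ _ (\sum_(i < n) \sum_(j < n)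
    (CR ^+ 2 * C1) ^+ 2 * pw (4 * a - 2) (dist i j))).
  apply: ler_sum => i _; apply: ler_sum => j _.
  have -> : 4 * a - 2 = (2 * a - 1) + (2 * a - 1) by ring.
  have s0 : 0 <= \sum_(k < n) covar i k * covar k j.
    by apply: sumr_ge0 => k _; rewrite mulr_ge0 ?covar_ge0.
  rewrite -pwM -expr2 -exprMn lerXn2r ?nnegrE ?(mulr_ge0 c2) ?pw_ge0//.
  rewrite -mulrA; apply: le_trans (ler_wpM2l (sqr_ge0 CR) (conv n i j)).
  rewrite mulr_sumr; apply: ler_sum => k _.
  rewrite expr2 mulrACA ler_pM ?covar_ge0 ?covar_pw//.
under eq_bigr do rewrite -mulr_sumr.
rewrite -mulr_sumr -[leRHS]mulrA ler_wpM2l ?sqr_ge0//.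
apply: (@le_trans _ _ (\sum_(i < n) 2 * W)).
  apply: ler_sum => i _; under eq_bigr do rewrite distC.
  by apply: sum_dist_le => // j; exact: pw_ge0.
have -> : \sum_(i < n) 2 * W = 2 * (n%:R * W).
  by rewrite sumr_const card_ord -[LHS]mulr_natl mulrCA.
rewrite -[leRHS]mulrA ler_pM2l// [leRHS]mulrCA ler_wpM2l//.
have := @sum_pw_le R (4 * a - 2) dl n dl01.
by have -> : 1 - (4 * a - 2) = 3 - 4 * a by ring.
Qed.

End sample.
End covariance.

(** * The Gaussian autoregression and its stationary solution *)

Section pointwise_limit.
Context (R : realType) d (T : measurableType d).

(* [limn] takes a fixed junk value where the sequence diverges, so the limit is
   measurable once the convergence set is. *)
Lemma measurable_limn (h : nat -> T -> R) : (forall n, measurable_fun setT (h n)) ->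
  measurable_fun setT (fun w => limn (fun n => h n w)).
Proof.
move=> mh.
pose C := [set w | cvgn (fun n => h n w)].
have mC : measurable C.
  (* By completeness, convergence is the Cauchy condition, which involves countably many measurable
     conditions. *)
  have -> : C = \bigcap_k \bigcup_N \bigcap_n \bigcap_m
      [set w | `|h (N + n)%N w - h (N + m)%N w| <= k.+1%:R^-1].
    apply/seteqP; split=> w /=.
      move=> cw k _.
      have k0 : 0 < k.+1%:R^-1 / 2 :> R by rewrite divr_gt0.
      have /cvgrPdist_lt/(_ _ k0)[N _ hN] := cw.
      exists N => // n _ m _ /=.
      have h1 := hN (N + n)%N (leq_addr _ _); have h2 := hN (N + m)%N (leq_addr _ _).
      rewrite -(subrK (limn (fun n => h n w)) (h (N + n)%N w)) -addrA.
      rewrite (le_trans (ler_normD _ _))// distrC [leRHS]splitr ltW// ltrD//.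
    move=> hw; apply/cauchy_cvgP/cauchy_ballP => e e0.
    have [k ke] : exists k, k.+1%:R^-1 < e :> R.
      exists (Num.truncn e^-1); rewrite invf_plt ?posrE//.
      by rewrite truncnS_gt.
    have [N _ hN] := hw k I.
    have bN : (\oo [set m | (N <= m)%N])%classic by exists N.
    exists ((fun n => h n w) @` [set m | (N <= m)%N], (fun n => h n w) @` [set m | (N <= m)%N]).
      by split; exists N => // m /= Nm; exists m.
    move=> [x y] /= [[n /= Nn <-] [m /= Nm <-]].
    rewrite /ball/=; apply: le_lt_trans ke.
    by have := hN (n - N)%N I (m - N)%N I; rewrite /= !subnKC.
  apply: bigcapT_measurable => k; apply: bigcupT_measurable => N.
  apply: bigcapT_measurable => n; apply: bigcapT_measurable => m.
  rewrite -[X in measurable X]setTI; apply: measurable_fun_le => //.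
  by apply: measurableT_comp => //; exact: measurable_funB.
pose h' n w := if w \in C then h n w else point.
have mh' n : measurable_fun setT (h' n).
  apply: measurable_fun_ifT => //.
  apply: (@measurable_fun_bool _ _ _ _ true); rewrite setTI.
  rewrite (_ : _ @^-1` _ = C)//.
  by apply/seteqP; split => w /= => [/set_mem|/mem_set].
apply: (@measurable_fun_cvg _ _ _ setT h') => // w _.
have [wC|wC] := boolP (w \in C); first by rewrite /h' wC; exact: set_mem wC.
rewrite /h' (negbTE wC) (_ : limn _ = point); first exact: cvg_cst.
rewrite /lim/lim_in; apply: xgetPN => l cl; move/negP: wC; apply; apply/mem_set.
by apply/cvg_ex; exists l.
Qed.

End pointwise_limit.

Section same_law.
Context (R : realType) d (T : measurableType d) (P : probability T R).

Lemma same_law_Rintegral (V W : T -> R) :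
  measurable_fun setT V -> measurable_fun setT W ->
  (forall A : set (measurableTypeR R), measurable A -> P (V @^-1` A) = P (W @^-1` A)) ->
  integ P W -> \int[P]_w V w = \int[P]_w W w.
Proof.
move=> mV mW VW iW.
pose W' : {RV P >-> measurableTypeR R} := @mfun_Sub _ _ T (measurableTypeR R) W (mem_set mW).
have mid : measurable_fun setT (@id R) by exact: measurable_id.
have iid : integ (distribution P W') (@id R).
  apply: integrable_pushforward => //; exact/measurable_EFinP.
have [_ ->] := @law_transfer _ _ _ P (distribution P W') V id mV VW mid iid.
by have [_ ->] := @law_transfer _ _ _ P (distribution P W') W id mW (fun _ _ => erefl) mid iid.
Qed.

End same_law.

(** * The process as a linear image of the noise *)

Section model.
Context (R : realType) d (T : measurableType d) (P : probability T R).
Context (xi : int -> {RV P >-> R}) (rho : int -> R) (theta : R).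
Hypothesis xi_gaussian : gaussian_seq xi.
Hypothesis xi_stationary : stationary_seq xi.
Hypothesis xi_centered : forall t : int, ('E_P[xi t] = 0)%E.
Hypothesis xi_cov : forall k : int, ('E_P[xi 0%R \* xi k] = (rho k)%:E)%E.
Hypothesis theta01 : 0 <= theta < 1.

Let theta_ge0 : 0 <= theta. Proof. by case/andP: theta01. Qed.

Lemma measurable_xi t : measurable_fun setT (xi t).
Proof. exact: measurable_funP. Qed.
Hint Resolve measurable_xi : core.

Lemma E_xi t : \int[P]_w xi t w = 0.
Proof. by rewrite /Rintegral; have := xi_centered t; rewrite unlock => ->. Qed.

Lemma integ_xixi s t : integ P (fun w => xi s w * xi t w).
Proof.
pose tt (i : 'I_2) := if i == 0 then s else t.
exact: (@integ_XX _ _ _ P 2 (fun i => xi (tt i)) (fun i => measurable_xi (tt i))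
  (@xi_gaussian 2 tt) (fun i => E_xi (tt i)) 0 1).
Qed.

Lemma integ_xi t : integ P (xi t).
Proof.
have := @polybnd_integ _ _ _ P 1 (fun=> xi t) (fun=> measurable_xi t)
  (@xi_gaussian 1 (fun=> t)) (fun=> E_xi t) 1 (xi t) isT.
by apply; exact: (@polybnd_X _ _ _ 1 (fun=> xi t) (fun=> measurable_xi t) 0).
Qed.

(** Stationarity compares laws of tuples; pulled back along the product map, it says that the
    products at times (s, t) and (0, t - s) have the same law, hence the same expectation. *)
Lemma E_xixi s t : \int[P]_w (xi s w * xi t w) = rho (t - s).
Proof.
have -> : rho (t - s) = \int[P]_w (xi 0 w * xi (t - s) w).
  by rewrite /Rintegral; have := xi_cov (t - s); rewrite unlock => ->.
apply: same_law_Rintegral; last exact: integ_xixi.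
- exact: measurable_funM.
- exact: measurable_funM.
move=> A mA.
pose g (u : 2.-tuple (measurableTypeR R)) : measurableTypeR R := (tnth u 0 : R) * tnth u 1.
have mg : measurable_fun setT g.
  apply: (@measurable_funM _ _ R setT (fun u => tnth u 0) (fun u => tnth u 1)); exact: measurable_tnth.
pose tt (i : 'I_2) : int := if i == 0 then 0 else t - s.
have mgA : measurable (g @^-1` A) by rewrite -[_ @^-1` _]setTI; exact: mg.
have := @xi_stationary 2 tt s _ mgA.
rewrite (_ : [set w | _] = (fun w => xi s w * xi t w) @^-1` A); last first.
  by apply/seteqP; split => w /=; rewrite /g !tnth_mktuple /tt/= add0r subrK.
by move=> ->; congr (P _); apply/seteqP; split => w /=; rewrite /g !tnth_mktuple /tt.
Qed.

Lemma rhoN k : rho (- k) = rho k.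
Proof.
have := E_xixi 0 k; rewrite subr0 => <-.
have := E_xixi k 0; rewrite sub0r => <-.
by congr fine; apply: eq_integral => w _; rewrite mulrC.
Qed.

Lemma rho_le1 k : rho 0 = 1 -> rho k <= 1.
Proof.
move=> rho0.
have h0 : 0 <= \int[P]_w ((xi 0 w - xi k w) ^+ 2).
  by apply: Rintegral_ge0 => w _; exact: sqr_ge0.
move: h0.
rewrite (_ : (fun w => _) = fun w => (xi 0 w * xi 0 w + xi k w * xi k w) - 2 * (xi 0 w * xi k w));
  last by apply/funext => w; ring.
have i1 := integ_xixi 0 0; have i2 := integ_xixi k k; have i3 := integ_xixi 0 k.
rewrite RintegralB//; [|exact: integD|exact: integZ].
rewrite RintegralD// (RintegralZl _ measurableT i3)//.
rewrite !E_xixi !subrr subr0 rho0; lra.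
Qed.

Lemma ar_sum t w : ar_process xi theta t w = \sum_(p < t) theta ^+ p * xi (t%:Z - p%:Z) w.
Proof.
elim: t => [|t IH]; first by rewrite big_ord0.
rewrite /= IH big_ord_recl expr0 mul1r subr0 addrC; congr (_ + _).
rewrite mulr_sumr; apply: eq_bigr => p _.
by rewrite lift0 mulrA -exprS; congr (_ * xi _ w); lia.
Qed.

(** Coefficient of the noise at time s+1 in X_(t+1), zero for s > t. All X_1, ..., X_n become
    combinations of the same n noise variables, so a combination of them is one of the noise. *)
Fixpoint ar_coef (t s : nat) : R :=
  if t is t'.+1 then theta * ar_coef t' s + (s == t'.+1)%:R else (s == 0%N)%:R.

Lemma ar_lin n t w : (t < n)%N ->
  ar_process xi theta t.+1 w = \sum_(s < n) ar_coef t s * xi s.+1%:Z w.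
Proof.
elim: t => [|t IH] tn.
  rewrite /= mulr0 add0r (bigD1 (Ordinal tn))//= mul1r big1 ?addr0// => s.
  by rewrite -val_eqE/= => /negbTE ->; rewrite mul0r.
rewrite [LHS]/= -/(ar_process xi theta t.+1 w) IH ?(ltnW tn)//=.
under [RHS]eq_bigr do rewrite mulrDl -mulrA.
rewrite big_split/= mulr_sumr; congr (_ + _).
rewrite (bigD1 (Ordinal tn))//= eqxx mul1r big1 ?addr0// => s.
by rewrite -val_eqE/= => /negbTE ->; rewrite mul0r.
Qed.

Lemma measurable_ar t : measurable_fun setT (ar_process xi theta t).
Proof.
rewrite (_ : ar_process _ _ _ = fun w => \sum_(p < t) theta ^+ p * xi (t%:Z - p%:Z) w).
  by apply: measurable_sum => p; exact: measurable_funM.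
by apply/funext => w; exact: ar_sum.
Qed.

Lemma gaussian_ar n (a : 'I_n -> R) : gaussian_law
  (fun A => P ((fun w => \sum_(i < n) a i * ar_process xi theta i.+1 w) @^-1` A)).
Proof.
rewrite (_ : (fun w => _) = fun w => \sum_(s < n) (\sum_(i < n) a i * ar_coef i s) * xi s.+1%:Z w).
  exact: (@xi_gaussian n (fun s => s.+1%:Z)).
apply/funext => w; under eq_bigr do rewrite (ar_lin w (ltn_ord _)) mulr_sumr.
rewrite exchange_big; apply: eq_bigr => s _; rewrite mulr_suml.
by apply: eq_bigr => i _; rewrite mulrA.
Qed.

Lemma E_ar t : \int[P]_w ar_process xi theta t w = 0.
Proof.
rewrite (_ : (fun w => _) = fun w => \sum_(p < t) theta ^+ p * xi (t%:Z - p%:Z) w).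
  rewrite Rint_sum; last by move=> p; apply: integZ; exact: integ_xi.
  rewrite big1// => p _; have := integ_xi (t%:Z - p%:Z) => ix.
  by rewrite (RintegralZl _ measurableT ix) E_xi mulr0.
by apply/funext => w; exact: ar_sum.
Qed.

Lemma E_sum_xi t u (s s' : int) :
  \int[P]_w ((\sum_(i < t) theta ^+ i * xi (s - i%:Z) w) *
             (\sum_(j < u) theta ^+ j * xi (s' - j%:Z) w)) = cov rho theta t u (s' - s).
Proof.
have ixx i j : integ P (fun w => theta ^+ (i + j) * (xi (s - i%:Z) w * xi (s' - j%:Z) w)).
  by apply: integZ; exact: integ_xixi.
rewrite (_ : (fun w => _) = fun w => \sum_(i < t) \sum_(j < u)
    theta ^+ (i + j) * (xi (s - i%:Z) w * xi (s' - j%:Z) w)).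
  rewrite Rint_sum; last by move=> i; apply: integ_sum => j; exact: ixx.
  apply: eq_bigr => i _; rewrite Rint_sum; last by move=> j; exact: ixx.
  apply: eq_bigr => j _; have := integ_xixi (s - i%:Z) (s' - j%:Z) => ix.
  by rewrite (RintegralZl _ measurableT ix) E_xixi; congr (_ * rho _); ring.
apply/funext => w; rewrite big_distrlr/=; apply: eq_bigr => i _; apply: eq_bigr => j _.
by rewrite exprD; ring.
Qed.

Lemma E_ar_ar (i j : nat) :
  \int[P]_w (ar_process xi theta i.+1 w * ar_process xi theta j.+1 w) = covar rho theta i j.
Proof.
rewrite (_ : covar _ _ _ _ = cov rho theta i.+1 j.+1 (j.+1%:Z - i.+1%:Z)).
  rewrite -E_sum_xi; congr fine; apply: eq_integral => w _.
  by rewrite !ar_sum.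
by rewrite /covar; congr (cov _ _ _ _ _); lia.
Qed.

(** * The stationary solution and its covariances *)

Section solution.
Hypothesis rho_ge0 : forall k, 0 <= rho k.
Hypothesis rho0 : rho 0 = 1.

Let partial t N w := \sum_(j < N) theta ^+ j * xi (t - j%:Z) w.

Let partialE t w : series (fun j : nat => theta ^+ j * xi (t - j%:Z) w) = (partial t)^~ w.
Proof. by apply/funext => N; rewrite /series/= big_mkord. Qed.

Let measurable_partial t N : measurable_fun setT (partial t N).
Proof. by apply: measurable_sum => j; exact: measurable_funM. Qed.

Let measurable_solution t : measurable_fun setT (stationary_solution xi theta t).
Proof.
have := measurable_limn (measurable_partial t).
congr (measurable_fun _ _); apply/funext => w; rewrite /stationary_solution.
by rewrite partialE.
Qed.

(** Cauchy-Schwarz for the weights theta^j. Unlike the left side, the right side increases with N,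
    so its limit is a majorant for all N. *)
Let sq_partial t N w :
  partial t N w ^+ 2 <= (1 - theta)^-1 * \sum_(j < N) theta ^+ j * xi (t - j%:Z) w ^+ 2.
Proof.
pose x j := xi (t - j%:Z) w.
have s0 : 0 <= \sum_(j < N) theta ^+ j * x j ^+ 2.
  by apply: sumr_ge0 => j _; exact: mulr_ge0 (exprn_ge0 _ theta_ge0) (sqr_ge0 _).
apply: le_trans (ler_wpM2r s0 (geom_sum_le N theta01)).
rewrite expr2 /partial !big_distrlr/=.
have half : \sum_(i < N) \sum_(j < N) theta ^+ i * (theta ^+ j * x j ^+ 2) =
   \sum_(i < N) \sum_(j < N) theta ^+ i * theta ^+ j * ((x i ^+ 2 + x j ^+ 2) / 2).
  under [RHS]eq_bigr do under eq_bigr do rewrite mulrA mulrDr mulrDl.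
  under [RHS]eq_bigr do rewrite big_split/=.
  rewrite [RHS]big_split/= [X in _ = X + _]exchange_big -big_split/=.
  apply: eq_bigr => i _; rewrite -big_split; apply: eq_bigr => j _ /=.
  by field.
rewrite half; apply: ler_sum => i _; apply: ler_sum => j _.
rewrite mulrACA ler_wpM2l ?mulr_ge0 ?exprn_ge0//.
by have := sqr_ge0 (x i - x j); rewrite /x; nra.
Qed.

(** Terms of a series that dominates the products of partial sums at times 0 and k: [sq_partial] at
    both times, combined by |xy| <= (x^2 + y^2)/2. *)
Let bnd (k : int) (j : nat) (w : T) : \bar R :=
  ((1 - theta)^-1 / 2 * (theta ^+ j * (xi (0 - j%:Z) w ^+ 2 + xi (k - j%:Z) w ^+ 2)))%:E.

Let bnd_ge0 k j w : (0 <= bnd k j w)%E.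
Proof.
rewrite lee_fin !mulr_ge0 ?exprn_ge0 ?addr_ge0 ?sqr_ge0// invr_ge0 subr_ge0.
by case/andP: theta01 => _ /ltW.
Qed.

Let bnd_sum k N w : (\sum_(0 <= j < N) bnd k j w)%E = ((1 - theta)^-1 / 2 *
  ((\sum_(j < N) theta ^+ j * xi (0 - j%:Z) w ^+ 2) + \sum_(j < N) theta ^+ j * xi (k - j%:Z) w ^+ 2))%:E.
Proof.
rewrite big_mkord sumEFin -big_split/= mulr_sumr; congr EFin.
by apply: eq_bigr => j _; rewrite mulrDr.
Qed.

Let measurable_bnd k j : measurable_fun setT (bnd k j).
Proof.
apply/measurable_EFinP; apply: measurable_funM => //; apply: measurable_funM => //.
by apply: measurable_funD; exact: measurable_funX.
Qed.

Let integrable_bnd k : P.-integrable setT (fun w => \sum_(j <oo) bnd k j w)%E.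
Proof.
have mS : measurable_fun setT (fun w => \sum_(j <oo) bnd k j w)%E.
  by apply: ge0_emeasurable_sum => // j w _ _; exact: bnd_ge0.
apply/integrableP; split => //.
under eq_integral do rewrite gee0_abs ?nneseries_ge0//.
rewrite integral_nneseries//.
have term j : (\int[P]_w bnd k j w = ((1 - theta)^-1 * theta ^+ j)%:E)%E.
  have i1 := integ_xixi (0 - j%:Z) (0 - j%:Z).
  have i2 := integ_xixi (k - j%:Z) (k - j%:Z).
  have i12 : integ P (fun w => xi (0 - j%:Z) w ^+ 2 + xi (k - j%:Z) w ^+ 2).
    by apply: integD; [have := i1 | have := i2]; congr (integ _ _).
  have iB : integ P (fun w => (1 - theta)^-1 / 2 * (theta ^+ j * (xi (0 - j%:Z) w ^+ 2 + xi (k - j%:Z) w ^+ 2))).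
    by do 2 apply: integZ.
  rewrite -[LHS]fineK; last exact: integrable_fin_num.
  congr EFin; rewrite -/(Rintegral _ _ _).
  have iB' := integZ (theta ^+ j) i12.
  rewrite (RintegralZl _ measurableT iB') (RintegralZl _ measurableT i12).
  have i1' : integ P (fun w => xi (0 - j%:Z) w ^+ 2) by have := i1; congr (integ _ _).
  have i2' : integ P (fun w => xi (k - j%:Z) w ^+ 2) by have := i2; congr (integ _ _).
  rewrite (RintegralD measurableT i1' i2').
  have E1 t : \int[P]_w (xi t w ^+ 2) = 1.
    by have := E_xixi t t; rewrite subrr rho0.
  rewrite !E1; field; rewrite subr_eq0 gt_eqF//; by case/andP: theta01.
apply: (@le_lt_trans _ _ ((1 - theta)^-1 * (1 - theta)^-1)%:E); last exact: ltry.
apply: lime_le; first by apply: is_cvg_nneseries => n _ _; exact: integral_ge0.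
near=> N; under eq_bigr do rewrite term.
rewrite big_mkord sumEFin lee_fin -mulr_sumr ler_wpM2l ?geom_sum_le//.
by rewrite invr_ge0 subr_ge0; case/andP: theta01 => _ /ltW.
Unshelve. all: by end_near. Qed.

(** Absolute convergence follows from |x| <= 1 + x^2, the constant being summed by the geometric
    weights. *)
Let partial_cvg t w M :
  (forall N, \sum_(j < N) theta ^+ j * xi (t - j%:Z) w ^+ 2 <= M) ->
  (fun N => partial t N w) @ \oo --> stationary_solution xi theta t w.
Proof.
move=> hM.
suff cv : cvgn (series (fun j : nat => theta ^+ j * xi (t - j%:Z) w)).
  by move: cv; rewrite /stationary_solution partialE.
apply: normed_cvg; apply: nondecreasing_is_cvgn.
  by apply/nondecreasing_seqP => n; rewrite /normed_series_of /series/= big_nat_recr//= lerDl.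
exists ((1 - theta)^-1 + M) => _ [N _ <-]; rewrite /normed_series_of /series/= big_mkord.
apply: le_trans (lerD (geom_sum_le N theta01) (hM N)).
rewrite -big_split; apply: ler_sum => j _ /=.
rewrite normrM (ger0_norm (exprn_ge0 j theta_ge0)) -[X in _ <= X + _]mulr1 -mulrDr ler_wpM2l ?exprn_ge0//.
rewrite -real_normK ?num_real//; have := sqr_ge0 (`|xi (t - j%:Z) w| - 1).
have := sqr_ge0 `|xi (t - j%:Z) w|; nra.
Qed.

(** The majorant is integrable, hence finite almost surely, and where it is finite both partial sums
    converge. The conventional value of a divergent limit thus occurs only on a null set, and
    dominated convergence applies. *)
Lemma solution_covE k : solution_cov xi theta k = Rcov rho theta k.
Proof.
rewrite /solution_cov unlock.
pose f_ N w : \bar R := (partial 0 N w * partial k N w)%:E.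
pose f w : \bar R := (stationary_solution xi theta 0 w * stationary_solution xi theta k w)%:E.
have w0 : 0 < 1 - theta by rewrite subr_gt0; case/andP: theta01.
have sums0 t N w : 0 <= \sum_(j < N) theta ^+ j * xi (t - j%:Z) w ^+ 2.
  by apply: sumr_ge0 => j _; exact: mulr_ge0 (exprn_ge0 _ theta_ge0) (sqr_ge0 _).
have mf_ N : measurable_fun setT (f_ N).
  by apply/measurable_EFinP; exact: measurable_funM.
have mf : measurable_fun setT f.
  by apply/measurable_EFinP; apply: measurable_funM; exact: measurable_solution.
have ig := integrable_bnd k.
have f_le N w : (`|f_ N w| <= \sum_(j <oo) bnd k j w)%E.
  apply: le_trans (nneseries_lim_ge N (fun n _ _ => bnd_ge0 k n w)).
  rewrite bnd_sum lee_fin.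
  have := sq_partial 0 N w; have := sq_partial k N w.
  move: (sums0 0 N w) (sums0 k N w).
  set A := \sum_(j < N) theta ^+ j * xi (0 - _) w ^+ 2.
  set B := \sum_(j < N) theta ^+ j * xi (k - _) w ^+ 2.
  set x := partial 0 N w; set y := partial k N w; set q := (1 - theta)^-1 => A0 B0 hy hx.
  have h : `|x * y| <= (x ^+ 2 + y ^+ 2) / 2.
    rewrite ler_norml; apply/andP; split.
      by have := sqr_ge0 (x + y); nra.
    by have := sqr_ge0 (x - y); nra.
  by rewrite (le_trans h)//; lra.
have f_g : {ae P, forall w N, setT w -> (`|f_ N w| <= \sum_(j <oo) bnd k j w)%E}.
  by apply: aeW => w N _.
have f_f : {ae P, forall w, setT w -> f_ ^~ w @ \oo --> f w}.
  apply: filterS (integrable_ae measurableT ig) => w /(_ I) fin _.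
  pose G := fine (\sum_(j <oo) bnd k j w)%E.
  have hN N : (1 - theta)^-1 / 2 * ((\sum_(j < N) theta ^+ j * xi (0 - j%:Z) w ^+ 2)
      + \sum_(j < N) theta ^+ j * xi (k - j%:Z) w ^+ 2) <= G.
    by rewrite -lee_fin /G fineK// -bnd_sum nneseries_lim_ge.
  have hN' N : ((\sum_(j < N) theta ^+ j * xi (0 - j%:Z) w ^+ 2)
      + \sum_(j < N) theta ^+ j * xi (k - j%:Z) w ^+ 2) <= 2 * (1 - theta) * G.
    have := ler_wpM2l (_ : 0 <= 2 * (1 - theta)) (hN N); rewrite mulr_ge0 ?(ltW w0)// => /(_ isT).
    rewrite mulrA (_ : 2 * (1 - theta) * ((1 - theta)^-1 / 2) = 1) ?mul1r//.
    by field; rewrite subr_eq0 gt_eqF// -subr_gt0.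
  apply: cvg_EFin; first exact: nearW.
  apply: cvgM.
    apply: (@partial_cvg _ _ (2 * (1 - theta) * G)) => N.
    by apply: le_trans (hN' N); rewrite lerDl.
  apply: (@partial_cvg _ _ (2 * (1 - theta) * G)) => N.
  by apply: le_trans (hN' N); rewrite lerDr.
have [iF _ cv] := dominated_convergence measurableT mf_ mf f_f ig f_g.
have e N : (\int[P]_w f_ N w)%E = (cov rho theta N N k)%:E.
  rewrite -[k in RHS]subr0 -E_sum_xi /Rintegral fineK//.
  apply: integrable_fin_num => //.
  by apply: (le_integrable measurableT (mf_ N) _ ig) => w _; rewrite [leRHS]gee0_abs ?nneseries_ge0.
have -> : (\int[P]_w (((stationary_solution xi theta 0 \* stationary_solution xi theta k) w)%:E))%E
    = (Rcov rho theta k)%:E; last by [].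
apply: (cvg_unique _ cv) => //.
rewrite (_ : (fun N => _) = fun N => (cov rho theta N N k)%:E); last by apply/funext => N; rewrite e.
apply: cvg_EFin; first exact: nearW.
by apply: cov_cvg => // j; exact: rho_le1.
Qed.

Lemma sigmaHE : cvgn (sumR2 rho theta) -> sigmaH xi theta = Num.sqrt (asym_var rho theta).
Proof.
move=> cv; rewrite /sigmaH; congr (Num.sqrt _); rewrite /asym_var; congr (2 * _).
pose F (k : int) : \bar R := ((solution_cov xi theta k) ^+ 2)%:E.
have F0 k : (0 <= F k)%E by rewrite lee_fin sqr_ge0.
have -> : \esum_(k in [set: int]) ((solution_cov xi theta k) ^+ 2)%:E =
  (\sum_(k <oo) F (Posz k) + \sum_(k <oo) F (Negz k))%E.
  rewrite (esumID [set k : int | 0 <= k]); last by move=> k _; exact: F0.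
  congr (_ + _)%E.
    rewrite setTI nneseries_esumT// -(esum_image setT Posz)//; last by move=> x y _ _ [].
    congr esum; apply/seteqP; split => [[k|k]//= _|_ [k _ <-]//]; by exists k.
  rewrite setTI nneseries_esumT// -(esum_image setT Negz)//; last by move=> x y _ _ [].
  by congr esum; apply/seteqP; split => [[k|k]//= _|_ [k _ <-]//]; exists k.
have -> : (\sum_(k <oo) F (Posz k))%E = (sumR2_lim rho theta)%:E.
  rewrite /sumR2_lim -EFin_lim//; congr (limn _); apply/funext => N.
  rewrite big_mkord /sumR2/= -sumEFin; apply: eq_bigr => k _.
  by rewrite /F solution_covE.
(* [Negz k] is -(k+1), so the negative half is the one-sided sum without its term at 0. *)
have -> : (\sum_(k <oo) F (Negz k))%E = (sumR2_lim rho theta - Rcov rho theta 0 ^+ 2)%:E.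
  apply: cvg_lim => //.
  have -> : (fun N => \sum_(0 <= k < N) F (Negz k))%E =
      (fun N => (sumR2 rho theta N.+1 - Rcov rho theta 0 ^+ 2)%:E).
    apply/funext => N; rewrite big_mkord /sumR2 big_ord_recl/= addrAC subrr add0r -sumEFin.
    by apply: eq_bigr => k _; rewrite /F solution_covE NegzE RcovN//; exact: rhoN.
  apply: cvg_EFin; first exact: nearW.
  apply: cvgB; last exact: cvg_cst.
  by rewrite (cvg_shiftS (sumR2 rho theta)); exact: cv.
by rewrite -EFinD/=; ring.
Qed.

End solution.

End model.

(** * Transfer to the estimator *)

Section normal_shift.
Context (R : realType).
Implicit Types (z : R).

Lemma weight_le1 z : `|z| / (1 + z ^+ 2 / 8) <= 2.
Proof.
have d0 : 0 < 1 + z ^+ 2 / 8 by rewrite ltr_pwDl// divr_ge0// sqr_ge0.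
rewrite ler_pdivrMr// -(real_normK (num_real z)); have := sqr_ge0 (`|z| - 2); nra.
Qed.

Lemma weight_le2 z : z ^+ 2 / (1 + z ^+ 2 / 8) <= 8.
Proof.
have d0 : 0 < 1 + z ^+ 2 / 8 by rewrite ltr_pwDl// divr_ge0// sqr_ge0.
by rewrite ler_pdivrMr//; lra.
Qed.

(** N stands for sqrt n, s for the exact standard deviation, D for f'(theta), t for the shift of the
    parameter, e2 for the Taylor remainder of f and e1 for the bias of the mean. The true threshold
    is z + (z q + g) + e1/s, with q the relative error of the scale and g the contribution of e2. *)
Lemma delta_shift (N sg s D K K1 A r dl z e1 e2 : R) :
  0 < N -> 0 < sg -> 2 <= sg ^+ 2 -> 0 < s -> 2 * N ^+ 2 <= s ^+ 2 ->
  `|N ^+ 2 * sg ^+ 2 - s ^+ 2| <= A * N ^+ 2 * r -> A * r <= 1 ->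
  0 < D -> 0 <= K -> K * dl <= D / 8 ->
  let t := z * sg / (D * N) in
  `|t| <= dl -> `|e2| <= K * t ^+ 2 -> 0 <= e1 <= K1 ->
  `|Phi ((N ^+ 2 * (D * t + e2) + e1) / s) - Phi z|
    <= A * r + (8 * K * sg ^+ 2 / D ^+ 2 + K1) / N.
Proof.
move=> N0 sg0 sg2 s0 sN hV Ar D0 K0 Kdl t tdl he2 /andP[e10 e1K].
have rt2 : N <= s by rewrite -(@ler_pXn2r _ 2)// ?nnegrE ?ltW//; nra.
have ms : N * (s + N * sg) <= s * (s + N * sg) by rewrite ler_wpM2r// ltW// addr_gt0// mulr_gt0.
set q := N * sg / s - 1.
have hq : `|q| <= A * r / 4.
  (* Rationalising turns the error of the standard deviation into that of the variance, over a
     denominator of at least 4 N^2. *)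
  have -> : q = (N ^+ 2 * sg ^+ 2 - s ^+ 2) / (s * (s + N * sg)).
    rewrite /q; field; rewrite !gt_eqF// addr_gt0// mulr_gt0//.
  have d0 : 0 < s * (s + N * sg) by rewrite mulr_gt0// addr_gt0// mulr_gt0.
  rewrite normrM normfV (gtr0_norm d0) ler_pdivrMr// (le_trans hV)//.
  have Ar0 : 0 <= A * r.
    have : 0 <= A * N ^+ 2 * r by apply: le_trans hV.
    by rewrite mulrAC pmulr_lge0// exprn_gt0.
  have : 2 * N ^+ 2 <= s * (N * sg).
    have : (2 * N ^+ 2) ^+ 2 <= (s * (N * sg)) ^+ 2.
      have h : 2 * N ^+ 2 * 2 <= s ^+ 2 * sg ^+ 2.
        by apply: ler_pM => //; rewrite mulr_ge0// sqr_ge0.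
      by have := ler_wpM2r (sqr_ge0 N) h; lra.
    by rewrite ler_pXn2r// nnegrE ?mulr_ge0 ?sqr_ge0 ?ltW//.
  move=> h; have h4 : 4 * N ^+ 2 <= s * (s + N * sg) by rewrite mulrDr -expr2; lra.
  by have := ler_wpM2l Ar0 h4; lra.
set g := N ^+ 2 * e2 / s.
have tE : N ^+ 2 * (D * t) = z * (N * sg) by rewrite /t; field; rewrite !gt_eqF.
have -> : (N ^+ 2 * (D * t + e2) + e1) / s = z + (z * q + g) + e1 / s.
  by rewrite mulrDr tE /q /g; field; rewrite gt_eqF.
have Nq : N * sg / s <= 5 / 4.
  by have := ler_norm q; rewrite /q in hq *; lra.
have is0 : 0 < s^-1 by rewrite invr_gt0.
have hg0 : `|g| <= N ^+ 2 * (K * t ^+ 2) / s.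
  rewrite /g normrM (gtr0_norm is0) normrM (ger0_norm (sqr_ge0 N)).
  by rewrite ler_wpM2r ?(ltW is0)// ler_wpM2l// sqr_ge0.
have tz : `|t| = `|z| * (sg / (D * N)).
  by rewrite /t -mulrA normrM [X in _ * X]gtr0_norm// divr_gt0// mulr_gt0.
(* Two bounds on g are needed: this linear one, from K |t| <= D/8, brings the perturbation below
   |z|/2 as [Phi_perturb] demands; the quadratic one [hg2], with factor 1/N, gives the error. *)
have hg1 : `|g| <= `|z| / 4.
  apply: (le_trans hg0); rewrite -(real_normK (num_real t)) expr2.
  have -> : N ^+ 2 * (K * (`|t| * `|t|)) / s = (K * `|t|) * `|z| * (N * sg / s) / D.
    by rewrite {2}tz; field; rewrite !gt_eqF.
  rewrite ler_pdivrMr//.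
  have Kt : K * `|t| <= D / 8 by rewrite (le_trans _ Kdl)// ler_wpM2l.
  have h1 : K * `|t| * `|z| <= D / 8 * `|z| by rewrite ler_wpM2r.
  have h2 : K * `|t| * `|z| * (N * sg / s) <= (D / 8 * `|z|) * (5 / 4).
    apply: ler_pM => //; first by rewrite !mulr_ge0.
    by rewrite divr_ge0 ?mulr_ge0 ?ltW.
  apply: (le_trans h2); have := mulr_ge0 (ltW D0) (normr_ge0 z); lra.
have KD0 : 0 <= K * sg ^+ 2 / D ^+ 2.
  by apply: divr_ge0 (sqr_ge0 D); exact: mulr_ge0 K0 (sqr_ge0 sg).
have hg2 : `|g| <= K * sg ^+ 2 / D ^+ 2 / N * z ^+ 2.
  apply: (le_trans hg0).
  have -> : N ^+ 2 * (K * t ^+ 2) / s = K * sg ^+ 2 / D ^+ 2 * z ^+ 2 / s.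
    by rewrite /t; field; rewrite !gt_eqF.
  by rewrite mulrAC ler_wpM2r ?sqr_ge0// ler_wpM2l// ?lef_pV2.
have ha : `|z * q + g| <= `|z| / 2.
  rewrite (le_trans (ler_normD _ _))// normrM.
  have : `|z| * `|q| <= `|z| * (1 / 4) by rewrite ler_wpM2l//; lra.
  lra.
apply: (le_trans (Phi_perturb (e1 / s) ha)).
have w0 : 0 <= (1 + z ^+ 2 / 8)^-1 by rewrite invr_ge0 addr_ge0// divr_ge0// sqr_ge0.
have h1 : `|z * q + g| <= A * r / 4 * `|z| + K * sg ^+ 2 / D ^+ 2 / N * z ^+ 2.
  rewrite (le_trans (ler_normD _ _))// lerD// normrM mulrC ler_wpM2r//.
have h2 := ler_wpM2r w0 h1.
have h3 : `|e1 / s| <= K1 / N.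
  rewrite (ger0_norm (divr_ge0 e10 (ltW s0))).
  by apply: ler_pM => //; [exact: ltW | rewrite lef_pV2].
have Ar0 : 0 <= A * r / 4 by apply: le_trans hq.
have KD : 0 <= K * sg ^+ 2 / D ^+ 2 / N := divr_ge0 KD0 (ltW N0).
have h4 := ler_wpM2l Ar0 (weight_le1 z).
have h5 := ler_wpM2l KD (weight_le2 z).
rewrite mulrDl in h2; rewrite [X in _ <= _ + X]mulrDl.
apply: (le_trans (lerD h2 h3)); move: h4 h5; rewrite !mulrA; lra.
Qed.

End normal_shift.

Section zygmund_bound.
Context (R : realType) (H : R) (rho : int -> R) (L : R -> R).
Hypothesis rho0 : rho 0 = 1.
Hypothesis rhoE : forall k : int, k != 0 ->
  rho k = L (`|k|%:~R) * (`|k|%:~R) `^ (2 * H - 2).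
Hypothesis L_pos : forall x : R, 0 < x -> 0 < L x.
Hypothesis L_slow : zygmund_slowly_varying L.

Lemma rho_gt0 k : 0 < rho k.
Proof.
have [->|k0] := eqVneq k 0; first by rewrite rho0.
rewrite rhoE// mulr_gt0 ?powR_gt0 ?L_pos// ltr0z normr_gt0//.
Qed.

(** Beyond some threshold, x^(-e) L(x) decreases and is bounded by its value at m; the finitely many
    integers before are covered by summing all their values. *)
Lemma slowly_varying_le (e : R) : 0 < e ->
  exists2 B, 0 <= B & forall k : nat, L k.+1%:R <= B * k.+1%:R `^ e.
Proof.
move=> e0; have [a [ah]] := filter_ex (filterI (L_slow e0) (nbhs_pinfty_gt (num_real (0 : R)))).
move=> a0; have {ah} [_ ah] := ah.
pose m := (Num.truncn a).+1.
have am : a < m%:R by rewrite truncnS_gt.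
pose g (j : nat) := j.+1%:R `^ (- e) * L j.+1%:R.
have g0 j : 0 <= g j by rewrite mulr_ge0 ?powR_ge0// ltW// L_pos// ltr0n.
exists (\sum_(j < m.+1) g j); first exact: sumr_ge0.
move=> k; suff h : g k <= \sum_(j < m.+1) g j.
  rewrite -ler_pdivrMr ?powR_gt0 ?ltr0n// mulrC -powRN; exact: h.
have [km|km] := ltnP k m.+1.
  by rewrite (bigD1 (Ordinal km))//= lerDl sumr_ge0.
apply: (@le_trans _ _ (g m)).
  apply: ah; last by rewrite ler_nat ltnS ltnW.
  by rewrite (lt_trans am)// ltr_nat.
by rewrite (bigD1 ord_max)//= lerDl sumr_ge0.
Qed.

Lemma rho_power (e : R) : 0 < e -> 0 < 2 - 2 * H - e < 1 ->
  exists2 C, 0 < C & forall k : int, rho k <= C * pw (2 - 2 * H - e) `|k|%N.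
Proof.
move=> e0; set a := 2 - 2 * H - e => /andP[a0 a1].
have [B B0 hB] := slowly_varying_le e0.
exists (1 + 2 * B); first by rewrite ltr_pwDl// mulr_ge0.
move=> k; have [->|k0] := eqVneq k 0.
  by rewrite rho0 /pw absz0 powR1 mulr1 lerDl mulr_ge0.
have [j jE] : exists j, `|k|%N = j.+1.
  by exists (`|k|%N.-1); rewrite prednK// absz_gt0.
have kE : `|k|%:~R = j.+1%:R :> R by rewrite -abszE jE.
rewrite rhoE// kE jE.
apply: (@le_trans _ _ (B * pw a j)).
  have -> : 2 * H - 2 = - e - a by rewrite /a; ring.
  rewrite powRDn mulrA -[X in X <= _]/(_ * pw a j) ler_wpM2r ?pw_ge0//.
  by rewrite powRN ler_pdivrMr ?powR_gt0 ?ltr0n//.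
(* [pw] is indexed from zero: lag k = j+1 is weighted by j+2, and the mismatch costs at most 2^a <=
   2. *)
have h : pw a j <= 2 * pw a j.+1.
  rewrite /pw !powRN ler_pdivlMr ?powR_gt0 ?ltr0n// mulrC ler_pdivrMr ?powR_gt0 ?ltr0n//.
  apply: (@le_trans _ _ ((2 * j.+1%:R) `^ a)).
    rewrite ge0_ler_powR ?nnegrE ?(ltW a0) ?mulr_ge0//.
    by rewrite -natrM ler_nat; lia.
  rewrite powRM// ler_wpM2r ?powR_ge0//.
  by rewrite -[leRHS]powRr1// ler_powR ?ler1n// ltW.
have := ler_wpM2l B0 h; have := pw_ge0 a j.+1; lra.
Qed.

End zygmund_bound.

Section kolmogorov_arithmetic.
Context (R : realType).
Implicit Types (p g q b x y c r : R).

Lemma kolm_bad p g x y b c : `|p - x| <= b -> `|g - y| <= b -> x <= c -> 1 - y <= c ->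
  p + (1 - g) <= 2 * b + 2 * c.
Proof. by rewrite !ler_norml => /andP[? ?] /andP[? ?] ? ?; lra. Qed.

(** Here p, g and q are the probabilities of the estimator event, of the corresponding event for the
    empirical mean and of the bad event; x and y are normal values at the nominal and the true
    threshold. The total 3b is one b for g and two for the two halves of the bad event. *)
Lemma kolm_middle p g q b x y c r c' c'' : p <= g + q -> g <= p + q -> q <= 2 * b + c ->
  `|g - y| <= b -> `|y - x| <= r + c' -> 0 <= c'' ->
  `|p - x| <= 3 * b + r + (c + c' + c'').
Proof.
rewrite !ler_norml => ? ? ? /andP[? ?] /andP[? ?] ?.
by apply/andP; split; lra.
Qed.

Lemma kolm_right p q b x c r c' c'' : 1 - q <= p -> p <= 1 -> q <= 2 * b + c ->
  1 - x <= c'' -> x <= 1 -> 0 <= b -> 0 <= r -> 0 <= c -> 0 <= c' -> 0 <= c'' ->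
  `|p - x| <= 3 * b + r + (c + c' + c'').
Proof. by move=> *; rewrite ler_norml; apply/andP; split; lra. Qed.

Lemma kolm_left p q b x c r c' c'' : p <= q -> 0 <= p -> q <= 2 * b + c ->
  0 <= x -> x <= c'' -> 0 <= b -> 0 <= r -> 0 <= c -> 0 <= c' -> 0 <= c'' ->
  `|p - x| <= 3 * b + r + (c + c' + c'').
Proof. by move=> *; rewrite ler_norml; apply/andP; split; lra. Qed.

Lemma tail_threshold_lower (M eta K e s t l : R) : 0 <= M -> 2 * K <= M * eta ->
  s <= M * eta / 2 -> e <= K -> eta <= t - l -> M * (l - t) + e <= - s.
Proof. by move=> M0 ? ? ? h; have := ler_wpM2l M0 h; lra. Qed.

Lemma tail_threshold_upper (M eta e s t u : R) : 0 <= M -> 0 <= eta -> 0 <= e ->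
  s <= M * eta / 2 -> eta <= u - t -> s <= M * (u - t) + e.
Proof. by move=> M0 e0 ? ? h; have := ler_wpM2l M0 h; have := mulr_ge0 M0 e0; lra. Qed.

Lemma scale_le (N sg s A r : R) : 0 < N -> 0 < sg -> 0 < s -> 2 <= sg ^+ 2 -> A * r <= 1 ->
  `|N ^+ 2 * sg ^+ 2 - s ^+ 2| <= A * N ^+ 2 * r -> s <= 2 * sg * N.
Proof.
move=> N0 sg0 s0 sg2 Ar; rewrite ler_norml => /andP[hV _].
rewrite -(@ler_pXn2r _ 2)// ?nnegrE ?(ltW s0) ?mulr_ge0 ?(ltW sg0) ?(ltW N0)//.
have : A * r * N ^+ 2 <= N ^+ 2 by rewrite ler_piMl// sqr_ge0.
by have := ler_wpM2r (sqr_ge0 N) sg2; rewrite !exprMn; nra.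
Qed.

End kolmogorov_arithmetic.

Section fine_probability.
Context (R : realType) d (T : measurableType d) (P : probability T R).
Implicit Types A B : set T.

Let fin A : measurable A -> P A \is a fin_num. Proof. exact: fin_num_measure. Qed.

Lemma fine_prob_le A B : measurable A -> measurable B -> A `<=` B ->
  fine (P A) <= fine (P B).
Proof. by move=> mA mB AB; rewrite fine_le ?fin// le_measure// inE. Qed.

Lemma fine_probU A B : measurable A -> measurable B ->
  fine (P (A `|` B)) <= fine (P A) + fine (P B).
Proof.
move=> mA mB; rewrite -fineD ?fin// fine_le ?fin//; first exact: measurableU.
  by rewrite fin_numD !fin.
exact: measureU2.
Qed.

Lemma fine_probC A : measurable A -> fine (P (~` A)) = 1 - fine (P A).
Proof. by move=> mA; rewrite probability_setC// fineB// fin. Qed.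

Lemma fine_prob_ge0 A : 0 <= fine (P A). Proof. exact: fine_ge0. Qed.

Lemma fine_prob_le1 A : measurable A -> fine (P A) <= 1.
Proof. by move=> mA; rewrite -lee_fin fineK ?fin// probability_le1. Qed.

End fine_probability.

(** * Inversion of f and the distance for the estimator *)

Section estimator.
Context (R : realType) d (T : measurableType d) (P : probability T R).
Context (xi : int -> {RV P >-> R}) (rho : int -> R) (theta theta0 a C0 : R).
Hypothesis xi_gaussian : gaussian_seq xi.
Hypothesis xi_stationary : stationary_seq xi.
Hypothesis xi_centered : forall t : int, ('E_P[xi t] = 0)%E.
Hypothesis xi_cov : forall k : int, ('E_P[xi 0%R \* xi k] = (rho k)%:E)%E.
Hypothesis theta_range : 0 < theta < 1.
Hypothesis rho0 : rho 0 = 1.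
Hypothesis rho_gt0 : forall k, 0 < rho k.
Hypothesis C0_gt0 : 0 < C0.
Hypothesis a_range : 1 / 2 < a < 1.
Hypothesis rho_pw : forall k : int, rho k <= C0 * pw a `|k|%N.

Let theta01 : 0 <= theta < 1. Proof. by case/andP: theta_range => /ltW ->. Qed.
Let rho_ge0 k : 0 <= rho k. Proof. exact: ltW. Qed.
Let rho_le1 k : rho k <= 1. Proof. exact: rho_le1. Qed.
Let rhoN k : rho (- k) = rho k. Proof. exact: rhoN. Qed.

Let f := second_moment rho.

Let fE v : 0 < v < 1 -> f v = Rcov rho v 0.
Proof. by move=> /andP[v0 v1]; apply: second_momentE => //; rewrite (ltW v0). Qed.

Let f_lt v w : 0 < v -> v < w -> w < 1 -> f v < f w.
Proof.
move=> v0 vw w1; rewrite !fE ?v0 ?(lt_trans vw)// ?w1 ?(lt_trans v0)//.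
have := Rcov_incr rho_ge0 rho_le1 (ltW v0) (ltW vw) w1.
have : 0 < rho 1 * (w - v) by rewrite mulr_gt0// subr_gt0.
lra.
Qed.

Let f_le v w : 0 < v < 1 -> 0 < w < 1 -> (f v <= f w) = (v <= w).
Proof.
move=> /andP[v0 v1] /andP[w0 w1]; apply/idP/idP; last first.
  by rewrite le_eqVlt => /predU1P[->//|vw]; rewrite ltW// f_lt.
by apply: contraTT; rewrite -!ltNge => wv; exact: f_lt.
Qed.

Let f_ivt v w y : 0 < v -> v <= w -> w < 1 -> f v <= y <= f w ->
  exists2 u, v <= u <= w & f u = y.
Proof.
move=> v0 vw w1 /andP[vy yw].
have cf : {within `[v, w], continuous f}.
  apply: derivable_within_continuous => u; rewrite in_itv/= => /andP[vu uw].
  have u01 : 0 < u < 1 by rewrite (lt_le_trans v0)//= (le_lt_trans uw).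
  by have [] := is_derive_second_moment rho_ge0 rho_le1 (rho_gt0 1) C0_gt0 a_range u01.
have [|u] := @IVT R f v w y vw cf.
  by rewrite ge_min vy/= le_max yw orbT.
by rewrite in_itv/= => uvw fu; exists u.
Qed.

Let inv := second_moment_inv rho theta0.

Let inv_in v w y : 0 < v -> v <= w -> w < 1 -> f v <= y <= f w ->
  v <= inv y <= w /\ f (inv y) = y.
Proof.
move=> v0 vw w1 vyw; have [u /andP[vu uw] fu] := f_ivt v0 vw w1 vyw.
have : [set u | 0 < u < 1 /\ second_moment rho u = y] (inv y).
  apply: xgetPex; exists u; split => //.
  by rewrite (lt_le_trans v0)//= (le_lt_trans uw).
move=> [i01 fi]; have {}fi : f (inv y) = y by [].
have v01 : 0 < v < 1 by rewrite v0 (le_lt_trans vw).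
have w01 : 0 < w < 1 by rewrite w1 (lt_le_trans v0).
by split => //; rewrite -(f_le v01 i01) -(f_le i01 w01) fi.
Qed.

(** By monotonicity and the intermediate value theorem, f maps intervals to intervals. The sublevel
    set is the image of (0, c] within (0, 1), together with the complement of the range when the
    default [theta0] is at most c. *)
Let measurable_inv c : measurable [set y : measurableTypeR R | inv y <= c].
Proof.
pose I1 := f @` [set v | 0 < v < 1].
pose I2 := f @` [set v | 0 < v < 1 /\ v <= c].
have m1 : measurable (I1 : set (measurableTypeR R)).
  apply: is_interval_measurable => _ _ [v /andP[v0 v1] <-] [w /andP[w0 w1] <-] y vyw.
  have vw : v <= w by rewrite -f_le ?v0 ?w0//; case/andP: vyw; exact: le_trans.
  have [u /andP[vu uw] <-] := f_ivt v0 vw w1 vyw; exists u => //=.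
  by rewrite (lt_le_trans v0)//= (le_lt_trans uw).
have m2 : measurable (I2 : set (measurableTypeR R)).
  apply: is_interval_measurable => _ _ [v [/andP[v0 v1] vc] <-] [w [/andP[w0 w1] wc] <-] y vyw.
  have vw : v <= w by rewrite -f_le ?v0 ?w0//; case/andP: vyw; exact: le_trans.
  have [u /andP[vu uw] <-] := f_ivt v0 vw w1 vyw; exists u => //=; split.
    by rewrite (lt_le_trans v0)//= (le_lt_trans uw).
  exact: le_trans uw wc.
have -> : [set y : measurableTypeR R | inv y <= c] =
    I2 `|` (~` I1 `&` (if theta0 <= c then setT else set0)).
  have invf v : 0 < v < 1 -> inv (f v) = v.
    move=> /andP[v0 v1]; have [] := @inv_in v v (f v) v0 (lexx v) v1.
      by rewrite lexx.
    by move=> /andP[h1 h2] _; apply/eqP; rewrite eq_le h1 h2.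
  have invN y : ~ I1 y -> inv y = theta0.
    by move=> nI; apply: xgetPN => v [v01 fv]; apply: nI; exists v.
  apply/seteqP; split => y /=.
    have [[v v01 <-]|nI] := pselect (I1 y).
      by rewrite invf// => vc; left; exists v.
    by rewrite invN// => ->; right.
  case=> [[v [v01 vc] <-]|[nI]]; first by rewrite invf.
  by rewrite invN//; case: ifP.
apply: measurableU => //; apply: measurableI; first exact: measurableC.
by case: ifP.
Qed.

Let X (i : nat) := ar_process xi theta i.+1.
Let Q n w := \sum_(i < n) X i w ^+ 2.
Let mu n := \sum_(i < n) covar rho theta i i.
Let V n := sample_var rho theta n.
Let kap n := sample_kap rho theta n.
Let W n w := (Q n w - mu n) / Num.sqrt (V n).
Let B n := 2 * (Num.sqrt (8 * kap n) / V n).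

Let mX i : measurable_fun setT (X i). Proof. exact: (measurable_ar xi theta01). Qed.

Let mQ n : measurable_fun setT (Q n).
Proof. by have [] := @polybnd_Q _ _ _ n (fun i => X i) (fun i => mX i). Qed.

Let mW n : measurable_fun setT (W n).
Proof. by apply: measurable_funM => //; apply: measurable_funB => //; exact: mQ. Qed.

Let V_gt0 n : (0 < n)%N -> 0 < V n.
Proof.
move=> n0; apply: (@lt_le_trans _ _ (2 * n%:R)); first by rewrite mulr_gt0// ltr0n.
exact: sample_var_ge.
Qed.

Lemma sample_kolmogorov n z : (0 < n)%N ->
  `|fine (P [set w | W n w <= z]) - Phi z| <= B n.
Proof.
move=> n0; apply: kolmogorov_of_smooth => [|h ch h01]; first exact: mW.
have E i j : \int[P]_w (X i w * X j w) = covar rho theta i j by exact: E_ar_ar.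
have VE : \sum_(i < n) \sum_(j < n) 2 * (\int[P]_w (X i w * X j w)) ^+ 2 = V n.
  by apply: eq_bigr => i _; apply: eq_bigr => j _; rewrite E.
have muE : \sum_(i < n) \int[P]_w (X i w * X i w) = mu n.
  by apply: eq_bigr => i _; rewrite E.
have kE : \sum_(i < n) \sum_(j < n) (\sum_(k < n)
    \int[P]_w (X i w * X k w) * \int[P]_w (X k w * X j w)) ^+ 2 = kap n.
  apply: eq_bigr => i _; apply: eq_bigr => j _; congr (_ ^+ 2).
  by apply: eq_bigr => k _; rewrite !E.
have gX (c : 'I_n -> R) :
    gaussian_law (fun A => P ((fun w => \sum_(i < n) c i * X i w) @^-1` A)).
  exact: gaussian_ar.
have EX (i : 'I_n) : \int[P]_w X i w = 0 by exact: E_ar.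
have := @berry_esseen_smooth _ _ _ P n (fun i => X i) (fun i => mX i) gX EX.
by rewrite VE muE kE => /(_ (V_gt0 n0) h ch h01).
Qed.

Let D := Dcov rho theta.
Let sg := Num.sqrt (asym_var rho theta).
Let E n z := [set w | D * Num.sqrt n%:R * (inv (n%:R^-1 * Q n w) - theta) / sg <= z].
Let G n y := [set w | n%:R^-1 * Q n w <= y].

Let mean_meas n : measurable_fun setT (fun w => n%:R^-1 * Q n w).
Proof. by apply: measurable_funM => //; exact: mQ. Qed.

Let measurable_G n y : measurable (G n y).
Proof. by rewrite /G -[X in measurable X]setTI; apply: measurable_fun_le => //; exact: mean_meas. Qed.

Let D_gt0 : 0 < D. Proof. exact: (Dcov_gt0 rho_ge0 rho_le1 (rho_gt0 1) C0_gt0 a_range). Qed.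

Let asym2 : 2 <= asym_var rho theta.
Proof.
have [CR CR0 hCR] := Rcov_pw rho_ge0 rho_le1 (rho_gt0 1) C0_gt0 a_range rho_pw theta01.
exact: (asym_var_ge rho_ge0 rho_le1 rho0 a_range theta01 CR0 hCR).
Qed.

Let sg2 : 2 <= sg ^+ 2. Proof. by rewrite /sg sqr_sqrtr// (le_trans _ asym2). Qed.

Let sg_gt0 : 0 < sg.
Proof.
rewrite lt_def sqrtr_ge0 andbT; apply/eqP => h; have := sg2; rewrite h expr0n/=.
by apply/negP; rewrite -ltNge.
Qed.

Let E_inv n z : (0 < n)%N ->
  E n z = [set w | inv (n%:R^-1 * Q n w) <= theta + z * sg / (D * Num.sqrt n%:R)].
Proof.
move=> n0; have N0 : 0 < Num.sqrt n%:R :> R by rewrite sqrtr_gt0 ltr0n.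
have DN : 0 < D * Num.sqrt n%:R by rewrite mulr_gt0.
apply/seteqP; split => w; rewrite /E/= ler_pdivrMr// -lerBlDl ler_pdivlMr// [_ * (_ - theta)]mulrC//.
Qed.

Let measurable_E n z : (0 < n)%N -> measurable (E n z).
Proof.
move=> n0; rewrite (E_inv z n0).
have := mean_meas n measurableT (measurable_inv (theta + z * sg / (D * Num.sqrt n%:R))).
by rewrite setTI.
Qed.

Let G_Phi n y : (0 < n)%N ->
  `|fine (P (G n y)) - Phi ((n%:R * y - mu n) / Num.sqrt (V n))| <= B n.
Proof.
move=> n0; have := sample_kolmogorov ((n%:R * y - mu n) / Num.sqrt (V n)) n0.
rewrite (_ : [set w | _] = G n y)//.
have s0 : 0 < Num.sqrt (V n) by rewrite sqrtr_gt0 V_gt0.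
have nn : 0 < n%:R :> R by rewrite ltr0n.
apply/seteqP; split => w /=; rewrite /W ler_pM2r ?invr_gt0// lerD2r.
  by rewrite /G/= ler_pdivrMl.
by rewrite /G/= ler_pdivrMl.
Qed.

(** If the shift t lies in the window of radius [dl], the estimator event is compared with the mean
    lying below f(theta + t). Otherwise |z| is at least of order sqrt n, and off the bad event the
    estimator event is certain or impossible according to the sign of z. The rank n is fixed before
    z, which makes the bound uniform. *)
Lemma estimator_bound : exists A C : R, [/\ 0 < A, 0 < C &
  \forall n \near \oo, forall z, measurable (E n z) /\
   `|fine (P (E n z)) - Phi z| <= 3 * B n + A * n%:R `^ (1 - 2 * a) + C / Num.sqrt n%:R].
Proof.
have /andP[t0 t1] := theta_range.
have /andP[a2 a1] := a_range.
have [CR CR0 hCR] := Rcov_pw rho_ge0 rho_le1 (rho_gt0 1) C0_gt0 a_range rho_pw theta01.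
have [A A0 hA] := sample_var_asym rho_ge0 rho_le1 (rho_gt0 1) rhoN C0_gt0 a_range theta01 CR0 hCR.
have hmu n := mean_bound rho_ge0 rho_le1 (rho_gt0 1) rhoN C0_gt0 a_range theta01 CR0 n.
pose K1 : R := 2 / (1 - theta) ^+ 3.
have K10 : 0 <= K1 by rewrite divr_ge0// exprn_ge0// subr_ge0 ltW.
pose r0 := (1 + theta) / 2.
have r01 : 0 < r0 < 1 by apply/andP; split; rewrite /r0; lra.
pose K := taylorK r0.
have K0 : 0 < K := taylorK_gt0 r01.
(* The first two entries keep the window inside (0, r0], where the Taylor bound holds; the third
   makes the quadratic remainder small against the linear term, as [delta_shift] requires. *)
pose dl := Num.min (theta / 2) (Num.min ((1 - theta) / 2) (D / (8 * K))).
have dl0 : 0 < dl.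
  by rewrite /dl !lt_min; apply/and3P; split; [lra | lra | rewrite divr_gt0// mulr_gt0].
have dl1 : dl <= theta / 2 by rewrite /dl ge_min lexx.
have dl2 : dl <= (1 - theta) / 2 by rewrite /dl !ge_min lexx orbT.
have rng (t : R) : - dl <= t <= dl -> (0 < theta + t < 1) /\ (0 <= theta + t <= r0).
  by move=> /andP[? ?]; rewrite /r0; split; apply/andP; split; lra.
have vr : 0 <= theta <= r0 by apply/andP; split; rewrite /r0; lra.
pose l := theta - dl; pose u := theta + dl.
have l0 : 0 < l by rewrite /l; lra.
have u1 : u < 1 by rewrite /u; lra.
have lu : l <= u by rewrite /l /u; lra.
have tl : l <= theta by rewrite /l; lra.
have tu : theta <= u by rewrite /u; lra.
have Kdl : K * dl <= D / 8.
  have : dl <= D / (8 * K) by rewrite /dl !ge_min lexx !orbT.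
  rewrite -(ler_pM2l K0) => /le_trans -> //.
  by rewrite le_eqVlt; apply/orP; left; apply/eqP; field; rewrite gt_eqF.
(* By [Rcov_incr], f(theta) differs from f at either end of the window by at least this much. *)
pose eta := rho 1 * dl.
have eta0 : 0 < eta by rewrite mulr_gt0.
(* Three costs of order 1/sqrt n: the bad event, the moved threshold inside the window, and the
   normal tail outside it. *)
pose C := 8 * sg / eta + (8 * K * sg ^+ 2 / D ^+ 2 + K1) + sg / (dl * D).
have c1 : 0 < 8 * sg / eta by rewrite divr_gt0// mulr_gt0.
have c2 : 0 <= 8 * K * sg ^+ 2 / D ^+ 2 + K1.
  apply: addr_ge0 K10; apply: divr_ge0; last exact: sqr_ge0.
  by apply: mulr_ge0; [rewrite mulr_ge0// ltW | exact: sqr_ge0].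
have c3 : 0 < sg / (dl * D) by rewrite divr_gt0// mulr_gt0.
exists A, C; split => //; first by rewrite /C; lra.
near=> n => z.
have n0 : (0 < n)%N by near: n; exact: nbhs_infty_gt.
have nn : 0 < n%:R :> R by rewrite ltr0n.
split; first exact: measurable_E.
set r := n%:R `^ (1 - 2 * a).
have Ar1 : A * r <= 1.
  have p0 : 0 < 2 * a - 1 by lra.
  have nA : A `^ (2 * a - 1)^-1 <= n%:R by near: n; exact: nbhs_infty_ger.
  rewrite /r -opprB powRN ler_pdivrMr ?powR_gt0// mul1r.
  have := ge0_ler_powR (ltW p0) (powR_ge0 _ _) (ltW nn) nA.
  by rewrite -powRrM mulVf ?gt_eqF// powRr1// ltW.
have nbig : 2 * K1 <= n%:R * eta.
  rewrite -ler_pdivrMr//; near: n; exact: nbhs_infty_ger.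
set N := Num.sqrt n%:R.
have N0 : 0 < N by rewrite sqrtr_gt0.
have N2 : N ^+ 2 = n%:R by rewrite /N sqr_sqrtr// ltW.
set s := Num.sqrt (V n).
have s0 : 0 < s by rewrite sqrtr_gt0 V_gt0.
have s2 : s ^+ 2 = V n by rewrite /s sqr_sqrtr// ltW// V_gt0.
have sN : 2 * N ^+ 2 <= s ^+ 2 by rewrite N2 s2; exact: sample_var_ge.
have hV : `|N ^+ 2 * sg ^+ 2 - s ^+ 2| <= A * N ^+ 2 * r.
  rewrite N2 s2 /sg sqr_sqrtr; last exact: le_trans asym2.
  apply: (le_trans (hA n)); rewrite -mulrA ler_pM2l// /r (_ : 2 - 2 * a = 1 + (1 - 2 * a)).
    by rewrite powRD ?(gt_eqF nn) ?implybT// powRr1// ltW.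
  by ring.
set e1 := n%:R * Rcov rho theta 0 - mu n.
have e1b : 0 <= e1 <= K1 := hmu n.
have s_le : s <= 2 * sg * N := scale_le N0 sg_gt0 s0 sg2 Ar1 hV.
(* With s <= 2 sg N this gives y s <= n eta / 2. As the bias is at most n eta / 2, the normalised
   thresholds at the ends of the window lie beyond -y and y. *)
pose y := N * eta / (4 * sg).
have y0 : 0 < y by rewrite divr_gt0 ?mulr_gt0.
have ys : y * s <= N ^+ 2 * eta / 2.
  have := ler_wpM2l (ltW y0) s_le; rewrite {2}/y => /le_trans -> //.
  by rewrite le_eqVlt; apply/orP; left; apply/eqP; field; rewrite gt_eqF.
have fc (c : R) : 0 < c < 1 -> n%:R * f c - mu n = N ^+ 2 * (Rcov rho c 0 - Rcov rho theta 0) + e1.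
  by move=> c01; rewrite fE// N2 /e1; ring.
have xl : Phi ((n%:R * f l - mu n) / s) <= y^-1.
  apply: le_trans (Phi_lower y0); apply: Phi_nondecreasing.
  rewrite ler_pdivrMr// fc; last by rewrite l0 (le_lt_trans lu).
  have := Rcov_incr rho_ge0 rho_le1 (ltW l0) tl t1.
  rewrite (_ : theta - l = dl); last by rewrite /l; ring.
  rewrite -/eta => hl; have /andP[_ e1K] := e1b; rewrite -N2 in nbig.
  by rewrite mulNr; exact: tail_threshold_lower (sqr_ge0 N) nbig ys e1K hl.
have xu : 1 - Phi ((n%:R * f u - mu n) / s) <= y^-1.
  apply: le_trans (Phi_upper y0); rewrite lerD2l lerN2; apply: Phi_nondecreasing.
  rewrite ler_pdivlMr// fc; last by rewrite u1 (lt_le_trans l0).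
  have := Rcov_incr rho_ge0 rho_le1 (ltW t0) tu u1.
  rewrite (_ : u - theta = dl); last by rewrite /u; ring.
  rewrite -/eta => hu; have /andP[e10 _] := e1b.
  exact: tail_threshold_upper (sqr_ge0 N) (ltW eta0) e10 ys hu.
have yE : 2 * y^-1 = (8 * sg / eta) / N by rewrite /y; field; rewrite !gt_eqF.
(* Outside this event the mean lies in (f l, f u], inside the range of f, so [inv] returns a genuine
   preimage in [l, u] and not its default. *)
pose Bad := G n (f l) `|` ~` G n (f u).
have mBad : measurable Bad by apply: measurableU => //; exact: measurableC.
have pBad : fine (P Bad) <= 2 * B n + (8 * sg / eta) / N.
  apply: (le_trans (fine_probU _ (measurable_G _ _) (measurableC (measurable_G _ _)))).
  rewrite fine_probC// -yE.
  exact: kolm_bad (G_Phi (f l) n0) (G_Phi (f u) n0) xl xu.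
have B0 : 0 <= B n by apply: le_trans (G_Phi (f l) n0).
have good w : ~ Bad w -> l <= inv (n%:R^-1 * Q n w) <= u /\
    f (inv (n%:R^-1 * Q n w)) = n%:R^-1 * Q n w.
  move=> nB; apply: inv_in => //; apply/andP; split.
    by rewrite leNgt; apply/negP => h; apply: nB; left; rewrite /G/= ltW.
  by apply: contrapT => h; apply: nB; right.
have mE := measurable_E z n0.
have EE := E_inv z n0.
pose t := z * sg / (D * N).
have Ar0 : 0 <= A * r by rewrite mulr_ge0 ?powR_ge0// ltW.
have iN : 0 < N^-1 by rewrite invr_gt0.
have split_C : C / N = (8 * sg / eta) / N + (8 * K * sg ^+ 2 / D ^+ 2 + K1) / N + sg / (dl * D) / N.
  by rewrite /C (mulrDl (_ + _)) (mulrDl (8 * sg / eta)).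
have c1N : 0 <= (8 * sg / eta) / N by rewrite divr_ge0// ltW.
have c2N : 0 <= (8 * K * sg ^+ 2 / D ^+ 2 + K1) / N by rewrite divr_ge0// ltW.
have c3N : 0 <= sg / (dl * D) / N by rewrite divr_ge0// ltW.
have [tdl|tdl] := leP `|t| dl.
  have [c01 wr] := rng t (etrans (esym (ler_norml _ _)) tdl).
  pose c := theta + t.
  rewrite -/c in c01 wr.
  have hT := Rcov_taylor rho_ge0 rho_le1 (rho_gt0 1) C0_gt0 a_range r01 vr wr.
  have ct : c - theta = t by rewrite /c; ring.
  rewrite ct -/D -/K in hT.
  have hS := delta_shift N0 sg_gt0 sg2 s0 sN hV Ar1 D_gt0 (ltW K0) Kdl tdl hT e1b.
  have hx : (N ^+ 2 * (D * (z * sg / (D * N)) + (Rcov rho c 0 - Rcov rho theta 0 - D * t)) + e1) / s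
      = (n%:R * f c - mu n) / s.
    by rewrite fc// -/t; congr ((_ * _ + _) / _); ring.
  rewrite hx in hS.
  have hG := G_Phi (f c) n0.
  have EG : E n z `<=` G n (f c) `|` Bad.
    move=> w; rewrite EE /= => Ew; have [Bw|nB] := pselect (Bad w); first by right.
    left; rewrite /G/=; have [/andP[il iu] <-] := good w nB.
    by rewrite f_le// (lt_le_trans l0)//= (le_lt_trans iu).
  have GE : G n (f c) `<=` E n z `|` Bad.
    move=> w; rewrite EE /G/= => Gw; have [Bw|nB] := pselect (Bad w); first by right.
    left; move: Gw; have [/andP[il iu] e] := good w nB; rewrite -[leLHS]e.
    by rewrite f_le// (lt_le_trans l0)//= (le_lt_trans iu).
  have mG := measurable_G n (f c).
  have h1 := le_trans (fine_prob_le P mE (measurableU _ _ mG mBad) EG) (fine_probU P mG mBad).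
  have h2 := le_trans (fine_prob_le P mG (measurableU _ _ mE mBad) GE) (fine_probU P mE mBad).
  by rewrite split_C; exact: kolm_middle h1 h2 pBad hG hS c3N.
have tz : `|t| = `|z| * (sg / (D * N)).
  by rewrite /t -mulrA normrM [X in _ * X]gtr0_norm// divr_gt0// mulr_gt0.
have z0 : 0 < `|z|.
  rewrite lt_def normr_ge0 andbT; apply: contraTN tdl => /eqP h.
  by rewrite tz h mul0r -leNgt ltW.
(* Leaving the window means |z| > dl D N / sg, so the tail bound 1/|z| is already of order 1/sqrt
   n. *)
have zinv : `|z|^-1 <= sg / (dl * D) / N.
  rewrite invf_ple ?posrE ?divr_gt0 ?mulr_gt0//.
  rewrite tz in tdl; move: (ltW tdl); rewrite -ler_pdivrMr ?divr_gt0 ?mulr_gt0//.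
  by apply: le_trans; rewrite le_eqVlt; apply/orP; left; apply/eqP; field; rewrite !gt_eqF.
have Ege0 := fine_prob_ge0 P (E n z).
have Ele1 := fine_prob_le1 P mE.
rewrite split_C.
have t_sgn : (0 <= z) = (0 <= t).
  by rewrite /t -mulrA pmulr_lge0// divr_gt0// mulr_gt0.
have [zp|zn] := leP 0 z.
  have tp : dl < t by move: tdl; rewrite ger0_norm// -t_sgn.
  have BE : ~` Bad `<=` E n z.
    move=> w nB; rewrite EE/=; have [/andP[_ iu] _] := good w nB.
    by rewrite (le_trans iu)// /u lerD2l ltW.
  have h := fine_prob_le P (measurableC mBad) mE BE; rewrite fine_probC// in h.
  rewrite (ger0_norm zp) in z0 zinv.
  exact: kolm_right h Ele1 pBad (le_trans (Phi_upper z0) zinv) (Phi_le1 z) B0 Ar0 c1N c2N c3N.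
have tn0 : t < 0 by rewrite ltNge -t_sgn -ltNge.
have tn : t < - dl by rewrite ltrNr -(ltr0_norm tn0).
have EB : E n z `<=` Bad.
  move=> w; rewrite EE/= => Ew; apply: contrapT => nB; have [/andP[il _] _] := good w nB.
  by have := le_trans il Ew; rewrite /l lerD2l leNgt tn.
have h := fine_prob_le P mE mBad EB.
rewrite (ltr0_norm zn) in z0 zinv.
have hz := Phi_lower z0; rewrite opprK in hz.
exact: kolm_left h Ege0 pBad (Phi_ge0 z) (le_trans hz zinv) B0 Ar0 c1N c2N c3N.
Unshelve. all: by end_near. Qed.

End estimator.

Section rates.
Context (R : realType) (rho : int -> R) (theta a C0 : R).
Hypothesis theta01 : 0 <= theta < 1.
Hypothesis rho0 : rho 0 = 1.
Hypothesis rho_gt0 : forall k, 0 < rho k.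
Hypothesis rho_le1 : forall k, rho k <= 1.
Hypothesis rhoN : forall k, rho (- k) = rho k.
Hypothesis C0_gt0 : 0 < C0.
Hypothesis a_range : 1 / 2 < a < 1.
Hypothesis rho_pw : forall k : int, rho k <= C0 * pw a `|k|%N.

(** The square root halves the exponent 1 + max(0, 3-4a) + dl of tr S^4, and the variance, at least
    2n, removes one power of n. *)
Lemma smooth_bound_rate dl : 0 < dl < 1 ->
  exists2 C, 0 < C & forall n, (0 < n)%N ->
  2 * (Num.sqrt (8 * sample_kap rho theta n) / sample_var rho theta n)
    <= C * n%:R `^ (Num.max (- (1 / 2)) (1 - 2 * a) + dl).
Proof.
move=> dl01; have /andP[dl0 dl1] := dl01.
have rho_ge0 k : 0 <= rho k := ltW (rho_gt0 k).
have [CR CR0 hCR] := Rcov_pw rho_ge0 rho_le1 (rho_gt0 1) C0_gt0 a_range rho_pw theta01.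
have [C C_gt0 hC] :=
  sample_kap_le rho_ge0 rho_le1 (rho_gt0 1) rhoN C0_gt0 a_range theta01 CR0 hCR dl01.
have c0 : 0 < Num.sqrt (8 * C) by rewrite sqrtr_gt0 mulr_gt0.
exists (Num.sqrt (8 * C)) => // -[//|n] _.
pose q := (1 + (Num.max 0 (3 - 4 * a) + dl)) / 2.
pose y := Num.sqrt (8 * C) * n.+1%:R `^ q.
have y0 : 0 <= y by rewrite mulr_ge0 ?powR_ge0// ltW.
have nn : 0 < n.+1%:R :> R by rewrite ltr0n.
have sy : Num.sqrt (8 * sample_kap rho theta n.+1) <= y.
  rewrite -(ger0_norm y0) -sqrtr_sqr ler_wsqrtr//.
  rewrite /y exprMn sqr_sqrtr ?mulr_ge0 ?(ltW C_gt0)// -[leRHS]mulrA ler_pM2l//.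
  rewrite expr2 -powRDn (_ : q + q = 1 + (Num.max 0 (3 - 4 * a) + dl)); last by rewrite /q; field.
  by rewrite powRDn (powRr1 (ltW nn)); exact: hC.
have Vn : 2 * n.+1%:R <= sample_var rho theta n.+1 by exact: sample_var_ge.
have V0 : 0 < sample_var rho theta n.+1 by apply: lt_le_trans Vn; rewrite mulr_gt0.
apply: (@le_trans _ _ (Num.sqrt (8 * C) * n.+1%:R `^ (q - 1))).
  rewrite (powRDn q (- 1)) powRN (powRr1 (ltW nn)) [leRHS]mulrA -/y.
  apply: (@le_trans _ _ (2 * (y / (2 * n.+1%:R)))).
    rewrite ler_pM2l// ler_pM// ?sqrtr_ge0 ?invr_ge0 ?(ltW V0)//.
    by rewrite lef_pV2 ?posrE// mulr_gt0.
  by rewrite le_eqVlt; apply/orP; left; apply/eqP; field; rewrite addrC natr1 gt_eqF.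
rewrite ler_pM2l// ler_powR ?ler1n// /q.
have h1 : - (1 / 2) <= Num.max (- (1 / 2)) (1 - 2 * a) by rewrite le_max lexx.
have h2 : 1 - 2 * a <= Num.max (- (1 / 2)) (1 - 2 * a) by rewrite le_max lexx orbT.
by have [h|h] := leP 0 (3 - 4 * a); lra.
Qed.

End rates.

Theorem theorem1p6 (R : realType)
    (d : measure_display) (T : measurableType d) (P : probability T R)
    (d' : measure_display) (T' : measurableType d') (Q : probability T' R)
    (H theta theta0 : R)
    (xi : int -> {RV P >-> R}) (rho : int -> R) (L : R -> R)
    (Z : {RV Q >-> R})
    (H_range : 1 / 2 < H < 3 / 4)
    (theta_range : 0 < theta < 1)
    (theta0_range : 0 < theta0 < 1)
    (xi_gaussian : gaussian_seq xi)
    (xi_stationary : stationary_seq xi)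
    (xi_centered : forall t : int, ('E_P[xi t] = 0)%E)
    (xi_cov : forall k : int, ('E_P[xi 0%R \* xi k] = (rho k)%:E)%E)
    (rho0 : rho 0 = 1)
    (rhoE : forall k : int, k != 0 ->
      rho k = L (`|k|%:~R) * (`|k|%:~R) `^ (2 * H - 2))
    (L_pos : forall x : R, 0 < x -> 0 < L x)
    (L_slow : zygmund_slowly_varying L)
    (L_bv : forall a : R, 0 < a ->
      bounded_variation_oo a pi (fun l : R => L (1 / l)))
    (Z_std : forall A : set (measurableTypeR R), measurable A ->
      distribution Q Z A = normal_prob 0 1 A) :
  forall eps : R, 0 < eps ->
  exists C : R, 0 < C /\
    \forall n \near \oo,
      (ereal_sup [set `| P [set w |
             ((second_moment rho)^`()%classic theta * Num.sqrt n%:R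
              * (second_moment_estimator xi rho theta theta0 n w - theta)
              / sigmaH xi theta <= z)%R]
           - Q [set w | (Z w <= z)%R] | | z in [set: R]]
       <= (C * phi_rate H eps n)%:E)%E.
Proof.
have /andP[H1 H2] := H_range.
have theta01 : 0 <= theta < 1 by case/andP: theta_range => /ltW ->.
have rho_pos := rho_gt0 rho0 rhoE L_pos.
have rho_ge0 k : 0 <= rho k := ltW (rho_pos k).
have rho_le k : rho k <= 1 := rho_le1 xi_gaussian xi_stationary xi_centered xi_cov k rho0.
move=> eps eps0.
(* The bound 3/4 - H keeps a = 2 - 2H - del above 1/2. As 1 - 2a = 4H - 3 + 2 del, the bound eps/4
   spends half of eps; [dl] spends the other half. *)
pose del := Num.min (eps / 4) (3 / 4 - H).
have del0 : 0 < del by rewrite lt_min; apply/andP; split; lra.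
have del1 : del <= eps / 4 by rewrite ge_min lexx.
have del2 : del <= 3 / 4 - H by rewrite ge_min lexx orbT.
pose dl := Num.min (eps / 2) (1 / 2).
have dl0 : 0 < dl by rewrite lt_min; apply/andP; split; lra.
have dl1 : dl <= eps / 2 by rewrite ge_min lexx.
have dl2 : dl <= 1 / 2 by rewrite ge_min lexx orbT.
have dl01 : 0 < dl < 1 by apply/andP; split; lra.
pose a := 2 - 2 * H - del.
have a_range : 1 / 2 < a < 1 by apply/andP; split; rewrite /a; lra.
have a01 : 0 < a < 1 by have /andP[? ?] := a_range; apply/andP; split; lra.
pose b := Num.max (- (1 / 2)) (1 - 2 * a) + dl.
(* For H < 5/8 one has 4H - 3 < -1/2, so both entries of the maximum are at most -1/2 + eps/2; for H
   >= 5/8 both are at most 4H - 3 + eps/2. *)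
have b1 : H < 5 / 8 -> b <= - (1 / 2 - eps).
  by move=> H5; rewrite /b -lerBrDr ge_max; apply/andP; split; rewrite /a; lra.
have b2 : 5 / 8 <= H -> b <= - (3 - 4 * H - eps).
  by move=> H5; rewrite /b -lerBrDr ge_max; apply/andP; split; rewrite /a; lra.
have [C0 C00 rho_pw] := rho_power rho0 rhoE L_pos L_slow del0 a01.
have [CR CR0 hCR] := Rcov_pw rho_ge0 rho_le (rho_pos 1) C00 a_range rho_pw theta01.
have cvR := sumR2_cvg rho_ge0 rho_le a_range theta01 CR0 hCR.
have rho_N k : rho (- k) = rho k := rhoN xi_gaussian xi_stationary xi_centered xi_cov k.
have [CB CB0 hB] := smooth_bound_rate theta01 rho0 rho_pos rho_le rho_N C00 a_range rho_pw dl01.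
have [A [C [A_gt0 C_gt0 hC]]] := estimator_bound theta0 xi_gaussian xi_stationary xi_centered xi_cov
  theta_range rho0 rho_pos C00 a_range rho_pw.
have K0 : 0 < 3 * CB + A + C by rewrite !addr_gt0// mulr_gt0.
exists (3 * CB + A + C); split => //; apply: filterS2 hC (nbhs_infty_gt 0) => n hC n0.
have nn : 0 < n%:R :> R by rewrite ltr0n.
have n1 : 1 <= n%:R :> R by rewrite ler1n.
apply: ub_ereal_sup => _ [z _ <-].
have -> : Q [set w | Z w <= z] = (Phi z)%:E.
  rewrite -normal_prob_Phi -(Z_std _ (measurable_itv _)) /distribution/= /pushforward.
  by congr (Q _); apply/seteqP; split => w /=; rewrite in_itv.
have -> : (second_moment rho)^`()%classic theta = Dcov rho theta.
  have hd := is_derive_second_moment rho_ge0 rho_le (rho_pos 1) C00 a_range theta_range.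
  by rewrite derive1E; exact: derive_val.
rewrite (sigmaHE xi_gaussian xi_stationary xi_centered xi_cov theta01 rho_ge0 rho0); last first.
  by apply/cvg_ex; eexists; exact: cvR.
have -> : [set w | Dcov rho theta * Num.sqrt n%:R *
      (second_moment_estimator xi rho theta theta0 n w - theta)
      / Num.sqrt (asym_var rho theta) <= z] =
    [set w | Dcov rho theta * Num.sqrt n%:R *
      (second_moment_inv rho theta0
        (n%:R^-1 * \sum_(i < n) ar_process xi theta i.+1 w ^+ 2) - theta)
      / Num.sqrt (asym_var rho theta) <= z].
  by apply/seteqP; split => w; rewrite /= /second_moment_estimator big_add1 big_mkord.
have [mE hE] := hC z.
(* The exponent b dominates both 1 - 2a and -1/2, so the three errors merge into a single power of
   n. *)
have hb : 3 * CB * n%:R `^ b + A * n%:R `^ (1 - 2 * a) + C / Num.sqrt n%:R <=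
    (3 * CB + A + C) * n%:R `^ b.
  have c1 : 1 - 2 * a <= b by rewrite /b ler_wpDr ?(ltW dl0)// le_max lexx orbT.
  have c2 : - (1 / 2) <= b by rewrite /b ler_wpDr ?(ltW dl0)// le_max lexx.
  have h1 : A * n%:R `^ (1 - 2 * a) <= A * n%:R `^ b by rewrite ler_pM2l// ler_powR.
  have h2 : C / Num.sqrt n%:R <= C * n%:R `^ b.
    by rewrite ler_pM2l// -powR12_sqrt ?(ltW nn)// -powRN ler_powR// -div1r.
  by rewrite (mulrDl (3 * CB + A)) (mulrDl (3 * CB)); apply: (lerD _ h2); exact: (lerD (lexx _) h1).
rewrite -[P _]fineK ?fin_num_measure// -EFinB abse_EFin lee_fin (le_trans hE)//.
apply: (@le_trans _ _ ((3 * CB + A + C) * n%:R `^ b)).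
  apply: le_trans hb; rewrite lerD2r lerD2r -mulrA ler_pM2l//; exact: hB.
rewrite ler_pM2l// /phi_rate; case: ifPn => [H5|]; first by rewrite ler_powR// b1.
by rewrite -leNgt => H5; rewrite ler_powR// b2.
Qed.
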